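(* The problem ICS-Ext is NP-complete, even when restricted to acyclic implicational bases whose degree is at most $4$, premise-degree at most $4$, conclusion-degree at most $2$, and dimension at most $2$, and with $K=\emptyset$.
   Context: An implicational base $(X,\Sigma)$ is a set of implications $A\to B$ with $A,B\subseteq X$ disjoint; its closed sets are the $C\subseteq X$ with $A\subseteq C\Rightarrow B\subseteq C$ for every $A\to B\in\Sigma$, forming a closure system $\mathcal{C}$. For $x\in X$, $\mathrm{irr}(x)$ is the family of inclusion-maximal closed sets not containing $x$, and $\mathrm{irr}(\mathcal{C})=\bigcup_x\mathrm{irr}(x)$. ICS-Ext: given $(X,\Sigma)$ and $K,F\subseteq X$, decide whether there is $M\in\mathrm{irr}(\mathcal{C})$ with $K\subseteq M$ and $M\cap F=\emptyset$. $\Sigma$ is acyclic if the digraph on $X$ with arcs $ab$ ($a\in A,b\in B$, $A\to B\in\Sigma$) is acyclic. The degree (resp. premise-degree, conclusion-degree) of $\Sigma$ is the maximum over $x\in X$ of the number of implications in which $x$ appears (resp. whose premise contains $x$, whose conclusion contains $x$); the dimension is the maximum size of a premise. *)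

(* Defs.v *)
From mathcomp Require Import all_boot.

Set Implicit Arguments.
Unset Strict Implicit.
Unset Printing Implicit Defensive.

Definition word := seq bool.

(** * Deterministic multitape Turing machines *)

Inductive move := MoveL | MoveN | MoveR.

(* [None] is the blank, [Some (inl b)] an input/output bit, and [Some (inr g)]
   an auxiliary symbol of the machine. *)
Definition cell (aux : finType) : finType := option (bool + aux).

Record machine := Machine {
  state : finType;
  aux : finType;
  ntapes : nat;  (* the machine has [ntapes.+1] tapes *)
  start : state;
  halt : pred state;
  delta : state -> {ffun 'I_ntapes.+1 -> cell aux} ->
          state * {ffun 'I_ntapes.+1 -> cell aux * move} }.

(* Two-way infinite tape: [lhs] lists the cells left of the head, nearest
   first; [rhs] lists the scanned cell and the cells to its right.  All cells
   not listed are blank. *)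
Record tape (aux : finType) := Tape { lhs : seq (cell aux); rhs : seq (cell aux) }.

Definition scan aux (t : tape aux) : cell aux := head None (rhs t).

Definition act aux (t : tape aux) (am : cell aux * move) : tape aux :=
  let: (a, m) := am in
  match m with
  | MoveL => Tape (behead (lhs t)) (head None (lhs t) :: a :: behead (rhs t))
  | MoveN => Tape (lhs t) (a :: behead (rhs t))
  | MoveR => Tape (a :: lhs t) (behead (rhs t))
  end.

Definition config (M : machine) : Type :=
  (state M * {ffun 'I_(ntapes M).+1 -> tape (aux M)})%type.

Definition halted (M : machine) (c : config M) : bool := halt c.1.

(* A halting configuration is a fixpoint of [step]. *)
Definition step (M : machine) (c : config M) : config M :=
  if halted c then c else
  let: (q, w) := delta c.1 [ffun i => scan (c.2 i)] in
  (q, [ffun i => act (c.2 i) (w i)]).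

(* The [i]-th argument is written on the [i]-th tape, with the head on its
   first bit; the other tapes are blank. *)
Definition init (M : machine) (args : seq word) : config M :=
  (start M,
   [ffun i : 'I_(ntapes M).+1 =>
      Tape [::] [seq Some (inl b : bool + aux M) | b <- nth [::] args i]]).

Fixpoint read_bits aux (s : seq (cell aux)) : word :=
  if s is Some (inl b) :: s' then b :: read_bits s' else [::].

(* The output is the block of bits starting at the head of the first tape. *)
Definition output (M : machine) (c : config M) : word := read_bits (rhs (c.2 ord0)).

Definition computes_within (M : machine) (args : seq word) (y : word) (t : nat) :=
  let c := iter t (@step M) (init M args) in halted c /\ output c = y.

(** * Polynomial time, NP, and NP-completeness *)

Definition polytime (I : Type) (args : I -> seq word) (f : I -> word) : Prop :=
  exists (M : machine) (c d : nat), forall i : I,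
    computes_within M (args i) (f i) (c * (sumn (map size (args i))) ^ d + c).

Definition polytime_fun (f : word -> word) : Prop :=
  polytime (fun w => [:: w]) f.

Definition polytime_verifier (V : word -> word -> bool) : Prop :=
  polytime (fun wu : word * word => [:: wu.1; wu.2])
           (fun wu => [:: V wu.1 wu.2]).

Definition language := word -> Prop.

Definition NP (L : language) : Prop :=
  exists V : word -> word -> bool, polytime_verifier V /\
  exists c d : nat, forall w : word,
    L w <-> exists u : word, size u <= c * size w ^ d + c /\ V w u.

(* [codes i w] means that the word [w] encodes the instance [i]; an instance
   may have several codes, e.g. when it contains a set listed in any order. *)
Record problem := Problem {
  instance : Type;
  codes : instance -> word -> Prop;
  yes : instance -> Prop }.

Definition yes_language (P : problem) : language :=
  fun w => exists i : instance P, codes i w /\ yes i.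

Definition restrict (P : problem) (D : instance P -> Prop) : problem :=
  Problem (fun (i : instance P) w => D i /\ codes i w) (@yes P).

Definition in_NP (P : problem) : Prop := NP (yes_language P).

(* The reduction only outputs codes of instances of [P], which matters when
   [P] is a restricted problem. *)
Definition NP_hard (P : problem) : Prop :=
  forall L : language, NP L ->
  exists f : word -> word, polytime_fun f /\
  forall w : word, exists i : instance P, codes i (f w) /\ (L w <-> yes i).

Definition NP_complete (P : problem) : Prop := in_NP P /\ NP_hard P.

(** * Implicational bases *)

Definition implication (X : finType) : finType := ({set X} * {set X})%type.

Definition premise (X : finType) (i : implication X) : {set X} := i.1.
Definition conclusion (X : finType) (i : implication X) : {set X} := i.2.

Section Base.

Variables (X : finType) (Sigma : {set implication X}).

Definition implicational_base : bool :=
  [forall i in Sigma, [disjoint premise i & conclusion i]].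

Definition closed_set (C : {set X}) : bool :=
  [forall i in Sigma, (premise i \subset C) ==> (conclusion i \subset C)].

Definition irr_at (x : X) : {set {set X}} :=
  [set M | maxset (fun C => closed_set C && (x \notin C)) M].

Definition irr : {set {set X}} := \bigcup_(x : X) irr_at x.

Definition arc : rel X :=
  fun a b => [exists i in Sigma, (a \in premise i) && (b \in conclusion i)].

Definition acyclic : Prop := forall c : seq X, cycle arc c -> c = [::].

Definition degree : nat :=
  \max_(x : X) #|[set i in Sigma | (x \in premise i) || (x \in conclusion i)]|.

Definition premise_degree : nat :=
  \max_(x : X) #|[set i in Sigma | x \in premise i]|.

Definition conclusion_degree : nat :=
  \max_(x : X) #|[set i in Sigma | x \in conclusion i]|.

Definition dimension : nat := \max_(i in Sigma) #|premise i|.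

End Base.

(** * The problem ICS-Ext *)

(* The ground set is taken to be {0, ..., n - 1}. *)
Record ics_instance := IcsInstance {
  ground : nat;
  Sigma : {set implication 'I_ground};
  Sigma_base : implicational_base Sigma;
  K : {set 'I_ground};
  F : {set 'I_ground} }.

Definition bits n (A : {set 'I_n}) : word := [seq i \in A | i <- enum 'I_n].

(* The size n in unary, closed by [false]; the characteristic vectors of K and
   F; then, for each implication A -> B, the bit [true] and the characteristic
   vectors of A and B. *)
Definition ics_word n (s : seq (implication 'I_n)) (K F : {set 'I_n}) : word :=
  nseq n true ++ false :: bits K ++ bits F ++
  flatten [seq true :: bits (premise i) ++ bits (conclusion i) | i <- s].

Definition ics_codes (I : ics_instance) (w : word) : Prop :=
  exists s : seq (implication 'I_(ground I)),
    [/\ uniq s, s =i Sigma I & w = ics_word s (K I) (F I)].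

Definition ics_yes (I : ics_instance) : Prop :=
  exists M : {set 'I_(ground I)},
    [/\ M \in irr (Sigma I), K I \subset M & M :&: F I = set0].

Definition ICS_Ext : problem := Problem ics_codes ics_yes.

(* Main.v *)
Require Import Defs.
From mathcomp Require Import all_boot zify.
From Stdlib Require Import FunctionalExtensionality.

(* Membership: a certificate consists of a set [M], of derivations of the
   avoided element [x] from each [y |: M] with [y] outside [M], and of a strict
   order witnessing acyclicity.

   Hardness: if [{a_e, b_e} -> {t_e}] for the edges [e] of a graph and
   [t_0 -> t_1 -> ... -> x], then the maximal closed sets avoiding [x] are the
   maximal independent sets of the graph, and putting [x] in F excludes all
   other meet-irreducible sets.  It thus suffices to find, in a graph of
   maximum degree 4, an independent set that avoids some vertices and dominates
   them.  A clause becomes such a vertex, adjacent to its literals, and a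
   variable becomes a cycle of copies, one per literal occurrence.  Clauses with
   at most four literals suffice to describe a computation: the joint state and
   scanned symbols [z_t] at time [t] are encoded by the variables [z_t >= z],
   so that [z_t <> z] is a clause with two literals, and the cells are
   indexed relative to the heads.

   Polynomial time: all functions needed are built from bounded sums, truncated
   subtraction and access to the input bits.  Such expressions over numbers in
   unary are evaluated by a program on stacks, with values and running time
   bounded by polynomials, and stacks are tapes. *)

Set Implicit Arguments.
Unset Strict Implicit.
Unset Printing Implicit Defensive.

(** * Stack programs *)

(** Expressions contain sums but no recursion, and this shapes both halves. The verifier cannot
    iterate a closure or search for a cycle, so derivations and the order are guessed and merely
    checked. The reduction must give each output bit by index arithmetic, so clauses, edges and
    implications are laid out regularly, with tautologies, absent edges and empty conclusions as
    padding. Indexing cells relative to the heads removes head positions from the clauses: a step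
    clause needs two literals to exclude a value of [z_t] and at most two more, for a cell before
    and after the step or for the value of [z_{t+1}]. The ladder of variables [z_t >= z] likewise
    avoids a long clause offering all values. Degree 4 stems from the four literals of a clause: a
    copy of a variable has at most three neighbours, being used in at most one clause, and an
    element [t_e] occurs in at most two premises and two conclusions. *)

Definition store := nat -> word.

Definition upd (s : store) v x : store := fun i => if i == v then x else s i.

Inductive prog :=
  | Skip
  | Push of nat & bool
  | Pop of nat
  | Seq of prog & prog
  | Case of nat & prog & prog & prog
  | While of nat & prog.

Definition top_case A (x : word) (a b c : A) : A :=
  if x is h :: _ then if h then c else b else a.

(** Costs are those of the compiled code: a [Case] pays for its test and for the jump that closes
    the chosen branch, a loop round for its test and the jump back. *)
Inductive exec : prog -> store -> store -> nat -> Prop :=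
  | ExecSkip s : exec Skip s s 0
  | ExecPush s v b : exec (Push v b) s (upd s v (b :: s v)) 1
  | ExecPop s v : exec (Pop v) s (upd s v (behead (s v))) 1
  | ExecSeq p q s s1 s2 t1 t2 :
      exec p s s1 t1 -> exec q s1 s2 t2 -> exec (Seq p q) s s2 (t1 + t2)
  | ExecCase v p0 p1 p2 s s' t :
      exec (top_case (s v) p0 p1 p2) s s' t -> exec (Case v p0 p1 p2) s s' t.+2
  | ExecWhile0 v p s : s v = [::] -> exec (While v p) s s 1
  | ExecWhileS v p s s1 s2 t1 t2 :
      s v <> [::] -> exec p s s1 t1 -> exec (While v p) s1 s2 t2 ->
      exec (While v p) s s2 (t1 + t2).+2.

Inductive instr :=
  | IPush of nat & bool
  | IPop of nat
  | ICase of nat & nat & nat & nat.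

Definition jump v l := ICase v l l l.

Fixpoint compile p l : seq instr :=
  match p with
  | Skip => [::]
  | Push v b => [:: IPush v b]
  | Pop v => [:: IPop v]
  | Seq p q => let cp := compile p l in cp ++ compile q (l + size cp)
  | Case v p0 p1 p2 =>
      let c0 := compile p0 l.+1 in
      let l1 := l.+1 + (size c0).+1 in
      let c1 := compile p1 l1 in
      let l2 := l1 + (size c1).+1 in
      let c2 := compile p2 l2 in
      let e := l2 + (size c2).+1 in
      ICase v l.+1 l1 l2 ::
        c0 ++ jump v e :: c1 ++ jump v e :: c2 ++ [:: jump v e]
  | While v p =>
      let c := compile p l.+1 in
      ICase v (l + (size c).+2) l.+1 l.+1 :: c ++ [:: jump v l]
  end.

Definition fetch code pc := nth (jump 0 0) code pc.

(** Jump targets are clamped to [size code], the halting position, so that the program counter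
    ranges over a finite set. *)
Definition fstep code (c : nat * store) : nat * store :=
  let: (pc, s) := c in
  if size code <= pc then c else
  match fetch code pc with
  | IPush v b => (pc.+1, upd s v (b :: s v))
  | IPop v => (pc.+1, upd s v (behead (s v)))
  | ICase v l0 l1 l2 => (minn (top_case (s v) l0 l1 l2) (size code), s)
  end.

Lemma fetch_cat pre i post : fetch (pre ++ i :: post) (size pre) = i.
Proof. by rewrite /fetch nth_cat ltnn subnn. Qed.

Lemma fstep_jump pre post v l s :
  l <= size (pre ++ jump v l :: post) ->
  fstep (pre ++ jump v l :: post) (size pre, s) = (l, s).
Proof.
move=> lec; rewrite /fstep fetch_cat size_cat /= leqNgt ltnNge.
rewrite -ltnNge addnS ltnS leq_addr /= /top_case.
rewrite size_cat /= in lec.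
by congr (_, _); case: (s v) => [|[] ?]; lia.
Qed.

Lemma fstep_case pre post v l0 l1 l2 s :
  top_case (s v) l0 l1 l2 <= size (pre ++ ICase v l0 l1 l2 :: post) ->
  fstep (pre ++ ICase v l0 l1 l2 :: post) (size pre, s) =
  (top_case (s v) l0 l1 l2, s).
Proof.
move=> lec; rewrite /fstep fetch_cat size_cat /=.
rewrite size_cat /= in lec.
by rewrite leqNgt addnS ltnS leq_addr /=; congr (_, _); lia.
Qed.

Lemma size_cons A (x : A) s : size (x :: s) = (size s).+1. Proof. by []. Qed.

(** Jump targets are absolute addresses, so the induction needs the compiled code at an arbitrary
    place between [pre] and [post]. *)
Lemma compile_exec p s s' t : exec p s s' t -> forall pre post,
  iter t (fstep (pre ++ compile p (size pre) ++ post)) (size pre, s) =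
  (size pre + size (compile p (size pre)), s').
Proof.
pose sizeE := (size_cat, size_cons, size_rcons).
pose catR := (=^~ @catA instr, @cat_cons instr, @cat_rcons instr).
elim=> {p s s' t}.
- by move=> s pre post; rewrite addn0.
- move=> s v b pre post; rewrite /= fetch_cat size_cat /=.
  by rewrite leqNgt addnS ltnS leq_addr /= addn1.
- move=> s v pre post; rewrite /= fetch_cat size_cat /=.
  by rewrite leqNgt addnS ltnS leq_addr /= addn1.
- move=> p q s s1 s2 t1 t2 _ IHp _ IHq pre post.
  rewrite addnC iterD /= -catA IHp.
  have := IHq (pre ++ compile p (size pre)) post.
  by rewrite size_cat -!catA => ->; rewrite size_cat addnA.
- move=> v p0 p1 p2 s s' t _ IH pre post /=.
  set c0 := compile p0 _; set l1 := (_ + (size c0).+1).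
  set c1 := compile p1 _; set l2 := (_ + (size c1).+1).
  set c2 := compile p2 _; set e := (_ + (size c2).+1).
  rewrite -iterS iterSr fstep_case; last first.
    rewrite /top_case !sizeE /= /e /l2 /l1.
    by case: (s v) => [|[] ?]; lia.
  set code := pre ++ _.
  have szc : size code = e + size post.
    by rewrite /code !sizeE /= /e /l2 /l1; lia.
  have endj pre' post' x : code = pre' ++ jump v e :: post' ->
     fstep code (size pre', x) = (e, x).
    by move=> E; rewrite E fstep_jump // -E szc leq_addr.
  have -> : size pre + (size (c0 ++ jump v e :: c1 ++ jump v e :: c2 ++
              [:: jump v e])).+1 = e.
    by rewrite !sizeE /= /e /l2 /l1; lia.
  rewrite /top_case in IH *; case: (s v) IH => [|[] ?] IH /=.
  + have := IH (rcons pre (ICase v (size pre).+1 l1 l2))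
      (jump v e :: c1 ++ jump v e :: c2 ++ jump v e :: post).
    rewrite size_rcons -/c0 => IH'.
    have E : code = rcons pre (ICase v (size pre).+1 l1 l2) ++ c0 ++
        jump v e :: c1 ++ jump v e :: c2 ++ jump v e :: post.
      by rewrite /code !catR.
    rewrite -E in IH'; rewrite IH'.
    rewrite -(endj (rcons pre (ICase v (size pre).+1 l1 l2) ++ c0)
      (c1 ++ jump v e :: c2 ++ jump v e :: post)); last by rewrite E !catR.
    by rewrite size_cat size_rcons.
  + set pre' := rcons pre (ICase v (size pre).+1 l1 l2) ++ c0 ++ jump v e ::
      c1 ++ [:: jump v e].
    have sz' : size pre' = l2.
      by rewrite /pre' !sizeE /= /l2 /l1; lia.
    have := IH pre' (jump v e :: post).
    have E : code = pre' ++ c2 ++ jump v e :: post.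
      by rewrite /code /pre' !catR.
    rewrite sz' -/c2 -E => ->.
    rewrite -(endj (pre' ++ c2) post); last by rewrite E !catR.
    by rewrite size_cat sz'.
  + set pre' := rcons pre (ICase v (size pre).+1 l1 l2) ++ c0 ++ [:: jump v e].
    have sz' : size pre' = l1.
      by rewrite /pre' !sizeE /= /l1; lia.
    have := IH pre' (jump v e :: c2 ++ jump v e :: post).
    have E : code = pre' ++ c1 ++ jump v e :: c2 ++ jump v e :: post.
      by rewrite /code /pre' !catR.
    rewrite sz' -/c1 -E => ->.
    rewrite -(endj (pre' ++ c1) (c2 ++ jump v e :: post)); last by rewrite E !catR.
    by rewrite size_cat sz'.
- move=> v p s sv0 pre post; rewrite [LHS]/(fstep _ _) [compile (While _ _) _]/=.
  have := fstep_case (pre := pre) (post := (compile p (size pre).+1 ++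
    [:: jump v (size pre)]) ++ post) (v := v)
    (l0 := size pre + (size (compile p (size pre).+1)).+2)
    (l1 := (size pre).+1) (l2 := (size pre).+1) (s := s).
  rewrite sv0 /= => -> //; last by rewrite !size_cat /= !size_cat /=; lia.
  by rewrite size_cat /= addn1.
- move=> v p s s1 s2 t1 t2 svN _ IHp _ IHw pre post.
  rewrite -addnS -addSn addnC iterD.
  have -> : iter t1.+1 (fstep (pre ++ compile (While v p) (size pre) ++ post))
     (size pre, s) = ((size pre).+1 + size (compile p (size pre).+1), s1).
    rewrite iterSr [compile (While _ _) _]/= cat_cons fstep_case.
      set i := ICase _ _ _ _.
      have := IHp (rcons pre i) (jump v (size pre) :: post).
      rewrite size_rcons -cats1 -!catA /= => <-.
      by rewrite /top_case; case: (s v) svN => [|[]].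
    rewrite /top_case size_cat /= !size_cat /=.
    by case: (s v) svN => [|[] ?] // _; lia.
  rewrite iterSr -(IHw pre post); congr iter.
  rewrite [compile (While _ _) _]/=; set i := ICase _ _ _ _.
  have := @fstep_jump (rcons pre i ++ compile p (size pre).+1) post v (size pre) s1.
  rewrite !sizeE !catR => -> //; lia.
Qed.

(** * Compilation to Turing machines *)

Definition instr_tape i :=
  match i with IPush v _ => v | IPop v => v | ICase v _ _ _ => v end.

Section Machine.

Variable code : seq instr.

(** The sum is a crude but convenient upper bound for all stack numbers in the code. *)
Let N := sumn (map instr_tape code).
Let L := size code.

Definition symbol : finType := cell void.

(** The boolean of the state is a phase used by [IPush] only: the head first moves left onto a blank
    cell and then writes. [IPop] erases before moving right, which keeps everything left of the head
    blank. *)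
Definition code_delta (q : 'I_L.+1 * bool) (r : {ffun 'I_N.+1 -> symbol}) :
    ('I_L.+1 * bool) * {ffun 'I_N.+1 -> symbol * move} :=
  match fetch code q.1 with
  | IPush v b =>
      if q.2 then ((inord q.1.+1, false),
        [ffun i : 'I_N.+1 => (if val i == v then Some (inl b) else r i, MoveN)])
      else ((q.1, true),
        [ffun i : 'I_N.+1 => (r i, if val i == v then MoveL else MoveN)])
  | IPop v => ((inord q.1.+1, false),
      [ffun i : 'I_N.+1 => if val i == v then (None, MoveR) else (r i, MoveN)])
  | ICase v l0 l1 l2 =>
      let l := match r (inord v) with
               | Some (inl true) => l2 | Some (inl false) => l1 | _ => l0 end in
      ((inord (minn l L), false), [ffun i : 'I_N.+1 => (r i, MoveN)])
  end.

Definition code_machine : machine :=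
  @Machine ('I_L.+1 * bool)%type void N (ord0, false)
    (fun q => val q.1 == L) code_delta.

(** Contents are compared cell by cell because a head resting on an empty stack writes an explicit
    blank: the lists agree only up to trailing blanks. *)
Definition tape_stack (t : tape void) (s : word) :=
  (forall k, nth None (lhs t) k = None) /\
  (forall k, nth None (rhs t) k = nth None [seq Some (inl b) | b <- s] k).

Lemma tape_stack_scan t s : tape_stack t s ->
  scan t = nth None [seq Some (inl b) | b <- s] 0.
Proof. by case=> _ /(_ 0) <-; rewrite nth0. Qed.

Lemma tape_stack_stay t s : tape_stack t s -> tape_stack (act t (scan t, MoveN)) s.
Proof.
by case=> Hl Hr; split=> //= -[|k] /=; rewrite -Hr // ?nth_behead // nth0.
Qed.

Lemma tape_stack_pop t s : tape_stack t s -> tape_stack (act t (None, MoveR)) (behead s).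
Proof.
case=> Hl Hr; split=> [[|k]|k] //=.
by rewrite nth_behead Hr; case: s {Hr} => //=; rewrite !nth_nil.
Qed.

Lemma tape_stack_push t s b : tape_stack t s ->
  tape_stack (act (act t (scan t, MoveL)) (Some (inl b), MoveN)) (b :: s).
Proof.
case=> Hl Hr; split=> [k|[|[|k]]] //=; first by rewrite nth_behead.
  by rewrite -Hr nth0.
by rewrite nth_behead Hr.
Qed.

Definition represents (c : config code_machine) (d : nat * store) :=
  [/\ val c.1.1 = d.1, c.1.2 = false & forall i, tape_stack (c.2 i) (d.2 i)].

Lemma instr_tape_bound pc : pc < L -> instr_tape (fetch code pc) <= N.
Proof.
rewrite /N /fetch /L; elim: code pc => [|i c IH] [|pc] //= lt_pc.
  exact: leq_addr.
exact: leq_trans (IH _ lt_pc) (leq_addl _ _).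
Qed.

Lemma fstep_sim c d : represents c d ->
  exists2 k, k <= 2 & represents (iter k (@step code_machine) c) (fstep code d).
Proof.
case: d c => pc s [[q ph] T] [/= Eq Eph HT]; subst ph.
case: leqP => [le_L|lt_L]; first by exists 0 => //; split.
have := instr_tape_bound lt_L.
have nh : (nat_of_ord q == L) = false by rewrite Eq ltn_eqF.
have st ph U : @step code_machine ((q, ph), U) =
   let: (q', w) := code_delta (q, ph) [ffun i => scan (U i)] in
   (q', [ffun i => act (U i) (w i)]).
  by rewrite /step /halted /= nh.
case Ei : (fetch code pc) => [v b|v|v l0 l1 l2] /= ltv.
- exists 2 => //=; rewrite st /code_delta /= Eq Ei /= st /code_delta /= Eq Ei /=.
  split=> //=; first by rewrite inordK.
  move=> i; rewrite !ffunE /upd; case: eqP => [Ev|_].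
    by rewrite -Ev; apply: tape_stack_push.
  by apply: tape_stack_stay; apply: tape_stack_stay.
- exists 1 => //=; rewrite st /code_delta /= Eq Ei /=.
  split=> //=; first by rewrite inordK.
  move=> i; rewrite !ffunE /upd; case: eqP => [Ev|_].
    by rewrite -Ev; apply: tape_stack_pop.
  exact: tape_stack_stay.
- exists 1 => //=; rewrite st /code_delta /= Eq Ei /=.
  split=> //=; last by move=> i; rewrite !ffunE; apply: tape_stack_stay.
  rewrite inordK; last by rewrite ltnS geq_minr.
  congr minn; rewrite ffunE (tape_stack_scan (HT _)) inordK //.
  by case: (s v) => [|[] ?].
Qed.

Lemma iter_fstep_sim n c d : represents c d ->
  exists2 k, k <= n.*2 &
    represents (iter k (@step code_machine) c) (iter n (fstep code) d).
Proof.
elim: n d c => [|n IH] d c Rc; first by exists 0.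
have [k k2 Rk] := fstep_sim Rc; have [k' le_k' Rk'] := IH _ _ Rk.
exists (k' + k); last by rewrite iterSr iterD.
by rewrite doubleS -addn2 leq_add.
Qed.

End Machine.

Lemma read_bits_stack (r : seq symbol) (s : word) :
  (forall k, nth None r k = nth None [seq Some (inl b) | b <- s] k) ->
  read_bits r = s.
Proof.
elim: s r => [|b s IH] [|x r] //= H; try by move: (H 0).
  by move: (H 0) => /= ->.
by move: (H 0) => /= ->; rewrite (IH r) // => k; apply: (H k.+1).
Qed.

Lemma iter_step_halted M (c : config M) k : halted c -> iter k (@step M) c = c.
Proof. by move=> hc; elim: k => //= k ->; rewrite /step hc. Qed.

Definition arg_store (args : seq word) : store := nth [::] args.

(** An instruction costs at most two machine steps, and surplus steps are harmless since halting
    configurations are fixpoints. *)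
Lemma exec_computes p args s t n :
  exec p (arg_store args) s t -> t.*2 <= n ->
  computes_within (code_machine (compile p 0)) args (s 0) n.
Proof.
move=> Ex le_n.
have R0 : @represents (compile p 0) (init (code_machine (compile p 0)) args)
            (0, arg_store args).
  by split=> //= i; rewrite ffunE; split=> //= k; rewrite nth_nil.
have [k le_k] := iter_fstep_sim t R0.
have := compile_exec Ex [::] [::]; rewrite /= cats0 => ->.
set c := iter k _ _ => -[/= Ec1 _ Ec2].
have hc : halted c by rewrite /halted /= Ec1.
have le_kn : k <= n by apply: leq_trans le_n.
rewrite /computes_within -(subnK le_kn) iterD -/c iter_step_halted //.
by split=> //; apply: read_bits_stack; case: (Ec2 ord0).
Qed.

(** * Bounded-sum expressions *)

Definition bind (r : nat -> nat) x v : nat -> nat := fun y => if y == x then v else r y.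

Inductive expr :=
  | EVar of nat
  | EConst of nat
  | EAdd of expr & expr
  | ESub of expr & expr
  | ESum of nat & expr & expr
  | EBit of bool & expr
  | ELen of bool.

Fixpoint eval e (w u : word) (r : nat -> nat) : nat :=
  match e with
  | EVar x => r x
  | EConst c => c
  | EAdd a b => eval a w u r + eval b w u r
  | ESub a b => eval a w u r - eval b w u r
  | ESum x a b => \sum_(i < eval a w u r) eval b w u (bind r x i)
  | EBit i a => nth false (if i then u else w) (eval a w u r)
  | ELen i => size (if i then u else w)
  end.

Definition movetop a b :=
  Case a Skip (Seq (Pop a) (Push b false)) (Seq (Pop a) (Push b true)).
Definition clear a := While a (Pop a).
Definition transfer a b := While a (movetop a b).
(* [copy a b c] pushes the length of stack [a] in unary on [b], using [c] as scratch. *)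
Definition copy a b c :=
  Seq (While a (Seq (movetop a c) (Push b true))) (transfer c a).

Lemma exec_eq p s s1 s2 t1 t2 : exec p s s1 t1 -> s1 = s2 -> t1 = t2 -> exec p s s2 t2.
Proof. by move=> H <- <-. Qed.

Ltac upd_cases :=
  rewrite /upd;
  repeat match goal with
  | |- context [if ?a == ?b then _ else _] => case: (@eqP nat a b) => ?
  end; subst; try (exfalso; (congruence || lia)).

Ltac store_eq := apply: functional_extensionality => ?; upd_cases => //=.

Lemma exec_movetop a b s h l : a != b -> s a = h :: l ->
  exec (movetop a b) s (upd (upd s a l) b (h :: s b)) 4.
Proof.
move=> ab sa; apply: (@ExecCase _ _ _ _ _ _ 2); rewrite sa /=.
have Hp := ExecPop s a; rewrite sa /= in Hp.
have Hq c := ExecPush (upd s a l) b c.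
have Eb : upd s a l b = s b by rewrite /upd eq_sym (negbTE ab).
by case: h sa Hp => sa Hp; apply: (ExecSeq Hp); rewrite -Eb; apply: Hq.
Qed.

Lemma exec_clear a s : exec (clear a) s (upd s a [::]) (3 * size (s a)).+1.
Proof.
move E: (s a) => l; elim: l s E => [|h l IH] s E.
  by apply: exec_eq (ExecWhile0 _ E) _ _ => //; store_eq.
apply: exec_eq (ExecWhileS _ (ExecPop s a) (IH _ _)) _ _.
- by rewrite E.
- by rewrite /upd eqxx E.
- by store_eq.
- by rewrite /=; lia.
Qed.

Lemma exec_transfer a b s : a != b ->
  exec (transfer a b) s (upd (upd s a [::]) b (rev (s a) ++ s b)) (6 * size (s a)).+1.
Proof.
move=> ab; move E: (s a) => l; elim: l s E => [|h l IH] s E.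
  by apply: exec_eq (ExecWhile0 _ E) _ _ => //; store_eq.
apply: exec_eq (ExecWhileS _ (exec_movetop ab E) (IH _ _)) _ _.
- by rewrite E.
- by rewrite /upd (negbTE ab) eqxx.
- rewrite rev_cons cat_rcons; move/eqP: ab => ab; store_eq.
- by rewrite /=; lia.
Qed.

Lemma exec_copy a b c s : a != b -> a != c -> b != c -> s c = [::] ->
  exec (copy a b c) s (upd s b (nseq (size (s a)) true ++ s b)) (13 * size (s a) + 2).
Proof.
move=> ab ac bc sc.
have H l s0 : s0 a = l ->
  exec (While a (Seq (movetop a c) (Push b true))) s0
    (upd (upd (upd s0 a [::]) b (nseq (size l) true ++ s0 b)) c (rev l ++ s0 c))
    (7 * size l).+1.
  elim: l s0 => [|h l IH] s0 E.
    by apply: exec_eq (ExecWhile0 _ E) _ _ => //; store_eq.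
  apply: exec_eq
    (ExecWhileS _ (ExecSeq (exec_movetop ac E) (ExecPush _ _ _)) (IH _ _)) _ _.
  - by rewrite E.
  - by rewrite /upd (negbTE ab) (negbTE ac) eqxx.
  - have nE : forall A (x : A) n m, nseq n x ++ x :: m = x :: nseq n x ++ m.
      by move=> A x n m; elim: n => //= n ->.
    move/eqP: ab => ab; move/eqP: ac => ac; move/eqP: bc => bc.
    by store_eq; rewrite ?nE // rev_cons cat_rcons.
  - by rewrite /=; lia.
apply: exec_eq (ExecSeq (H _ _ erefl) (exec_transfer _ _)) _ _.
- by rewrite eq_sym.
- move/eqP: ab => ab; move/eqP: ac => ac; move/eqP: bc => bc.
  by store_eq; rewrite sc ?cats0 ?revK.
- by rewrite {1}/upd eqxx size_cat size_rev sc /=; lia.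
Qed.

(** [rho] assigns stacks to variables, stacks from [k] on are scratch, and the value is pushed in
    unary on [d], on top of what is there. Hence addition is sequencing, and a sum accumulates in
    [d] while [k] counts the remaining rounds and [k.+1] holds the summation index. *)
Fixpoint code_expr e (rho : nat -> nat) k d : prog :=
  match e with
  | EVar x => copy (rho x) d k
  | EConst c => iter c (Seq (Push d true)) Skip
  | EAdd a b => Seq (code_expr a rho k d) (code_expr b rho k d)
  | ESub a b =>
      Seq (code_expr a rho k.+1 k) (Seq (code_expr b rho k.+2 k.+1)
      (Seq (While k.+1 (Seq (Pop k.+1) (Pop k))) (transfer k d)))
  | ESum x a b =>
      Seq (code_expr a rho k.+1 k)
      (Seq (While k (Seq (Pop k)
             (Seq (code_expr b (bind rho x k.+1) k.+2 d) (Push k.+1 true))))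
           (clear k.+1))
  | EBit i a =>
      Seq (code_expr a rho k.+1 k)
      (Seq (While k (Seq (Pop k) (movetop i k.+1)))
      (Seq (Case i Skip Skip (Push d true)) (transfer k.+1 i)))
  | ELen i => copy i d k
  end.

(** The index of a sum stays below the number of terms, so the body is measured at the input bound
    enlarged by that number. *)
Fixpoint value_bound e X : nat :=
  match e with
  | EVar x => X
  | EConst c => c
  | EAdd a b => value_bound a X + value_bound b X
  | ESub a b => value_bound a X
  | ESum x a b => value_bound a X * value_bound b (X + value_bound a X)
  | EBit i a => 1
  | ELen i => X
  end.

Fixpoint time_bound e X : nat :=
  match e with
  | EVar x => 13 * X + 2
  | EConst c => c
  | EAdd a b => time_bound a X + time_bound b X
  | ESub a b => time_bound a X + time_bound b X + 4 * value_bound b X +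
                6 * value_bound a X + 2
  | ESum x a b => time_bound a X +
      value_bound a X * (time_bound b (X + value_bound a X) + 7) + 2
  | EBit i a => time_bound a X + 7 * value_bound a X + 6 * X + 5
  | ELen i => 13 * X + 2
  end.

Definition bounded (w u : word) (r : nat -> nat) X :=
  size w + size u <= X /\ forall x, r x <= X.

Lemma bounded_word w u r X (i : bool) : bounded w u r X -> size (if i then u else w) <= X.
Proof. by case=> H _; case: i; lia. Qed.

Lemma bounded_bind w u r X x i m : bounded w u r X -> i < m -> bounded w u (bind r x i) (X + m).
Proof.
case=> H1 H2 lt_i; split=> [|y]; first by lia.
by rewrite /bind; case: eqP => _; first lia; have := H2 y; lia.
Qed.

Lemma eval_bound e w u r X : bounded w u r X -> eval e w u r <= value_bound e X.
Proof.
elim: e r X => [x|c|a IHa b IHb|a IHa b IHb|x a IHa b IHb|i a IHa|i] r X B //=.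
- by case: B.
- by rewrite leq_add ?IHa ?IHb.
- by apply: leq_trans (leq_subr _ _) (IHa _ _ B).
- set m := eval a w u r.
  have le_m : m <= value_bound a X by apply: IHa.
  apply: (@leq_trans (\sum_(i < m) value_bound b (X + value_bound a X))).
    apply: leq_sum => i _; apply: IHb; apply: bounded_bind => //.
    exact: leq_trans le_m.
  by rewrite sum_nat_const card_ord leq_mul2r le_m orbT.
- by case: nth.
- exact: bounded_word B.
Qed.

Definition expr_inv (s : store) w u (r rho : nat -> nat) k d :=
  [/\ s 0 = w, s 1 = u, forall x, s (rho x) = nseq (r x) true,
      forall x, 2 <= rho x < k /\ rho x <> d & 2 <= d < k] /\
  forall v, k <= v -> s v = [::].

Lemma expr_inv_word s w u r rho k d (i : bool) :
  expr_inv s w u r rho k d -> s i = if i then u else w.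
Proof. by case=> -[]; case: i. Qed.

Lemma exec_code_expr e s w u r rho k d X :
  expr_inv s w u r rho k d -> bounded w u r X ->
  exists2 t, t <= time_bound e X &
    exec (code_expr e rho k d) s (upd s d (nseq (eval e w u r) true ++ s d)) t.
Proof.
elim: e s r rho k d X
  => [x|c|a IHa b IHb|a IHa b IHb|x a IHa b IHb|i a IHa|i] s r rho k d X I B /=.
- have [[s0 s1 sr Hr Hd] Hk] := I; have [_ rX] := B; have [rx1 rx2] := Hr x.
  eexists; last first.
    have := @exec_copy (rho x) d k s; rewrite sr size_nseq; apply.
    + exact/eqP.
    + by apply/eqP; lia.
    + by apply/eqP; lia.
    + exact: Hk.
  by rewrite leq_add2r leq_mul2l rX.
- exists c => //; elim: c s {I} => [|c IH] s /=.
    by apply: exec_eq (ExecSkip s) _ _ => //; store_eq.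
  apply: exec_eq (ExecSeq (ExecPush s d true) (IH _)) _ _ => //.
  rewrite /upd eqxx; apply: functional_extensionality => j.
  by case: eqP => // _; elim: (c) => //= n ->.
- have [t1 le1 E1] := IHa _ _ _ _ _ _ I B.
  set s1 := upd s d _ in E1.
  have I1 : expr_inv s1 w u r rho k d.
    case: I => -[s0 s1' sr Hr Hd] Hk; rewrite /s1 /upd; split; first split=> //=.
    + by case: eqP => // ?; lia.
    + by case: eqP => // ?; lia.
    + by move=> x; case: eqP => // ?; have := Hr x; lia.
    + by move=> v le_v; case: eqP => [?|_]; [lia | apply: Hk].
  have [t2 le2 E2] := IHb _ _ _ _ _ _ I1 B.
  exists (t1 + t2); first exact: leq_add.
  apply: exec_eq (ExecSeq E1 E2) _ _ => //.
  rewrite /s1 /upd eqxx; apply: functional_extensionality => j.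
  by case: eqP => // _; rewrite catA -nseqD addnC.
- have [[s0 s1 sr Hr Hd] Hk] := I.
  have I1 : expr_inv s w u r rho k.+1 k.
    split; first split=> //; try by [lia | move=> x; have := Hr x; lia].
    by move=> v le_v; apply: Hk; lia.
  have [t1 le1] := IHa _ _ _ _ _ _ I1 B; rewrite Hk // cats0.
  set va := eval a w u r => E1; set s2 := upd s k _ in E1.
  have I2 : expr_inv s2 w u r rho k.+2 k.+1.
    rewrite /s2 /upd; split; first split=> //; try by [lia | case: eqP => // ?; lia | move=> x; have := Hr x; lia].
      by move=> x; case: eqP => // ?; have := Hr x; lia.
    by move=> v le_v; case: eqP => [?|_]; [lia | apply: Hk; lia].
  have [t2 le2] := IHb _ _ _ _ _ _ I2 B.
  have -> : s2 k.+1 = [::] by rewrite /s2 /upd; case: eqP => [?|_]; [lia | apply: Hk].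
  rewrite cats0; set vb := eval b w u r => E2; set s3 := upd s2 _ _ in E2.
  (* Popping an empty stack does nothing, which is exactly the truncation of the subtraction. *)
  have Hloop m n s' : s' k.+1 = nseq n true -> s' k = nseq m true ->
      exec (While k.+1 (Seq (Pop k.+1) (Pop k))) s'
        (upd (upd s' k.+1 [::]) k (nseq (m - n) true)) (4 * n).+1.
    elim: n m s' => [|n IH] m s' En Em.
      rewrite subn0; apply: exec_eq (ExecWhile0 _ En) _ _ => //.
      by store_eq.
    apply: exec_eq (ExecWhileS _ (ExecSeq (ExecPop _ _) (ExecPop _ _)) (IH m.-1 _ _ _)) _ _.
    - by rewrite En.
    - rewrite /upd; case: eqP => [?|_]; first lia.
      by rewrite eqxx En.
    - rewrite /upd eqxx; case: eqP => [?|_]; first lia.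
      by rewrite Em; case: (m).
    - have -> : m.-1 - n = m - n.+1 by lia.
      by store_eq.
    - lia.
  have E3 : exec (While k.+1 (Seq (Pop k.+1) (Pop k))) s3
      (upd (upd s3 k.+1 [::]) k (nseq (va - vb) true)) (4 * vb).+1.
    apply: Hloop; first by rewrite /s3 /upd eqxx.
    by rewrite /s3 /s2 /upd eqxx; case: eqP => // ?; lia.
  set s4 := upd _ k _ in E3.
  have kd : k != d by apply/eqP; lia.
  have E4 := exec_transfer s4 kd.
  eexists; last first.
    apply: exec_eq (ExecSeq E1 (ExecSeq E2 (ExecSeq E3 E4))) _ erefl.
    have -> : s4 k = nseq (va - vb) true by rewrite /s4 /upd eqxx.
    have -> : rev (nseq (va - vb) true) = nseq (va - vb) true.
      by elim: (va - vb) => //= n IH; rewrite rev_cons IH; elim: (n) => //= ? ->.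
    have Hk0 := Hk k (leqnn _); have Hk1 := Hk k.+1 (leqnSn _).
    by rewrite /s4 /s3 /s2; store_eq.
  have -> : size (s4 k) = va - vb by rewrite /s4 /upd eqxx size_nseq.
  have := eval_bound a B; have := eval_bound b B; rewrite -/va -/vb; lia.
- have [[s0 s1 sr Hr Hd] Hk] := I.
  have I1 : expr_inv s w u r rho k.+1 k.
    split; first split=> //; try by [lia | move=> y; have := Hr y; lia].
    by move=> v le_v; apply: Hk; lia.
  have [t1 le1] := IHa _ _ _ _ _ _ I1 B; rewrite Hk // cats0.
  have := eval_bound a B.
  set va := eval a w u r => le_va E1; set s2 := upd s k _ in E1.
  set Y := X + value_bound a X.
  have Hloop n i : i + n = va -> exists2 t, t <= n * (time_bound b Y + 4) + 1 &
     exec (While k (Seq (Pop k)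
       (Seq (code_expr b (bind rho x k.+1) k.+2 d) (Push k.+1 true))))
     (upd (upd (upd s k (nseq n true)) k.+1 (nseq i true)) d
        (nseq (\sum_(j < i) eval b w u (bind r x j)) true ++ s d))
     (upd (upd s k.+1 (nseq va true)) d
        (nseq (\sum_(j < va) eval b w u (bind r x j)) true ++ s d)) t.
    elim: n i => [|n IH] i Ein.
      have -> : i = va by lia.
      exists 1 => //; apply: exec_eq (ExecWhile0 _ _) _ _ => //; first by upd_cases.
      by have Hk0 := Hk k (leqnn _); store_eq.
    have [t le_t Et] := IH i.+1 (ltac:(lia)).
    set s3 := upd _ d _; set s4 := upd s3 k (behead (s3 k)).
    have I3 : expr_inv s4 w u (bind r x i) (bind rho x k.+1) k.+2 d.
      rewrite /s4 /s3; split; first split.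
      - by upd_cases.
      - by upd_cases.
      - by move=> y; rewrite /bind; have := Hr y; case: (y =P x) => _ ?; upd_cases.
      - by move=> y; rewrite /bind; case: (y =P x) => _; have := Hr y; lia.
      - lia.
      - by move=> v le_v; upd_cases; apply: Hk; lia.
    have B3 : bounded w u (bind r x i) Y by apply: bounded_bind => //; lia.
    have [t3 le3 E3] := IHb _ _ _ _ _ _ I3 B3.
    set s5 := upd s4 d _ in E3.
    have E4 := ExecSeq (ExecPop s3 k) (ExecSeq E3 (ExecPush s5 k.+1 true)).
    exists (1 + (t3 + 1) + t).+2; first by nia.
    apply: (ExecWhileS _ E4); first by rewrite /s3; upd_cases.
    move: Et; set s6 := upd _ d _; suff -> : s6 = upd s5 k.+1 (true :: s5 k.+1) by [].
    rewrite /s6 /s5 /s4 /s3 big_ord_recr /=; store_eq.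
    by rewrite catA -nseqD addnC.
  have [t2 le2 E2] := Hloop va 0 erefl.
  rewrite big_ord0 in E2.
  move: E2; set s3 := upd _ d _; have -> : s3 = s2.
    have Hk1 := Hk k.+1 (leqnSn _); by rewrite /s3 /s2; store_eq.
  set s4 := upd _ d _ => E2.
  have E3 := exec_clear k.+1 s4.
  exists (t1 + (t2 + (3 * size (s4 k.+1)).+1)).
    have -> : size (s4 k.+1) = va by rewrite /s4; upd_cases; rewrite size_nseq.
    rewrite -/Y; nia.
  apply: exec_eq (ExecSeq E1 (ExecSeq E2 E3)) _ _ => //.
  have Hk1 := Hk k.+1 (leqnSn _); by rewrite /s4; store_eq.
- have [[s0 s1 sr Hr Hd] Hk] := I.
  have I1 : expr_inv s w u r rho k.+1 k.
    split; first split=> //; try by [lia | move=> y; have := Hr y; lia].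
    by move=> v le_v; apply: Hk; lia.
  have [t1 le1] := IHa _ _ _ _ _ _ I1 B; rewrite Hk // cats0.
  have := eval_bound a B.
  set va := eval a w u r => le_va E1; set s2 := upd s k _ in E1.
  have szx := bounded_word i B; set x := (if i then u else w) in szx *.
  have si : s i = x := expr_inv_word i I.
  have i2 : i < 2 by case: (i).
  (* Once the word is exhausted [movetop] does nothing; the test that follows then sees an empty
     stack, in accordance with the default [false] of [nth]. *)
  have Hloop n y z s' : s' k = nseq n true -> s' i = y -> s' k.+1 = z ->
    exists2 t, t <= 7 * n + 1 &
    exec (While k (Seq (Pop k) (movetop i k.+1))) s'
     (upd (upd (upd s' k [::]) i (drop n y)) k.+1 (rev (take n y) ++ z)) t.
    elim: n y z s' => [|n IH] y z s' En Ey Ez.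
      rewrite take0 drop0; exists 1 => //.
      by apply: exec_eq (ExecWhile0 _ _) _ _ => //; store_eq.
    set s'' := upd s' k (behead (s' k)).
    have En' : s'' k = nseq n true by rewrite /s''; upd_cases; rewrite En.
    have Ey' : s'' i = y by rewrite /s''; upd_cases.
    have Ez' : s'' k.+1 = z by rewrite /s''; upd_cases.
    case: y Ey Ey' => [|h y] Ey Ey'.
      have [t le_t Et] := IH _ _ _ En' Ey' Ez'.
      exists (1 + 2 + t).+2; first lia.
      apply: exec_eq (ExecWhileS _ (ExecSeq (ExecPop _ _) (ExecCase _)) Et) _ erefl.
      - by rewrite En.
      - by rewrite -/s'' Ey'; apply: ExecSkip.
      - by rewrite /s''; store_eq.
    have ik : i != k.+1 :> nat by lia.
    have Em := exec_movetop ik Ey'.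
    set s3 := upd _ k.+1 _ in Em.
    have [t le_t Et] : exists2 t, t <= 7 * n + 1 &
        exec (While k (Seq (Pop k) (movetop i k.+1))) s3
        (upd (upd (upd s3 k [::]) i (drop n y)) k.+1 (rev (take n y) ++ h :: z)) t.
      by apply: IH; rewrite /s3; upd_cases; rewrite ?Ez'.
    exists (1 + 4 + t).+2; first lia.
    apply: exec_eq (ExecWhileS _ (ExecSeq (ExecPop _ _) Em) Et) _ erefl.
      by rewrite En.
    by rewrite /s3 /s''; store_eq; rewrite rev_cons cat_rcons.
  have [t2 le2 E2] : exists2 t, t <= 7 * va + 1 &
    exec (While k (Seq (Pop k) (movetop i k.+1))) s2
     (upd (upd (upd s2 k [::]) i (drop va x)) k.+1 (rev (take va x))) t.
    have := @Hloop va x [::] s2; rewrite cats0; apply.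
    - by rewrite /s2; upd_cases.
    - by rewrite /s2; upd_cases.
    - by rewrite /s2; upd_cases; rewrite Hk.
  set s3 := upd _ k.+1 _ in E2.
  have E3 : exec (Case i Skip Skip (Push d true)) s3
      (upd s3 d (nseq (nth false x va) true ++ s3 d)) (nth false x va).+2.
    apply: ExecCase.
    have -> : s3 i = drop va x by rewrite /s3; upd_cases.
    have -> : nth false x va = head false (drop va x) by rewrite -nth0 nth_drop addn0.
    case: (drop va x) => [|[] l] /=; try exact: ExecPush;
      by apply: exec_eq (ExecSkip _) _ _ => //; store_eq.
  set s4 := upd _ d _ in E3.
  have ki : k.+1 != i by lia.
  have E4 := exec_transfer s4 ki.
  exists (t1 + (t2 + ((nth false x va).+2 + (6 * size (s4 k.+1)).+1))).
    have -> : size (s4 k.+1) = size (take va x).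
      by rewrite /s4 /s3; upd_cases; rewrite size_rev.
    have := size_take_min va x; case: nth => /=; lia.
  apply: exec_eq (ExecSeq E1 (ExecSeq E2 (ExecSeq E3 E4))) _ _ => //.
  have Hk0 := Hk k (leqnn _); have Hk1 := Hk k.+1 (leqnSn _).
  rewrite /s4 /s3 /s2; store_eq.
  by rewrite revK cat_take_drop.
- have [[s0 s1 sr Hr Hd] Hk] := I.
  have szx := bounded_word i B; have si := expr_inv_word i I.
  have i2 : i < 2 by case: (i).
  eexists; last first.
    have := @exec_copy i d k s; rewrite si; apply; try by apply/eqP; lia.
    exact: Hk.
  by rewrite leq_add2r leq_mul2l szx.
Qed.

(** As the base is at least 2, constants and sums are absorbed by a larger exponent, so a single
    parameter suffices for closure under sum, product and composition. *)
Definition poly_bounded (f : nat -> nat) := exists D, forall X, f X <= (X + 2) ^ D.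

Lemma poly_bounded_const c : poly_bounded (fun=> c).
Proof.
exists c => X; apply: leq_trans (ltnW (ltn_expl c (isT : 1 < 2))) _.
by case: c => // c; rewrite leq_exp2r // leq_addl.
Qed.

Lemma poly_bounded_id : poly_bounded id.
Proof. by exists 1 => X; rewrite expn1 leq_addr. Qed.

Lemma poly_bounded_mul f g : poly_bounded f -> poly_bounded g ->
  poly_bounded (fun X => f X * g X).
Proof.
by case=> D Hf [E Hg]; exists (D + E) => X; rewrite expnD leq_mul.
Qed.

Lemma poly_bounded_add f g : poly_bounded f -> poly_bounded g ->
  poly_bounded (fun X => f X + g X).
Proof.
case=> D Hf [E Hg]; exists (D + E).+1 => X.
have := Hf X; have := Hg X; rewrite expnS expnD.
have : 0 < (X + 2) ^ D by rewrite expn_gt0 addn2.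
have : 0 < (X + 2) ^ E by rewrite expn_gt0 addn2.
by move: ((X + 2) ^ D) ((X + 2) ^ E) => a b; nia.
Qed.

Lemma poly_bounded_comp f g : poly_bounded f -> poly_bounded g ->
  poly_bounded (fun X => f (g X)).
Proof.
case=> D Hf [E Hg]; exists ((E + 2) * D) => X.
apply: leq_trans (Hf _) _; rewrite expnM.
have le : g X + 2 <= (X + 2) ^ (E + 2).
  have := Hg X; rewrite expnD.
  have : 0 < (X + 2) ^ E by rewrite expn_gt0 addn2.
  by rewrite -mulnn; move: ((X + 2) ^ E) => a; nia.
by case: D {Hf} => // D; rewrite leq_exp2r.
Qed.

Ltac poly :=
  lazymatch goal with
  | |- poly_bounded (fun X => @?f X + @?g X) =>
      apply: (@poly_bounded_add f g); poly
  | |- poly_bounded (fun X => @?f X * @?g X) =>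
      apply: (@poly_bounded_mul f g); poly
  | |- poly_bounded (fun X => X) => exact: poly_bounded_id
  | |- poly_bounded (fun X => ?f (@?g X)) =>
      first [ exact: poly_bounded_const | apply: (@poly_bounded_comp f g); poly ]
  | |- _ => try first [ assumption | exact: poly_bounded_const ]
  end.

Lemma poly_value_bound e : poly_bounded (value_bound e).
Proof.
elim: e => [x|c|a Ha b Hb|a Ha b Hb|x a Ha b Hb|i a Ha|i];
  match goal with |- poly_bounded ?f => change (poly_bounded (fun X => f X)) end;
  rewrite /=; poly.
Qed.

Lemma poly_time_bound e : poly_bounded (time_bound e).
Proof.
have V := poly_value_bound.
by elim: e => [x|c|a Ha b Hb|a Ha b Hb|x a Ha b Hb|i a Ha|i];
  match goal with |- poly_bounded ?f => change (poly_bounded (fun X => f X)) end;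
  rewrite /=; poly; apply: V.
Qed.

(* Tape 3 holds the position of the current output bit, tape 4 the number of
   bits left, and tape 6 the bits produced so far, in reverse order. *)
Definition bits_prog l e : prog :=
  Seq (code_expr l (fun=> 2) 7 4)
  (Seq (While 4 (Seq (Pop 4) (Seq (code_expr e (bind (fun=> 2) 0 3) 7 5)
    (Seq (Case 5 (Push 6 false) Skip (Push 6 true))
         (Seq (clear 5) (Push 3 true))))))
  (Seq (clear 0) (transfer 6 0))).

Definition bits_of e w u : nat -> bool := fun t => eval e w u (bind (fun=> 0) 0 t) != 0.

Lemma exec_bits_prog l e s w u X :
  s 0 = w -> s 1 = u -> (forall v, 2 <= v -> s v = [::]) -> size w + size u <= X ->
  let V := value_bound l X in
  exists2 s', s' 0 = mkseq (bits_of e w u) (eval l w u (fun=> 0)) &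
  exists2 t, t <= time_bound l X +
                  V * (time_bound e (X + V) + 3 * value_bound e (X + V) + 20) +
                  3 * X + 3
  & exec (bits_prog l e) s s' t.
Proof.
move=> s0 s1 s2 leX V.
(* All free variables share stack 2, which stays empty, so their value is 0. *)
have I1 : expr_inv s w u (fun=> 0) (fun=> 2) 7 4.
  by split=> [|v le_v]; [split=> // x; rewrite s2 | apply: s2; lia].
have B1 : bounded w u (fun=> 0) X by [].
have [t1 le1 E1] := exec_code_expr l I1 B1.
rewrite s2 // cats0 in E1; have := eval_bound l B1; rewrite -/V.
set N := eval l w u _ in E1 * => leN.
have Hloop n i : i + n = N ->
  exists2 t, t <= n * (time_bound e (X + V) + 3 * value_bound e (X + V) + 11) + 1 &
  exec (While 4 (Seq (Pop 4) (Seq (code_expr e (bind (fun=> 2) 0 3) 7 5)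
    (Seq (Case 5 (Push 6 false) Skip (Push 6 true))
         (Seq (clear 5) (Push 3 true))))))
    (upd (upd (upd s 4 (nseq n true)) 3 (nseq i true)) 6 (rev (mkseq (bits_of e w u) i)))
    (upd (upd s 3 (nseq N true)) 6 (rev (mkseq (bits_of e w u) N))) t.
  elim: n i => [|n IH] i Ein.
    have -> : i = N by lia.
    exists 1 => //; apply: exec_eq (ExecWhile0 _ _) _ _ => //.
    by have s4 := s2 4 isT; store_eq.
  have [t le_t Et] := IH i.+1 (ltac:(lia)).
  set s3 := upd _ 6 _; set s4 := upd s3 4 (behead (s3 4)).
  have I3 : expr_inv s4 w u (bind (fun=> 0) 0 i) (bind (fun=> 2) 0 3) 7 5.
    rewrite /s4 /s3; split; first split.
    - by upd_cases.
    - by upd_cases.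
    - by move=> y; rewrite /bind; case: (y =P 0) => _; upd_cases => //; rewrite s2.
    - by move=> y; rewrite /bind; case: (y =P 0) => _; lia.
    - lia.
    - by move=> v le_v; upd_cases; apply: s2; lia.
  have B3 : bounded w u (bind (fun=> 0) 0 i) (X + V) by apply: bounded_bind => //; lia.
  have [t3 le3 E3] := exec_code_expr e I3 B3.
  have := eval_bound e B3; set ve := eval e w u _ in E3 * => leve.
  have s45 : s4 5 = [::] by rewrite /s4 /s3; upd_cases; apply: s2.
  rewrite s45 cats0 in E3; set s5 := upd s4 5 _ in E3.
  have E4 : exec (Case 5 (Push 6 false) Skip (Push 6 true)) s5
      (upd s5 6 ((ve != 0) :: s5 6)) 3.
    apply: ExecCase; have -> : s5 5 = nseq ve true by rewrite /s5; upd_cases.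
    by case: (ve) => [|v] /=; apply: ExecPush.
  set s6 := upd s5 6 _ in E4.
  have E5 := exec_clear 5 s6; set s7 := upd s6 5 _ in E5.
  have sz : size (s6 5) = ve by rewrite /s6 /s5; upd_cases; rewrite size_nseq.
  rewrite sz in E5.
  have Eb := ExecSeq (ExecPop s3 4) (ExecSeq E3 (ExecSeq E4 (ExecSeq E5 (ExecPush s7 3 true)))).
  exists (1 + (t3 + (3 + ((3 * ve).+1 + 1))) + t).+2; first by nia.
  apply: (ExecWhileS _ Eb); first by rewrite /s3; upd_cases.
  move: Et; set s8 := upd _ 6 _; suff -> : s8 = upd s7 3 (true :: s7 3) by [].
  have s50 := s2 5 isT.
  rewrite /s8 /s7 /s6 /s5 /s4 /s3; store_eq.
  by rewrite mkseqS rev_rcons.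
have [t2 le2 E2] := Hloop N 0 erefl.
move: E2; set s3 := upd _ 6 _; have -> : s3 = upd s 4 (nseq N true).
  have s30 := s2 3 isT; have s60 := s2 6 isT; by rewrite /s3; store_eq.
set s4 := upd _ 6 _ => E2.
have E3 := exec_clear 0 s4; set s5 := upd s4 0 _ in E3.
have E4 := @exec_transfer 6 0 s5 isT.
have Eall := ExecSeq E1 (ExecSeq E2 (ExecSeq E3 E4)).
eexists; last first.
  eexists; last exact: Eall.
  have -> : s4 0 = w by rewrite /s4; upd_cases.
  have -> : size (s5 6) = N by rewrite /s5 /s4; upd_cases; rewrite size_rev size_mkseq.
  by nia.
have -> : s5 6 = rev (mkseq (bits_of e w u) N) by rewrite /s5 /s4; upd_cases.
by rewrite /s5; upd_cases; rewrite revK cats0.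
Qed.

Lemma bits_polytime (I : Type) (args : I -> seq word) l e :
  (forall i, size (args i) <= 2) ->
  polytime args (fun i => let w := nth [::] (args i) 0 in
    let u := nth [::] (args i) 1 in
    mkseq (bits_of e w u) (eval l w u (fun=> 0))).
Proof.
move=> size_args.
have [D HD] : poly_bounded (fun X => 2 * (time_bound l X +
   value_bound l X * (time_bound e (X + value_bound l X) +
     3 * value_bound e (X + value_bound l X) + 20) + 3 * X + 3)).
  have := poly_value_bound; have := poly_time_bound => T V.
  by poly; try apply: T; try apply: V.
(* For [X > 0] one has [X + 2 <= 3 * X]; for [X = 0] the additive constant [3 ^ D] covers
   [2 ^ D]. *)
exists (code_machine (compile (bits_prog l e) 0)), (3 ^ D), D => i.
set X := sumn _.
have leX : size (nth [::] (args i) 0) + size (nth [::] (args i) 1) <= X.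
  rewrite /X; move: (size_args i); case: (args i) => [|w [|u [|]]] //=; lia.
have [|s' Es' [t le_t Ex]] := @exec_bits_prog l e (arg_store (args i)) _ _ X erefl erefl _ leX.
  by move=> v le_v; rewrite /arg_store nth_default //; apply: leq_trans le_v.
rewrite /= -Es'; apply: (exec_computes Ex).
rewrite -mul2n; apply: leq_trans (leq_mul (leqnn 2) le_t) _.
apply: leq_trans (HD X) _; case: X {leX le_t} => [|X].
  by rewrite add0n; case: D {HD} => // D; rewrite exp0n // muln0 add0n leq_exp2r.
by apply: leq_trans (leq_addr _ _); rewrite -expnMn; case: D {HD} => // D; rewrite leq_exp2r //; lia.
Qed.

(** * Definable functions *)

(* Two input words and [k] natural numbers; variable number [x] of an
   expression is the component added [x]-th, so weakening keeps expressions. *)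
Fixpoint ctx k : Type := if k is k'.+1 then (ctx k' * nat)%type else (word * word)%type.

Fixpoint inputs k : ctx k -> word * word :=
  match k with 0 => fun p => p | _.+1 => fun p => inputs p.1 end.

Fixpoint lookup k : ctx k -> nat -> nat :=
  match k with
  | 0 => fun _ _ => 0
  | k'.+1 => fun p x => if x == k' then p.2 else lookup p.1 x
  end.

(** Valuations are constrained only below [k]: larger variables stay free for the indices of sums,
    and the same expression remains valid in a larger context. *)
Definition D k (f : ctx k -> nat) := exists e, forall (p : ctx k) r,
  (forall x, x < k -> r x = lookup p x) -> eval e (inputs p).1 (inputs p).2 r = f p.

Definition alln n (P : nat -> bool) := all P (iota 0 n).
Definition exn n (P : nat -> bool) := has P (iota 0 n).

(* [D_sum] cannot be applied by unification, which does not see through the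
   coercion of ordinals. *)
Definition nsum n (g : nat -> nat) := \sum_(i < n) g i.

Lemma allnP n (P : nat -> bool) : reflect (forall i, i < n -> P i) (alln n P).
Proof.
apply: (iffP allP) => H i; first by move=> lt_i; apply: H; rewrite mem_iota.
by rewrite mem_iota => /andP[_]; apply: H.
Qed.

Lemma exnP n (P : nat -> bool) : reflect (exists2 i, i < n & P i) (exn n P).
Proof.
apply: (iffP hasP) => -[i]; first by rewrite mem_iota => /andP[_ lt_i] Pi; exists i.
by move=> lt_i Pi; exists i; rewrite ?mem_iota.
Qed.

Lemma exn_alln n P : exn n P = ~~ alln n (fun i => ~~ P i).
Proof. by rewrite /exn /alln -has_predC; apply: eq_has => i /=; rewrite negbK. Qed.

Section Closure.

Variable k : nat.
Implicit Types (a b c : ctx k -> nat) (P Q : ctx k -> bool).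

Lemma D_ext a b : D a -> a =1 b -> D b.
Proof. by case=> e He E; exists e => p r Hr; rewrite -E; apply: He. Qed.

Lemma D_const n : D (fun _ : ctx k => n).
Proof. by exists (EConst n). Qed.

Lemma D_var : D (fun p : ctx k.+1 => p.2).
Proof. by exists (EVar k) => p r Hr; rewrite /= Hr //= eqxx. Qed.

Lemma D_weak a : D a -> D (fun p : ctx k.+1 => a p.1).
Proof.
case=> e He; exists e => p r Hr; apply: (He p.1) => x lt_x.
by rewrite Hr ?leqW //= ltn_eqF.
Qed.

Lemma D_add a b : D a -> D b -> D (fun p => a p + b p).
Proof.
by case=> e He [f Hf]; exists (EAdd e f) => p r Hr /=; rewrite He ?Hf.
Qed.

Lemma D_sub a b : D a -> D b -> D (fun p => a p - b p).
Proof.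
by case=> e He [f Hf]; exists (ESub e f) => p r Hr /=; rewrite He ?Hf.
Qed.

Lemma D_sum a (g : ctx k -> nat -> nat) :
  D a -> D (fun p : ctx k.+1 => g p.1 p.2) -> D (fun p => \sum_(i < a p) g p i).
Proof.
case=> e He [f Hf]; exists (ESum k e f) => p r Hr /=; rewrite He //.
apply: eq_bigr => i _; apply: (Hf (p, nat_of_ord i)) => x.
by rewrite /bind /= ltnS leq_eqVlt; case: eqP => //= _; apply: Hr.
Qed.

Lemma D_nsum a (g : ctx k -> nat -> nat) :
  D a -> D (fun p : ctx k.+1 => g p.1 p.2) -> D (fun p => nsum (a p) (g p)).
Proof. exact: D_sum. Qed.

Lemma D_bit (g : ctx k -> word) i a :
  (forall p, g p = if i then (inputs p).2 else (inputs p).1) ->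
  D a -> D (fun p => nth false (g p) (a p)).
Proof.
by move=> Eg [e He]; exists (EBit i e) => p r Hr /=; rewrite He // Eg.
Qed.

Lemma D_size (g : ctx k -> word) i :
  (forall p, g p = if i then (inputs p).2 else (inputs p).1) ->
  D (fun p => size (g p)).
Proof. by move=> Eg; exists (ELen i) => p r Hr /=; rewrite Eg. Qed.

Lemma D_succ a : D a -> D (fun p => (a p).+1).
Proof. by move=> Da; apply: D_ext (D_add Da (D_const 1)) _ => p; rewrite addn1. Qed.

Lemma D_not P : D (fun p => P p) -> D (fun p => ~~ P p).
Proof. by move=> DP; apply: D_ext (D_sub (D_const 1) DP) _ => p; case: (P p). Qed.

Lemma D_leq a b : D a -> D b -> D (fun p => a p <= b p).
Proof.
move=> Da Db; apply: D_ext (D_sub (D_const 1) (D_sub Da Db)) _ => p.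
by rewrite /leq; case: (a p - b p).
Qed.

End Closure.

Lemma D_mul k (a b : ctx k -> nat) : D a -> D b -> D (fun p => a p * b p).
Proof.
move=> Da Db; apply: D_ext (D_sum Da (g := fun p _ => b p) (D_weak Db)) _ => p.
by rewrite sum_nat_const card_ord.
Qed.

Section Closure2.

Variable k : nat.
Implicit Types (a b c : ctx k -> nat) (P Q : ctx k -> bool).

Lemma D_exp a n : D a -> D (fun p => a p ^ n).
Proof.
move=> Da; elim: n => [|n IH]; first exact: D_const.
by apply: D_ext (D_mul Da IH) _ => p; rewrite expnS.
Qed.

Lemma D_and P Q : D (fun p => P p) -> D (fun p => Q p) -> D (fun p => P p && Q p).
Proof. by move=> DP DQ; apply: D_ext (D_mul DP DQ) _ => p; rewrite mulnb. Qed.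

Lemma D_or P Q : D (fun p => P p) -> D (fun p => Q p) -> D (fun p => P p || Q p).
Proof.
move=> DP DQ; apply: D_ext (D_not (D_and (D_not DP) (D_not DQ))) _ => p.
by rewrite negb_and !negbK.
Qed.

Lemma D_imply P Q : D (fun p => P p) -> D (fun p => Q p) -> D (fun p => P p ==> Q p).
Proof. by move=> DP DQ; apply: D_ext (D_or (D_not DP) DQ) _ => p; rewrite implybE. Qed.

Lemma D_eqn a b : D a -> D b -> D (fun p => a p == b p).
Proof.
move=> Da Db; apply: D_ext (D_and (D_leq Da Db) (D_leq Db Da)) _ => p.
by rewrite eqn_leq.
Qed.

Lemma D_eqb P Q : D (fun p => P p) -> D (fun p => Q p) -> D (fun p => P p == Q p).
Proof. by move=> DP DQ; apply: D_ext (D_eqn DP DQ) _ => p; case: (P p); case: (Q p). Qed.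

Lemma D_if P a b : D (fun p => P p) -> D a -> D b -> D (fun p => if P p then a p else b p).
Proof.
move=> DP Da Db; apply: D_ext (D_add (D_mul DP Da) (D_mul (D_not DP) Db)) _ => p.
by case: (P p); rewrite mul1n mul0n ?addn0.
Qed.

Lemma D_ifb P (Q Q' : ctx k -> bool) :
  D (fun p => P p) -> D (fun p => Q p) -> D (fun p => Q' p) ->
  D (fun p => if P p then Q p else Q' p : bool).
Proof. by move=> DP DQ DQ'; apply: D_ext (D_if DP DQ DQ') _ => p; case: (P p). Qed.

Lemma D_alln a (P : ctx k -> nat -> bool) :
  D a -> D (fun p : ctx k.+1 => P p.1 p.2) -> D (fun p => alln (a p) (P p)).
Proof.
move=> Da DP.
apply: D_ext (D_eqn (D_sum Da (g := fun p i => ~~ P p i) (D_not DP)) (D_const _ 0)) _ => p.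
congr nat_of_bool; rewrite sum_nat_eq0; apply/forallP/allnP => H i; last first.
  by rewrite eqb0 negbK H.
by move=> lt_i; have := H (Ordinal lt_i); rewrite eqb0 negbK.
Qed.

Lemma D_exn a (P : ctx k -> nat -> bool) :
  D a -> D (fun p : ctx k.+1 => P p.1 p.2) -> D (fun p => exn (a p) (P p)).
Proof.
move=> Da DP; apply: D_ext (D_not (D_alln Da (P := fun p i => ~~ P p i) (D_not DP))) _ => p.
by rewrite -exn_alln.
Qed.

(* Unlike [D_sum], the number of terms is fixed and the terms are unrelated:
   this is how finite tables enter expressions. *)
Lemma D_fsum n (f : nat -> ctx k -> nat) :
  (forall i, D (f i)) -> D (fun p => \sum_(i < n) f i p).
Proof.
move=> Df; elim: n => [|n IH].
  by apply: D_ext (D_const _ 0) _ => p; rewrite big_ord0.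
by apply: D_ext (D_add IH (Df n)) _ => p; rewrite big_ord_recr.
Qed.

End Closure2.

(** For a positive divisor the quotient counts the [i < a p] with [i.+1 * b p <= a p]; the factor
    [1 <= b p] gives the value 0 on division by zero. *)
Lemma D_div k (a b : ctx k -> nat) : D a -> D b -> D (fun p => a p %/ b p).
Proof.
move=> Da Db.
apply: D_ext (D_mul (D_leq (D_const _ 1) Db)
  (D_sum Da (g := fun p i => i.+1 * b p <= a p)
    (D_leq (D_mul (D_succ (D_var _)) (D_weak Db)) (D_weak Da)))) _ => p.
case: posnP => [->|b0]; first by rewrite divn0 mul0n.
rewrite mul1n; under eq_bigr => i _ do rewrite -leq_divRL //.
have : a p %/ b p <= a p by apply: leq_div.
move: (a p %/ b p) => q; elim: (a p) => [|n IH]; first by rewrite big_ord0 leqn0 => /eqP.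
rewrite leq_eqVlt => /predU1P[->|lt_q].
  under eq_bigr => i _ do rewrite ltn_ord.
  by rewrite sum_nat_const card_ord muln1.
by rewrite big_ord_recr /= IH // ltnNge -ltnS lt_q addn0.
Qed.

Lemma D_mod k (a b : ctx k -> nat) : D a -> D b -> D (fun p => a p %% b p).
Proof.
move=> Da Db; apply: D_ext (D_sub Da (D_mul (D_div Da Db) Db)) _ => p.
by rewrite {1}(divn_eq (a p) (b p)) addKn.
Qed.

Lemma D_odd k (a : ctx k -> nat) : D a -> D (fun p => odd (a p)).
Proof.
by move=> Da; apply: D_ext (D_mod Da (D_const _ 2)) _ => p; rewrite modn2.
Qed.

Definition finite_table m n (g : nat -> nat -> nat) (x y : nat) :=
  \sum_(i < m) \sum_(j < n) ((x == i) && (y == j)) * g i j.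

Lemma tableE m n g x y : x < m -> y < n -> finite_table m n g x y = g x y.
Proof.
move=> xm yn; rewrite /finite_table (bigD1 (Ordinal xm)) //= (bigD1 (Ordinal yn)) //= !eqxx mul1n.
rewrite big1 => [|j /eqP neq]; last first.
  by case: (y =P j) => // E; case: neq; apply: val_inj.
rewrite big1 ?addn0 // => i /eqP neq; rewrite big1 // => j _.
by case: (x =P i) => // E; case: neq; apply: val_inj.
Qed.

(** The field [y] of a clause index ranges over [nz + na], beyond the columns of [mismatch]; the
    value 0 there makes the clause trivial. *)
Lemma table_out m n g x y : n <= y -> finite_table m n g x y = 0.
Proof.
move=> ny; rewrite /finite_table big1 // => i _; rewrite big1 // => j _.
by rewrite [y == j](gtn_eqF (leq_trans (ltn_ord j) ny)) andbF.
Qed.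

Lemma D_table k (a b : ctx k -> nat) m n g :
  D a -> D b -> D (fun p => finite_table m n g (a p) (b p)).
Proof.
move=> Da Db; apply: (@D_fsum _ _ (fun i p => \sum_(j < n) ((a p == i) && (b p == j)) * g i j)) => i.
apply: (@D_fsum _ _ (fun j p => ((a p == i) && (b p == j)) * g i j)) => j.
by apply: D_mul (D_const _ _); apply: D_and; apply: D_eqn => //; apply: D_const.
Qed.

Ltac weaken H :=
  first [ exact: H | exact: (D_weak H) | exact: (D_weak (D_weak H))
        | exact: (D_weak (D_weak (D_weak H)))
        | exact: (D_weak (D_weak (D_weak (D_weak H))))
        | exact: (D_weak (D_weak (D_weak (D_weak (D_weak H)))))
        | exact: (D_weak (D_weak (D_weak (D_weak (D_weak (D_weak H)))))) ].

Ltac weaken_var :=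
  first [ exact: (D_weak (D_var _)) | exact: (D_weak (D_weak (D_var _)))
        | exact: (D_weak (D_weak (D_weak (D_var _))))
        | exact: (D_weak (D_weak (D_weak (D_weak (D_var _)))))
        | exact: (D_weak (D_weak (D_weak (D_weak (D_weak (D_var _))))))
        | exact: (D_weak (D_weak (D_weak (D_weak (D_weak (D_weak (D_var _)))))))
        | exact: (D_weak (D_weak (D_weak (D_weak (D_weak (D_weak (D_weak (D_var _)))))))) ].

(** A hook for functions that are known only through a definability hypothesis. *)
Ltac definable_step := fail.

Ltac definable :=
  lazymatch goal with
  | |- D (fun p => nat_of_bool (_ && _)) => apply: D_and; definable
  | |- D (fun p => nat_of_bool (_ || _)) => apply: D_or; definable
  | |- D (fun p => nat_of_bool (_ ==> _)) => apply: D_imply; definable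
  | |- D (fun p => nat_of_bool (~~ _)) => apply: D_not; definable
  | |- D (fun p => nat_of_bool (odd _)) => apply: D_odd; definable
  | |- D (fun p => nat_of_bool (leq _ _)) => apply: D_leq; definable
  | |- D (fun p => nat_of_bool (@eq_op _ ?x _)) =>
      first [ apply: D_eqn | apply: D_eqb ]; definable
  | |- D (fun p => nat_of_bool (alln _ _)) => apply: D_alln; definable
  | |- D (fun p => nat_of_bool (exn _ _)) => apply: D_exn; definable
  | |- D (fun p => nat_of_bool (if _ then _ else _)) => apply: D_ifb; definable
  | |- D (fun p => nat_of_bool (nth false _ _)) =>
      first [ apply: (@D_bit _ _ false); [by [] | definable]
            | apply: (@D_bit _ _ true); [by [] | definable] ]
  | |- D (fun p => nat_of_bool ?b) => first [ exact: D_const | definable_step; definable ]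
  | |- D (fun p => if _ then _ else _) => apply: D_if; definable
  | |- D (fun p => addn _ _) => apply: D_add; definable
  | |- D (fun p => subn _ _) => apply: D_sub; definable
  | |- D (fun p => muln _ _) => apply: D_mul; definable
  | |- D (fun p => divn _ _) => apply: D_div; definable
  | |- D (fun p => modn _ _) => apply: D_mod; definable
  | |- D (fun p => expn _ _) => apply: D_exp; definable
  | |- D (fun p => S _) => first [ exact: D_const | apply: D_succ; definable ]
  | |- D (fun p => finite_table _ _ _ _ _) => apply: D_table; definable
  | |- D (fun p => size _) =>
      first [ exact: (@D_size _ _ false) | exact: (@D_size _ _ true) ]
  | |- D (fun p => nsum _ _) => apply: D_nsum; definable
  | |- D (@snd _ _) => exact: D_var
  | |- D (fun p => @snd _ _ _) => weaken_var
  | |- _ => first [ exact: D_const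
                  | multimatch goal with H : D _ |- _ => weaken H end
                  | definable_step; definable ]
  end.

Lemma definable_polytime (I : Type) (args : I -> seq word)
    (l : ctx 0 -> nat) (f : ctx 1 -> bool) :
  (forall i, size (args i) <= 2) -> D l -> D (fun p => f p) ->
  polytime args (fun i => let p := (nth [::] (args i) 0, nth [::] (args i) 1) in
    mkseq (fun t => f (p, t)) (l p)).
Proof.
move=> sz [el Hl] [ef Hf]; have [M [c [d H]]] := bits_polytime el ef sz.
exists M, c, d => i; move: (H i) => /=.
set p : ctx 0 := (_, _).
have -> : eval el (nth [::] (args i) 0) (nth [::] (args i) 1) (fun=> 0) = l p.
  exact: (Hl p).
suff -> : bits_of ef (nth [::] (args i) 0) (nth [::] (args i) 1) =
   fun t => f (p, t) by [].
apply: functional_extensionality => t; rewrite /bits_of.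
have -> := Hf (p, t) (bind (fun=> 0) 0 t); first by case: (f _).
by move=> [|x] //; rewrite ltnS ltn0.
Qed.

(** * Codes of instances *)

Definition record_at n j := 3 * n + 1 + j * (2 * n + 1).
Definition prem_bit w n j i := nth false w ((record_at n j).+1 + i).
Definition conc_bit w n j i := nth false w ((record_at n j).+1 + n + i).
Definition K_bit w n i := nth false w (n.+1 + i).
Definition F_bit w n i := nth false w (2 * n + 1 + i).

Lemma size_bits n (A : {set 'I_n}) : size (bits A) = n.
Proof. by rewrite size_map size_enum_ord. Qed.

Lemma nth_bits n (A : {set 'I_n}) (i : 'I_n) : nth false (bits A) i = (i \in A).
Proof. by rewrite (nth_map i) ?size_enum_ord // nth_ord_enum. Qed.

Lemma nth_flatten_blocks (ss : seq word) c j o :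
  (forall t, t \in ss -> size t = c) -> o < c -> j < size ss ->
  nth false (flatten ss) (j * c + o) = nth false (nth [::] ss j) o.
Proof.
elim: ss j => [|t ss IH] [|j] //= Hc lt_o lt_j; have Et := Hc t (mem_head _ _).
  by rewrite nth_cat Et mul0n add0n lt_o.
rewrite nth_cat Et mulSn -addnA ltnNge leq_addr /= addKn IH // => t' t's.
by apply: Hc; rewrite inE t's orbT.
Qed.

(** The code described through single bits: the verifier rebuilds an instance from the bits it
    reads, and the reduction only knows the bits it writes. *)
Record word_spec n (s : seq (implication 'I_n)) (K F : {set 'I_n}) w : Prop := WordSpec {
  ws_size : size w = record_at n (size s);
  ws_unary : forall i, i < n -> nth false w i;
  ws_end : ~~ nth false w n;
  ws_K : forall i : 'I_n, K_bit w n i = (i \in K);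
  ws_F : forall i : 'I_n, F_bit w n i = (i \in F);
  ws_mark : forall j, j < size s -> nth false w (record_at n j);
  ws_prem : forall j (i : 'I_n), j < size s ->
    prem_bit w n j i = (i \in premise (nth (set0, set0) s j));
  ws_conc : forall j (i : 'I_n), j < size s ->
    conc_bit w n j i = (i \in conclusion (nth (set0, set0) s j)) }.

Lemma ics_word_spec n (s : seq (implication 'I_n)) K F : word_spec s K F (ics_word s K F).
Proof.
pose recd (i : implication 'I_n) := true :: bits (premise i) ++ bits (conclusion i).
have sz_rec t : t \in map recd s -> size t = 2 * n + 1.
  by case/mapP => i _ ->; rewrite /= size_cat !size_bits; lia.
have sz_flat : size (flatten (map recd s)) = size s * (2 * n + 1).
  elim: (s) => //= i s' IH; rewrite size_cat IH /= size_cat !size_bits; lia.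
have nthr j o : j < size s -> o < 2 * n + 1 ->
    nth false (ics_word s K F) (record_at n j + o) =
    nth false (recd (nth (set0, set0) s j)) o.
  move=> lt_j lt_o; rewrite /ics_word nth_cat size_nseq /record_at.
  rewrite ifF; last by lia.
  rewrite -[X in nth _ _ X]prednK /=; last by lia.
  rewrite nth_cat size_bits ifF; last by lia.
  rewrite nth_cat size_bits ifF; last by lia.
  rewrite -(nth_map _ [::]) // -(nth_flatten_blocks sz_rec lt_o) ?size_map //.
  by congr nth; lia.
split.
- rewrite /ics_word size_cat /= !size_cat sz_flat size_nseq !size_bits /record_at; move: (size s * (2 * n + 1)) => q; lia.
- by move=> i lt_i; rewrite nth_cat size_nseq lt_i nth_nseq lt_i.
- by rewrite nth_cat size_nseq ltnn subnn.
- move=> i; rewrite /K_bit /ics_word nth_cat size_nseq ifF; last by lia.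
  have -> : n.+1 + i - n = i.+1 by lia.
  by rewrite /= nth_cat size_bits ltn_ord nth_bits.
- move=> i; rewrite /F_bit /ics_word nth_cat size_nseq ifF; last by lia.
  have -> : 2 * n + 1 + i - n = (n + i).+1 by lia.
  rewrite /= nth_cat size_bits ifF; last by lia.
  have -> : n + i - n = i by lia.
  by rewrite nth_cat size_bits ltn_ord nth_bits.
- by move=> j lt_j; rewrite -[record_at n j]addn0 nthr //; lia.
- move=> j i lt_j; rewrite /prem_bit addSnnS nthr //; last by have := ltn_ord i; lia.
  by rewrite /= nth_cat size_bits ltn_ord nth_bits.
- move=> j i lt_j; rewrite /conc_bit -addnA addSnnS nthr //; last by have := ltn_ord i; lia.
  by rewrite /= nth_cat size_bits ifF; [rewrite addKn nth_bits | lia].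
Qed.

(** The regions of the specification cover every position below the length, so they determine the
    word. *)
Lemma ics_wordP n (s : seq (implication 'I_n)) K F w :
  word_spec s K F w -> w = ics_word s K F.
Proof.
have H' := ics_word_spec s K F; set w' := ics_word s K F in H' *.
move=> H; apply: (@eq_from_nth _ false); first by rewrite (ws_size H) (ws_size H').
move=> p; rewrite (ws_size H) => lt_p.
case: (ltnP p n) => [lt_pn|]; first by rewrite (ws_unary H) ?(ws_unary H').
rewrite leq_eqVlt => /predU1P[<-|lt_np].
  by rewrite (negbTE (ws_end H)) (negbTE (ws_end H')).
case: (ltnP p (2 * n + 1)) => [lt_p2|le_p2].
  have lt_i : p - n.+1 < n by lia.
  have := ws_K H (Ordinal lt_i); rewrite -(ws_K H') /K_bit /=.
  by have -> : n.+1 + (p - n.+1) = p by lia.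
case: (ltnP p (3 * n + 1)) => [lt_p3|le_p3].
  have lt_i : p - (2 * n + 1) < n by lia.
  have := ws_F H (Ordinal lt_i); rewrite -(ws_F H') /F_bit /=.
  by have -> : 2 * n + 1 + (p - (2 * n + 1)) = p by lia.
pose j := (p - (3 * n + 1)) %/ (2 * n + 1); pose o := (p - (3 * n + 1)) %% (2 * n + 1).
have Ep : p = record_at n j + o.
  by rewrite /record_at /j /o -addnA -divn_eq; lia.
have lt_o : o < 2 * n + 1 by rewrite /o ltn_mod; lia.
have lt_j : j < size s by rewrite /j ltn_divLR; [rewrite /record_at in lt_p; lia | lia].
rewrite Ep; case: (posnP o) => [->|o0].
  by rewrite addn0 (ws_mark H) ?(ws_mark H').
case: (leqP o n) => [le_on|lt_no].
  have lt_i : o.-1 < n by lia.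
  have := ws_prem H (Ordinal lt_i) lt_j; rewrite -(ws_prem H') // /prem_bit /=.
  by have -> : (record_at n j).+1 + o.-1 = record_at n j + o by lia.
have lt_i : o - n.+1 < n by lia.
have := ws_conc H (Ordinal lt_i) lt_j; rewrite -(ws_conc H') // /conc_bit /=.
by have -> : (record_at n j).+1 + n + (o - n.+1) = record_at n j + o by lia.
Qed.

(** * Certificates *)

Section Certificates.

Variables (X : finType) (Sigma : {set implication X}).

Definition derived (S : {set X}) : {set X} :=
  [set z | [exists i in Sigma, (premise i \subset S) && (z \in conclusion i)]].

Lemma closed_derived C : closed_set Sigma C = (derived C \subset C).
Proof.
apply/forallP/subsetP => [H z|H i].
  rewrite inE => /existsP[i /and3P[iS sub zi]].
  by have := H i; rewrite iS sub /= => /subsetP; apply.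
apply/implyP => iS; apply/implyP => sub; apply/subsetP => z zi.
by apply: H; rewrite inE; apply/existsP; exists i; rewrite iS sub.
Qed.

Lemma derivedS (A B : {set X}) : A \subset B -> derived A \subset derived B.
Proof.
move=> sAB; apply/subsetP => z; rewrite !inE => /existsP[i /and3P[iS sub zi]].
by apply/existsP; exists i; rewrite iS zi (subset_trans sub sAB).
Qed.

(** Inclusions are enough: every stage then lies in the closure of [y |: M]. The iterates that reach
    this closure are stationary after [#|X|] rounds. *)
Definition stages (M : {set X}) y x (S : nat -> {set X}) :=
  [/\ S 0 = set0, forall r, r < #|X| -> S r.+1 \subset (y |: M) :|: derived (S r)
    & x \in S #|X|].

(** Maximality of [M] means that adding any [y] outside [M] forces [x]. Conversely, a closed set
    strictly above [M] contains such a [y], hence all stages of the derivation, hence [x]. *)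
Lemma irr_at_certificate x M :
  reflect [/\ closed_set Sigma M, x \notin M & forall y, y \notin M -> exists S, stages M y x S]
          (M \in irr_at Sigma x).
Proof.
rewrite inE; apply: (iffP maxsetP) => [[/andP[clM xM] maxM]|[clM xM cert]].
  split=> // y yM; pose G S := (y |: M) :|: derived S.
  have Gmono : {homo G : A B / A \subset B} by move=> A B sAB; rewrite setUS ?derivedS.
  exists (fun r => iter r G set0); split=> //.
  (* By definition [fixset G] is the iterate of [G] of rank [#|X|] from [set0], that is, the last
     stage. *)
  have E : G (fixset G) = fixset G by apply: fixsetK.
  have clF : closed_set Sigma (fixset G) by rewrite closed_derived -{2}E subsetUr.
  have sMF : M \subset fixset G.
    by rewrite -E /G; apply: subset_trans (subsetUl _ _); apply: subsetUr.
  case: (boolP (x \in fixset G)) => // xF.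
  have EM := maxM (fixset G); rewrite clF xF in EM; have {}EM := EM isT sMF.
  by case/negP: yM; rewrite -EM -E !inE eqxx.
rewrite clM xM; split=> // B /andP[clB xB] sMB.
apply/eqP; rewrite eqEsubset sMB andbT; apply/subsetP => y yB.
apply: contraNT xB => /cert [S [S0 SS xS]].
suff: forall r, r <= #|X| -> S r \subset B by move/(_ _ (leqnn _))/subsetP; apply.
elim=> [|r IH] lt_r; first by rewrite S0 sub0set.
apply: subset_trans (SS _ lt_r) _; rewrite !subUset sub1set yB sMB /=.
by apply: subset_trans (derivedS (IH (ltnW lt_r))) _; rewrite -closed_derived.
Qed.

(** The transitive closure of the arcs is such an order; conversely, a transitive relation
    containing the arcs of a cycle relates a vertex to itself. *)
Lemma acyclic_certificate : acyclic Sigma <->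
  exists R : rel X, [/\ subrel (Defs.arc Sigma) R, transitive R & irreflexive R].
Proof.
split=> [ac|[R [sub tr irr]] c cyc].
  exists (fun a b => [exists c, Defs.arc Sigma a c && connect (Defs.arc Sigma) c b]); split.
  - by move=> a b ab; apply/existsP; exists b; rewrite ab connect0.
  - move=> b a c /existsP[a' /andP[aa' a'b]] /existsP[b' /andP[bb' b'c]].
    apply/existsP; exists a'; rewrite aa' /=.
    by apply: connect_trans a'b _; apply: connect_trans (connect1 bb') _.
  - move=> a /=; apply: negbTE; apply/negP => /existsP[b /andP[ab /connectP[p pth Ea]]].
    have E : rcons (belast b p) a = b :: p by rewrite lastI -Ea.
    by have := ac (a :: belast b p); rewrite /= E /= ab pth => /(_ isT).
case: c cyc => // a p /= pth.
have : path R a (rcons p a) by apply: sub_path pth.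
rewrite (path_sortedE tr) => /andP[/allP/(_ a)].
by rewrite mem_rcons mem_head irr => /(_ isT).
Qed.

End Certificates.

(** * Membership in NP *)

Definition code_ok w n m :=
  [&& alln n (fun i => nth false w i), ~~ nth false w n, size w == record_at n m
    & alln m (fun j => nth false w (record_at n j))].

Definition distinct_ok w n m := alln m (fun j => alln j (fun j' => exn n (fun i =>
  (prem_bit w n j i != prem_bit w n j' i) || (conc_bit w n j i != conc_bit w n j' i)))).

Definition disjoint_ok w n m :=
  alln m (fun j => alln n (fun i => ~~ (prem_bit w n j i && conc_bit w n j i))).

Definition closed_ok w u n m := alln m (fun j =>
  alln n (fun i => prem_bit w n j i ==> nth false u i) ==>
  alln n (fun i => conc_bit w n j i ==> nth false u i)).

(* A certificate lists the set [M], then for all [y] the stages [0 .. n] of a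
   derivation of [x] from [y |: M], then a strict order. *)
Definition stage_bit u n y r z := nth false u (n + (y * n.+1 + r) * n + z).
Definition order_bit u n a b := nth false u (n + n * n.+1 * n + a * n + b).

Definition derived_ok w u n m y r z := exn m (fun j =>
  alln n (fun i => prem_bit w n j i ==> stage_bit u n y r i) && conc_bit w n j z).

Definition irr_ok w u n m x := ~~ nth false u x &&
  alln n (fun y => ~~ nth false u y ==>
    [&& alln n (fun z => ~~ stage_bit u n y 0 z),
        alln n (fun r => alln n (fun z => stage_bit u n y r.+1 z ==>
          [|| z == y, nth false u z | derived_ok w u n m y r z]))
      & stage_bit u n y n x]).

Definition separates_ok w u n := alln n (fun i =>
  (K_bit w n i ==> nth false u i) && ~~ (nth false u i && F_bit w n i)).

Definition acyclic_ok w u n m := alln n (fun a => ~~ order_bit u n a a &&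
  alln n (fun b =>
    (exn m (fun j => prem_bit w n j a && conc_bit w n j b) ==> order_bit u n a b) &&
    alln n (fun c => order_bit u n a b && order_bit u n b c ==> order_bit u n a c))).

Definition degrees_ok w n m :=
  [&& alln n (fun x =>
        [&& nsum m (fun j => prem_bit w n j x || conc_bit w n j x) <= 4,
            nsum m (fun j => prem_bit w n j x) <= 4
          & nsum m (fun j => conc_bit w n j x) <= 2]),
      alln m (fun j => nsum n (fun i => prem_bit w n j i) <= 2)
    & alln n (fun i => ~~ K_bit w n i)].

(** The sizes [n] and [m] are found by search below the length of [w]; the flag [b] selects the
    restricted problem, so that both membership proofs share one verifier. *)
Definition verifier b w u := exn (size w).+1 (fun n => exn (size w).+1 (fun m =>
  [&& code_ok w n m, distinct_ok w n m, disjoint_ok w n m, closed_ok w u n m,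
      exn n (fun x => irr_ok w u n m x), separates_ok w u n
    & b ==> acyclic_ok w u n m && degrees_ok w n m])).

Lemma verifier_polytime b : polytime_verifier (verifier b).
Proof.
pose args (wu : word * word) := [:: wu.1; wu.2].
have Dv : D (fun p : ctx 1 => verifier b p.1.1 p.1.2).
  unfold verifier, code_ok, distinct_ok, disjoint_ok, closed_ok, irr_ok,
    separates_ok, acyclic_ok, degrees_ok, derived_ok, stage_bit, order_bit,
    prem_bit, conc_bit, K_bit, F_bit, record_at.
  definable.
have [M [c [d H]]] := @definable_polytime _ args (fun=> 1)
  (fun p => verifier b p.1.1 p.1.2) (fun=> isT) (D_const _ 1) Dv.
by exists M, c, d.
Qed.

Definition restriction (I : ics_instance) :=
  acyclic (Sigma I) /\ degree (Sigma I) <= 4 /\ premise_degree (Sigma I) <= 4 /\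
  conclusion_degree (Sigma I) <= 2 /\ dimension (Sigma I) <= 2 /\ K I = set0.

Lemma alln_ord n (P : nat -> bool) : reflect (forall i : 'I_n, P i) (alln n P).
Proof.
by apply: (iffP (allnP _ _)) => H i; [apply: H | move=> lt_i; apply: (H (Ordinal lt_i))].
Qed.

Lemma card_sum_nth (T : finType) (S : {set T}) (s : seq T) d (P : pred T) :
  uniq s -> s =i S -> #|[set i in S | P i]| = \sum_(j < size s) P (nth d s j).
Proof.
move=> us sS.
have -> : #|[set i in S | P i]| = #|filter P s|.
  by apply: eq_card => i; rewrite inE mem_filter sS andbC.
rewrite (card_uniqP (filter_uniq _ us)) size_filter -sum1_count big_mkcond /=.
by rewrite (big_nth d) big_mkord; apply: eq_bigr => j _; case: (P _).
Qed.

Section Bridge.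

Variables (n : nat) (s : seq (implication 'I_n)) (K F : {set 'I_n}) (w : word).
Hypothesis H : word_spec s K F w.
Let im j := nth (set0, set0) s j.
Let m := size s.
Implicit Types (P : nat -> bool) (u : word).

Lemma code_okP : code_ok w n m.
Proof.
apply/and4P; split; last by apply/allnP => j; apply: ws_mark H _.
- by apply/allnP => i; apply: ws_unary H _.
- exact: ws_end H.
- by rewrite (ws_size H).
Qed.

Lemma prem_sub j P : j < m ->
  alln n (fun i => prem_bit w n j i ==> P i) = (premise (im j) \subset [set i : 'I_n | P i]).
Proof.
move=> lt_j; apply/alln_ord/subsetP => Hs i.
  by rewrite inE -(ws_prem H) // => pi; have := Hs i; rewrite pi.
by apply/implyP; rewrite (ws_prem H) // => /Hs; rewrite inE.
Qed.

Lemma conc_sub j P : j < m ->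
  alln n (fun i => conc_bit w n j i ==> P i) = (conclusion (im j) \subset [set i : 'I_n | P i]).
Proof.
move=> lt_j; apply/alln_ord/subsetP => Hs i.
  by rewrite inE -(ws_conc H) // => pi; have := Hs i; rewrite pi.
by apply/implyP; rewrite (ws_conc H) // => /Hs; rewrite inE.
Qed.

Lemma distinct_okP : distinct_ok w n m = uniq s.
Proof.
apply/idP/idP => [/allnP Hd|us].
  apply/(uniqP (set0, set0)) => j j'; rewrite !inE.
  have key a b : b < a -> a < size s -> nth (set0, set0) s a = nth (set0, set0) s b -> a = b.
    move=> lt_b lt_a E; have /allnP/(_ _ lt_b)/exnP[i lt_i] := Hd a lt_a.
    have lt_b' : b < size s by apply: ltn_trans lt_a.
    rewrite (ws_prem H (Ordinal lt_i) lt_a) (ws_prem H (Ordinal lt_i) lt_b').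
    by rewrite (ws_conc H (Ordinal lt_i) lt_a) (ws_conc H (Ordinal lt_i) lt_b') E !eqxx.
  move=> lt_j lt_j' E; case: (ltngtP j j') => // lt_jj'; last exact: key E.
  by apply/esym; apply: key lt_j' _.
apply/allnP => j lt_j; apply/allnP => j' lt_j'.
have lt_j2 : j' < m by apply: ltn_trans lt_j.
have : im j != im j' by rewrite /im nth_uniq // gtn_eqF.
apply: contraR; rewrite exn_alln negbK => /alln_ord Hn; apply/eqP.
rewrite [im j]surjective_pairing [im j']surjective_pairing.
have Hi (i : 'I_n) : prem_bit w n j i = prem_bit w n j' i /\ conc_bit w n j i = conc_bit w n j' i.
  by have := Hn i; rewrite negb_or !negbK => /andP[/eqP -> /eqP ->].
congr (_, _); apply/setP => i.
  by rewrite -!/(premise _) -(ws_prem H) // -(ws_prem H) //; case: (Hi i).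
by rewrite -!/(conclusion _) -(ws_conc H) // -(ws_conc H) //; case: (Hi i).
Qed.

Variable S : {set implication 'I_n}.
Hypothesis sS : s =i S.

Lemma im_S j : j < m -> im j \in S.
Proof. by move=> lt_j; rewrite -sS mem_nth. Qed.

Lemma S_im i : i \in S -> exists2 j, j < m & i = im j.
Proof.
by rewrite -sS => si; exists (index i s); rewrite ?index_mem // /im nth_index.
Qed.

Lemma disjoint_okP : disjoint_ok w n m = implicational_base S.
Proof.
apply/allnP/forallP => [Hd i|Hd j lt_j].
  apply/implyP => /S_im[j lt_j ->]; rewrite -setI_eq0; apply/eqP/setP => x.
  rewrite !inE -(ws_prem H) // -(ws_conc H) //; apply: negbTE.
  by have /alln_ord := Hd j lt_j; apply.
apply/alln_ord => x; rewrite (ws_prem H) // (ws_conc H) //.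
have := Hd (im j); rewrite im_S //= -setI_eq0 => /eqP/setP/(_ x).
by rewrite !inE => ->.
Qed.

Lemma closed_okP u : closed_ok w u n m = closed_set S [set i : 'I_n | nth false u i].
Proof.
apply/allnP/forallP => [Hd i|Hd j lt_j].
  apply/implyP => /S_im[j lt_j ->].
  by rewrite -(prem_sub (nth false u)) // -(conc_sub (nth false u)) //; apply: Hd.
rewrite (prem_sub (nth false u)) // (conc_sub (nth false u)) //.
by have := Hd (im j); rewrite im_S.
Qed.

Lemma derived_okP u y r (z : 'I_n) : derived_ok w u n m y r z =
  (z \in derived S [set i : 'I_n | stage_bit u n y r i]).
Proof.
rewrite inE; apply/exnP/existsP => [[j lt_j /andP[Hp Hc]]|[i /and3P[/S_im[j lt_j ->] Hp Hc]]].
  exists (im j); rewrite im_S // -(prem_sub (stage_bit u n y r)) // Hp /=.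
  by rewrite -(ws_conc H).
by exists j; rewrite // (prem_sub (stage_bit u n y r)) // Hp (ws_conc H).
Qed.

Lemma irr_ok_sound u (x : 'I_n) : closed_ok w u n m -> irr_ok w u n m x ->
  [set i : 'I_n | nth false u i] \in irr_at S x.
Proof.
move=> cl /andP[xM /alln_ord Hy]; apply/irr_at_certificate.
split; [by rewrite -closed_okP | by rewrite inE | move=> y; rewrite inE => yM].
have := Hy y; rewrite yM /= => /and3P[/alln_ord S0 /allnP SS xn].
exists (fun r => [set i : 'I_n | stage_bit u n y r i]).
split; last by rewrite inE card_ord.
  by apply/setP => z; rewrite !inE; apply: negbTE; apply: S0.
move=> r; rewrite card_ord => lt_r; apply/subsetP => z; rewrite inE => zr.
have /alln_ord/(_ z) := SS r lt_r; rewrite zr /= derived_okP => Hz.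
by rewrite !inE in Hz *; rewrite -orbA; apply: Hz.
Qed.

Lemma separates_okP u : separates_ok w u n =
  (K \subset [set i : 'I_n | nth false u i]) &&
  ([set i : 'I_n | nth false u i] :&: F == set0).
Proof.
apply/alln_ord/andP => [Hs|[/subsetP sK /eqP/setP sF] i].
  split; first by apply/subsetP => i; rewrite -(ws_K H) inE => Ki; have := Hs i; rewrite Ki => /andP[].
  apply/eqP/setP => i; rewrite !inE -(ws_F H); apply: negbTE.
  by have /andP[] := Hs i.
rewrite (ws_K H) (ws_F H); have := sF i; rewrite !inE => ->; rewrite andbT.
by apply/implyP => /sK; rewrite inE.
Qed.

Lemma arc_bit (a b : 'I_n) :
  exn m (fun j => prem_bit w n j a && conc_bit w n j b) = Defs.arc S a b.
Proof.
apply/exnP/existsP => [[j lt_j]|[i /andP[/S_im[j lt_j ->] ab]]].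
  by rewrite (ws_prem H) // (ws_conc H) // => ab; exists (im j); rewrite im_S.
by exists j; rewrite // (ws_prem H) // (ws_conc H).
Qed.

Lemma acyclic_ok_sound u : acyclic_ok w u n m -> acyclic S.
Proof.
move/alln_ord => Ha; apply/acyclic_certificate; exists (fun a b : 'I_n => order_bit u n a b).
have trip (a b : 'I_n) := elimT (alln_ord _ _) (proj2 (andP (Ha a))) b.
split.
- by move=> a b ab; have /andP[] := trip a b; rewrite arc_bit ab.
- move=> b a c ab bc; have /andP[_ /alln_ord/(_ c)] := trip a b.
  by rewrite ab bc.
- by move=> a /=; apply: negbTE; case/andP: (Ha a).
Qed.

Lemma degrees_okP : uniq s -> degrees_ok w n m <->
  [/\ degree S <= 4, premise_degree S <= 4, conclusion_degree S <= 2, dimension S <= 2 & K = set0].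
Proof.
move=> us; have cardE (P : pred (implication 'I_n)) : #|[set i in S | P i]| = \sum_(j < m) P (im j).
  exact: card_sum_nth.
have p1 (x : 'I_n) : nsum m (fun j => prem_bit w n j x || conc_bit w n j x) =
    #|[set i in S | (x \in premise i) || (x \in conclusion i)]|.
  by rewrite cardE; apply: eq_bigr => j _; rewrite (ws_prem H) // (ws_conc H).
have p2 (x : 'I_n) : nsum m (fun j => prem_bit w n j x) = #|[set i in S | x \in premise i]|.
  by rewrite cardE; apply: eq_bigr => j _; rewrite (ws_prem H).
have p3 (x : 'I_n) : nsum m (fun j => conc_bit w n j x) = #|[set i in S | x \in conclusion i]|.
  by rewrite cardE; apply: eq_bigr => j _; rewrite (ws_conc H).
have p4 j : j < m -> nsum n (fun i => prem_bit w n j i) = #|premise (im j)|.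
  move=> lt_j; rewrite -sum1_card [RHS]big_mkcond; apply: eq_bigr => i _.
  by rewrite (ws_prem H) //; case: (i \in _).
split=> [/and3P[/alln_ord h1 /allnP h2 /alln_ord h3]|[h1 h2 h3 h4 h5]].
  split; try by (apply/bigmax_leqP => x _; have := h1 x; rewrite p1 p2 p3; case/and3P).
    by apply/bigmax_leqP => i /S_im[j lt_j ->]; rewrite -p4 // h2.
  by apply/setP => x; rewrite inE -(ws_K H); apply: negbTE; apply: h3.
apply/and3P; split.
- apply/alln_ord => x; rewrite p1 p2 p3; apply/and3P.
  by split; [move/bigmax_leqP: h1 | move/bigmax_leqP: h2 | move/bigmax_leqP: h3]; apply.
- by apply/allnP => j lt_j; rewrite p4 //; move/bigmax_leqP: h4; apply; apply: im_S.
- by apply/alln_ord => x; rewrite (ws_K H) h5 inE.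
Qed.

End Bridge.

Lemma verifier_sound b w u : verifier b w u ->
  exists I, [/\ ics_codes I w, ics_yes I & b -> restriction I].
Proof.
case/exnP=> n _ /exnP[m _ /and5P[cok dis disj clo /and3P[/exnP[x lt_x Hx] sep res]]].
pose im j : implication 'I_n := ([set i : 'I_n | prem_bit w n j i], [set i : 'I_n | conc_bit w n j i]).
pose s := mkseq im m; pose K := [set i : 'I_n | K_bit w n i].
pose F := [set i : 'I_n | F_bit w n i].
have sz : size s = m by rewrite size_mkseq.
have H : word_spec s K F w.
  case/and4P: cok => /allnP h1 h2 /eqP h3 /allnP h4.
  split; rewrite ?sz // => *; rewrite ?nth_mkseq ?inE //.
pose S := [set i in s].
have sS : s =i S by move=> i; rewrite inE.
rewrite -sz in dis disj clo Hx res.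
have us : uniq s by rewrite -(distinct_okP H).
have base : implicational_base S by rewrite -(disjoint_okP H sS).
exists (IcsInstance base K F); split.
- by exists s; split=> //; apply: ics_wordP.
- exists [set i : 'I_n | nth false u i].
  move: sep; rewrite (separates_okP H) => /andP[sK /eqP sF]; split=> //.
  by apply/bigcupP; exists (Ordinal lt_x) => //; apply: (irr_ok_sound H sS).
- move=> bT; move: res; rewrite bT => /andP[ac dg].
  have [h1 h2 h3 h4 h5] := proj1 (degrees_okP H sS us) dg.
  by do !split=> //; apply: (acyclic_ok_sound H sS) ac.
Qed.

Lemma verifier_complete (b : bool) w I : ics_codes I w -> ics_yes I -> (b -> restriction I) ->
  exists2 u : word, size u <= 4 * size w ^ 3 + 4 & verifier b w u.
Proof.
case: I => n S base K F [s [us sS Ew]] [M [/bigcupP[x _ Mx] sKM MF]] res.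
simpl in s, us, sS, Ew, M, x, Mx, sKM, MF.
have H : word_spec s K F w by rewrite Ew; apply: ics_word_spec.
have /irr_at_certificate[clM xM cert] := Mx.
(* Finite choice over [y]; the condition [y \notin M] is kept inside the predicate so that every [y]
   receives a family. *)
have [St HSt] : exists St : 'I_n -> nat -> {set 'I_n},
    forall y, y \notin M -> stages S M y x (St y).
  apply: (fin_all_exists (P := fun y T => y \notin M -> stages S M y x T)) => y.
  case: (boolP (y \in M)) => yM; first by exists (fun=> set0).
  by have [T HT] := cert y yM; exists T.
have [R HR] : exists R : rel 'I_n, b ->
    [/\ subrel (Defs.arc S) R, transitive R & irreflexive R].
  case: b res => res; last by exists (fun _ _ => false).
  by have /acyclic_certificate[R HR] := proj1 (res isT); exists R.
pose len := n + n * n.+1 * n + n * n.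
pose memn (A : {set 'I_n}) i := nth false (bits A) i.
pose g p := if p < n then memn M p else
  let q := p - n in if q < n * n.+1 * n then
    [exists y : 'I_n, (nat_of_ord y == q %/ n %/ n.+1) && memn (St y (q %/ n %% n.+1)) (q %% n)]
  else let q' := q - n * n.+1 * n in
    [exists a : 'I_n, exists c : 'I_n, [&& nat_of_ord a == q' %/ n, nat_of_ord c == q' %% n & R a c]].
pose u := mkseq g len.
have gM (i : 'I_n) : nth false u i = (i \in M).
  rewrite nth_mkseq; last by have := ltn_ord i; rewrite /len; lia.
  by rewrite /g ltn_ord /memn nth_bits.
have gS (y : 'I_n) r (z : 'I_n) : r <= n -> stage_bit u n y r z = (z \in St y r).
  move=> le_r; have lt_q : (y * n.+1 + r) * n + z < n * n.+1 * n.
    have := ltn_ord y; have := ltn_ord z => lz ly.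
    have : (y * n.+1 + r).+1 * n <= n * n.+1 * n by rewrite leq_mul2r; apply/orP; right; nia.
    by rewrite mulSn; lia.
  rewrite /stage_bit nth_mkseq; last by rewrite /len; lia.
  rewrite /g ifF; last by lia.
  have -> : n + (y * n.+1 + r) * n + z - n = (y * n.+1 + r) * n + z by lia.
  rewrite /= lt_q; have n0 : 0 < n by apply: leq_ltn_trans (ltn_ord z).
  have -> : ((y * n.+1 + r) * n + z) %% n = z by rewrite modnMDl modn_small.
  have -> : ((y * n.+1 + r) * n + z) %/ n = y * n.+1 + r.
    by rewrite divnMDl // divn_small ?addn0.
  have -> : (y * n.+1 + r) %% n.+1 = r by rewrite modnMDl modn_small.
  have -> : (y * n.+1 + r) %/ n.+1 = y by rewrite divnMDl // divn_small ?addn0.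
  apply/existsP/idP => [[y' /andP[/eqP/val_inj ->]]|zS]; first by rewrite /memn nth_bits.
  by exists y; rewrite eqxx /memn nth_bits.
have gR (a c : 'I_n) : order_bit u n a c = R a c.
  have la := ltn_ord a; have lc := ltn_ord c.
  have lt_q : a * n + c < n * n by have : a.+1 * n <= n * n; [rewrite leq_mul2r la orbT | rewrite mulSn; lia].
  rewrite /order_bit nth_mkseq; last by rewrite /len; lia.
  rewrite /g ifF; last by lia.
  rewrite /= ifF; last by lia.
  have -> : n + n * n.+1 * n + a * n + c - n - n * n.+1 * n = a * n + c by lia.
  have n0 : 0 < n by apply: leq_ltn_trans lc.
  have -> : (a * n + c) %% n = c by rewrite modnMDl modn_small.
  have -> : (a * n + c) %/ n = a by rewrite divnMDl // divn_small ?addn0.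
  apply/existsP/idP => [[a' /existsP[c' /and3P[/eqP/val_inj -> /eqP/val_inj ->]]]|Rac] //.
  by exists a; apply/existsP; exists c; rewrite !eqxx.
have EM : [set i : 'I_n | nth false u i] = M by apply/setP => i; rewrite inE gM.
have szw := ws_size H; rewrite /record_at in szw.
exists u.
  rewrite size_mkseq /len; have : n <= size w by lia.
  move: (size w) => k le_k.
  (* The certificate has length [n ^ 3 + 2 * n ^ 2 + n], at most [4 * n ^ 3]. *)
  apply: (@leq_trans (4 * n ^ 3 + 4)); first by case: (n) => // a; rewrite !expnS expn0; nia.
  by rewrite leq_add2r leq_mul2l leq_exp2r.
apply/exnP; exists n; first by lia.
(* A record takes [2 * n + 1] bits, at least one, so the number of implications is at most the
   length of [w]. *)
apply/exnP; exists (size s); first by rewrite szw ltnS; apply: leq_trans (leq_addl _ _); rewrite leq_pmulr // addn1.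
apply/and5P; split; first exact: code_okP H.
- by rewrite (distinct_okP H).
- by rewrite (disjoint_okP H sS).
- by rewrite (closed_okP H sS) EM.
apply/and3P; split.
- apply/exnP; exists x => //; apply/andP; split; first by rewrite gM.
  apply/alln_ord => y; apply/implyP; rewrite gM => yM.
  have [S0 SS xS] := HSt y yM; rewrite card_ord in SS xS.
  apply/and3P; split; last by rewrite gS.
    by apply/alln_ord => z; rewrite gS // S0 inE.
  apply/allnP => r lt_r; apply/alln_ord => z; rewrite gS //; apply/implyP => zS.
  rewrite (derived_okP H sS) gM.
  have -> : [set i : 'I_n | stage_bit u n y r i] = St y r.
    by apply/setP => i; rewrite inE gS // ltnW.
  by have /subsetP/(_ z zS) := SS r lt_r; rewrite !in_setU in_set1 -orbA.
- by rewrite (separates_okP H) EM sKM MF eqxx.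
apply/implyP => bT; have [h0 [h1 [h2 [h3 [h4 h5]]]]] := res bT.
have [R1 R2 R3] := HR bT; apply/andP; split.
  apply/alln_ord => a; rewrite gR R3; apply/alln_ord => c; rewrite gR (arc_bit H sS).
  apply/andP; split; first by apply/implyP => /R1.
  apply/alln_ord => e; rewrite !gR; apply/implyP => /andP[ac ce].
  exact: R2 ac ce.
by apply/(degrees_okP H sS us).
Qed.

Lemma verifier_in_NP (b : bool) (L : language) :
  (forall w, L w <-> exists I, [/\ ics_codes I w, ics_yes I & b -> restriction I]) -> NP L.
Proof.
move=> HL; exists (verifier b); split; first exact: verifier_polytime.
exists 4, 3 => w; rewrite HL; split=> [[I [Ic Iy Ir]]|[u [_ /verifier_sound]]] //.
by have [u su Vu] := verifier_complete Ic Iy Ir; exists u.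
Qed.

Lemma ICS_Ext_in_NP : in_NP ICS_Ext.
Proof.
apply: (@verifier_in_NP false) => w; split=> [[I [Ic Iy]]|[I [Ic Iy _]]]; last by exists I.
by exists I; split.
Qed.

Lemma restricted_ICS_Ext_in_NP : in_NP (@restrict ICS_Ext restriction).
Proof.
apply: (@verifier_in_NP true) => w; split=> [[I [[Ir Ic] Iy]]|[I [Ic Iy Ir]]]; last first.
  by exists I; split=> //; split=> //; apply: Ir.
by exists I; split.
Qed.

(* The value of [b] at [x := a], as a difference of two sums. *)
Definition elet x a b := ESub (ESum x (EAdd a (EConst 1)) b) (ESum x a b).

Lemma eval_elet x a b w u r :
  eval (elet x a b) w u r = eval b w u (bind r x (eval a w u r)).
Proof. by rewrite /= addn1 big_ord_recr /= addKn. Qed.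

(** Closure under substitution: such a [g] may be called on any definable argument in any context.
    [W] stands for whichever projection recovers the input words, so one hypothesis fits every depth
    of context. *)
Definition DF1 (g : ctx 0 -> nat -> nat) := forall k (W : ctx k -> ctx 0) x,
  (forall p, W p = inputs p) -> D x -> D (fun p => g (W p) (x p)).

Definition DF2 (g : ctx 0 -> nat -> nat -> nat) := forall k (W : ctx k -> ctx 0) x y,
  (forall p, W p = inputs p) -> D x -> D y -> D (fun p => g (W p) (x p) (y p)).

Lemma D_W k (c : ctx 0 -> nat) (W : ctx k -> ctx 0) :
  D c -> (forall p, W p = inputs p) -> D (fun p => c (W p)).
Proof.
by case=> e He HW; exists e => p r Hr; rewrite HW; apply: (He (inputs p)).
Qed.

Lemma DF1I g : D (fun q : ctx 1 => g q.1 q.2) -> DF1 g.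
Proof.
case=> e He k W x HW [f Hf]; exists (elet 0 f e) => p r Hr.
rewrite eval_elet Hf // HW; apply: (He (inputs p, x p)) => -[|z] //.
Qed.

Lemma DF2I g : D (fun q : ctx 2 => g q.1.1 q.1.2 q.2) -> DF2 g.
Proof.
case=> e He k W x y HW [f Hf] [h Hh].
(* Both arguments first go to fresh variables, since overwriting variable 0 at once would spoil the
   evaluation of [h]. The offset of at least 2 keeps the fresh variables apart from 0 and 1. *)
exists (elet k.+2 f (elet k.+3 h (elet 0 (EVar k.+2) (elet 1 (EVar k.+3) e)))) => p r Hr.
rewrite !eval_elet Hf // Hh => [|z lt_z]; last by rewrite /bind ltn_eqF ?Hr //; lia.
rewrite HW; apply: (He (inputs p, x p, y p)) => -[|[|z]] //= _;
  rewrite /bind /= ?eqxx //; do !(case: eqP => [?|_] //); lia.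
Qed.

Ltac definable_step ::=
  match goal with
  | H : DF1 ?g |- _ => apply: H; [by [] | ]
  | H : DF2 ?g |- _ => apply: H; [by [] | | ]
  | H : D ?c |- _ => apply: (D_W H); by []
  end.

(** * From graphs to implicational bases *)

Lemma mem_val_eq n (C : {set 'I_n}) (i j : 'I_n) : i \in C -> i = j :> nat -> j \in C.
Proof. by move=> iC /val_inj <-. Qed.


(* Vertices are [0 .. B-1].  Edge [e] (present unless [absent e]) becomes
   [{a e, b e} -> {t_e}], followed by [{t_e} -> {t_{e+1}}], where [t_e] is the
   element [B + e].  An absent edge becomes [{t_e} -> {}], so that the number
   of implications does not depend on [absent]. *)

Section GraphDef.

Variables (B E : nat) (a b : nat -> nat) (absent F0 : nat -> bool).

Definition ground_size := B + E + 1.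

Definition chain_premise j := odd j || absent (j %/ 2).

Definition graph_prem j i :=
  if chain_premise j then i == B + j %/ 2 else (i == a (j %/ 2)) || (i == b (j %/ 2)).

Definition graph_conc j i :=
  if odd j then i == (B + j %/ 2).+1 else ~~ absent (j %/ 2) && (i == B + j %/ 2).

Definition graph_F i := (i == B + E) || (i < B) && F0 i.

Definition graph_bit p :=
  if p <= ground_size then p < ground_size else
  if p < 2 * ground_size + 1 then false else
  if p < 3 * ground_size + 1 then graph_F (p - (2 * ground_size + 1)) else
  let q := p - (3 * ground_size + 1) in
  let j := q %/ (2 * ground_size + 1) in
  let o := q %% (2 * ground_size + 1) in
  if o == 0 then true else
  if o <= ground_size then graph_prem j (o - 1) else graph_conc j (o - (ground_size + 1)).

Definition graph_word := mkseq graph_bit (record_at ground_size (2 * E)).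

End GraphDef.

Section Graph.

Variables (B E : nat) (a b : nat -> nat) (absent F0 : nat -> bool).
Hypothesis edge_vertices : forall e, e < E -> ~~ absent e -> a e < B /\ b e < B.
Hypothesis edge_irrefl : forall e, e < E -> ~~ absent e -> a e <> b e.

Let n := ground_size B E.
Let prem := graph_prem B a b absent.
Let conc := graph_conc B absent.

Definition graph_imp j : implication 'I_n :=
  ([set i : 'I_n | prem j i], [set i : 'I_n | conc j i]).
Definition graph_imps := mkseq graph_imp (2 * E).
Definition graph_Sigma := [set i in graph_imps].
Definition graph_Fset := [set i : 'I_n | graph_F B E F0 i].

Lemma graph_word_spec :
  word_spec graph_imps set0 graph_Fset (graph_word B E a b absent F0).
Proof.
have sz : size graph_imps = 2 * E by rewrite size_mkseq.
have rec j o : j < 2 * E -> o < 2 * n + 1 ->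
    nth false (graph_word B E a b absent F0) (record_at n j + o) =
    if o == 0 then true else if o <= n then prem j (o - 1) else conc j (o - (n + 1)).
  move=> lt_j lt_o; rewrite /graph_word nth_mkseq; last first.
    rewrite -/n /record_at -addnA ltn_add2l.
    have : j.+1 * (2 * n + 1) <= 2 * E * (2 * n + 1) by rewrite leq_mul2r lt_j orbT.
    by rewrite mulSn; move: (j * (2 * n + 1)) (2 * E * (2 * n + 1)) => x y; lia.
  rewrite /graph_bit -/n; have Eq : record_at n j + o - (3 * n + 1) = j * (2 * n + 1) + o.
    by rewrite /record_at -addnA addKn.
  rewrite !Eq; have ge : 3 * n + 1 <= record_at n j + o.
    by rewrite /record_at -addnA leq_addr.
  move: (record_at n j + o) ge => q ge.
  rewrite ifF; last by lia.
  rewrite ifF; last by lia.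
  rewrite ifF; last by lia.
  have -> : (j * (2 * n + 1) + o) %% (2 * n + 1) = o by rewrite modnMDl modn_small.
  have -> // : (j * (2 * n + 1) + o) %/ (2 * n + 1) = j.
  by rewrite divnMDl ?divn_small ?addn0 // addn1.
have small p : p < 3 * n + 1 ->
    nth false (graph_word B E a b absent F0) p = graph_bit B E a b absent F0 p.
  move=> lt_p; rewrite nth_mkseq //; apply: leq_trans lt_p _.
  by rewrite /record_at leq_addr.
split; rewrite ?sz.
- by rewrite size_mkseq.
- move=> i; rewrite -/n => lt_i; rewrite small; last by lia.
  by rewrite /graph_bit -/n ltnW.
- by rewrite -/n small; [rewrite /graph_bit -/n leqnn ltnn | lia].
- move=> i; rewrite /K_bit small; last by have := ltn_ord i; lia.
  have := ltn_ord i; rewrite inE /graph_bit -/n => lt_i.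
  by rewrite ifF; [rewrite ifT //; lia | lia].
- move=> i; rewrite /F_bit small; last by have := ltn_ord i; lia.
  have := ltn_ord i; rewrite inE /graph_bit -/n => lt_i.
  rewrite ifF; last by lia.
  rewrite ifF; last by lia.
  by rewrite ifT; [rewrite addKn | lia].
- by move=> j lt_j; rewrite -[record_at _ _]addn0 rec //; lia.
- move=> j i lt_j; have lt_i : i < n := ltn_ord i.
  rewrite /prem_bit addSnnS rec //; last by lia.
  by rewrite nth_mkseq //= inE ifT ?subn1.
- move=> j i lt_j; have lt_i : i < n := ltn_ord i.
  rewrite /conc_bit -addnA addSnnS rec //; last by lia.
  rewrite nth_mkseq //= inE ifF; last by lia.
  by congr (conc j _); lia.
Qed.

Lemma lt_t e : e <= E -> B + e < n.
Proof. by rewrite /n /ground_size; lia. Qed.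

Definition tnode e (le_e : e <= E) : 'I_n := Ordinal (lt_t le_e).

Lemma lt_base i : i < B -> i < n.
Proof. by rewrite /n /ground_size; lia. Qed.

Lemma imp_lt j : j < 2 * E -> j %/ 2 < E.
Proof. by rewrite ltn_divLR // mulnC. Qed.

Lemma edge_index e (b' : bool) : (2 * e + b') %/ 2 = e /\ odd (2 * e + b') = b'.
Proof.
split; first by rewrite mulnC divnMDl // divn_small ?addn0 //; case: b'.
by rewrite oddD oddM /= oddb.
Qed.

Lemma graph_imps_uniq : uniq graph_imps.
Proof.
rewrite map_inj_in_uniq ?iota_uniq // => j j'; rewrite !mem_iota /= => lt_j lt_j' [Ep Ec].
have Ep' i : i < n -> prem j i = prem j' i.
  by move=> lt_i; have /setP/(_ (Ordinal lt_i)) := Ep; rewrite !inE.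
have Ec' i : i < n -> conc j i = conc j' i.
  by move=> lt_i; have /setP/(_ (Ordinal lt_i)) := Ec; rewrite !inE.
have lt_e := imp_lt lt_j; have lt_e' := imp_lt lt_j'.
suff [Eo Ee] : odd j = odd j' /\ j %/ 2 = j' %/ 2.
  by rewrite (divn_eq j 2) (divn_eq j' 2) !modn2 Eo Ee.
have lt_te := lt_t (ltnW lt_e); have lt_te' := lt_t (ltnW lt_e').
have lt_te1 := lt_t lt_e; have lt_te1' := lt_t lt_e'.
rewrite addnS in lt_te1; rewrite addnS in lt_te1'.
have := Ep' _ lt_te; have := Ec' _ lt_te; have := Ep' _ lt_te'.
have := Ec' _ lt_te1; have := Ec' _ lt_te1'.
rewrite /prem /conc /graph_prem /graph_conc /chain_premise.
have := edge_vertices lt_e; have := edge_vertices lt_e'.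
by case: (odd j); case: (odd j'); case: (absent _) => /=; case: (absent _) => /= H1 H2;
  rewrite ?eqxx; try have {H1} := H1 isT; try have {H2} := H2 isT; lia.
Qed.

Lemma SigmaP (i : implication 'I_n) :
  reflect (exists2 j, j < 2 * E & i = graph_imp j) (i \in graph_Sigma).
Proof.
rewrite inE; apply: (iffP mapP) => -[j].
  by rewrite mem_iota => /andP[_ lt_j] ->; exists j.
by move=> lt_j ->; exists j; rewrite ?mem_iota.
Qed.

Lemma prem_conc_lt j i i' : j < 2 * E -> prem j i -> conc j i' -> i < i'.
Proof.
move=> lt_j; have lt_e := imp_lt lt_j; have := edge_vertices lt_e.
rewrite /prem /conc /graph_prem /graph_conc /chain_premise.
case: (odd j) => /=; first by lia.
by case: (absent _) => //= /(_ isT) [? ?]; lia.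
Qed.

Lemma graph_base : implicational_base graph_Sigma.
Proof.
apply/forallP => i; apply/implyP => /SigmaP[j lt_j ->].
rewrite -setI_eq0; apply/eqP/setP => x; rewrite !inE; apply/negP => /andP[xp xc].
by have := prem_conc_lt lt_j xp xc; rewrite ltnn.
Qed.

Definition graph_instance := IcsInstance graph_base set0 graph_Fset.

Lemma graph_instance_codes : ics_codes graph_instance (graph_word B E a b absent F0).
Proof.
exists graph_imps; split=> /=; first exact: graph_imps_uniq.
  by move=> i; rewrite inE.
exact: ics_wordP graph_word_spec.
Qed.

Lemma closed_chain (C : {set 'I_n}) e (le_e : e <= E) :
  closed_set graph_Sigma C -> tnode le_e \in C -> tnode (leqnn E) \in C.
Proof.
move=> /forallP cl; move: {2}(E - e) (erefl (E - e)) => d.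
elim: d e le_e => [|d IH] e le_e Ed tC.
  have Ee : e = E by lia.
  by apply: mem_val_eq tC _; rewrite /= Ee.
have lt_e : e < E by lia.
apply: (IH _ lt_e); first by lia.
have [E2 Eo] := edge_index e true.
have : graph_imp (2 * e + true) \in graph_Sigma.
  by apply/SigmaP; exists (2 * e + true) => //=; lia.
move/(implyP (cl _))/implyP => H; have {}H := subsetP (H _); apply: H.
  apply/subsetP => i; rewrite inE /prem /graph_prem /chain_premise Eo /= E2 => /eqP Ei.
  by apply: mem_val_eq tC _.
by rewrite inE /conc /graph_conc Eo E2 /= addnS.
Qed.

Lemma closed_edge (C : {set 'I_n}) e (x y : 'I_n) :
  closed_set graph_Sigma C -> e < E -> ~~ absent e -> x = a e :> nat -> y = b e :> nat ->
  x \in C -> y \in C -> tnode (leqnn E) \in C.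
Proof.
move=> cl lt_e pe xa yb xC yC; apply: (@closed_chain _ _ (ltnW lt_e)) => //.
move/forallP: cl => cl; have [E2 Eo] := edge_index e false.
have : graph_imp (2 * e + false) \in graph_Sigma.
  by apply/SigmaP; exists (2 * e + false) => //=; lia.
move/(implyP (cl _))/implyP => H; have {}H := subsetP (H _); apply: H.
  apply/subsetP => i; rewrite inE /prem /graph_prem /chain_premise Eo E2 (negbTE pe) /=.
  by case/orP=> /eqP Ei; [apply: mem_val_eq xC _ | apply: mem_val_eq yC _]; lia.
by rewrite inE /conc /graph_conc Eo E2 /= pe eqxx.
Qed.

Definition dominating_independent (I : nat -> bool) :=
  (forall e, e < E -> ~~ absent e -> ~~ (I (a e) && I (b e))) /\
  (forall i, i < B -> F0 i -> ~~ I i /\ exists2 e, e < E & ~~ absent e /\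
     (a e = i /\ I (b e) \/ b e = i /\ I (a e))).

(** No premise fits into an independent set, so [C] is closed and extends to a maximal closed set
    avoiding [x]. If that set contained a vertex of [F0], its neighbour in [C] would complete the
    premise of an edge and the chain would lead to [x]. *)
Lemma graph_yes_of_set I : dominating_independent I -> ics_yes graph_instance.
Proof.
case=> ind dom; pose x := tnode (leqnn E).
pose C := [set i : 'I_n | (i < B) && I i].
have tC e : (B + e < B) = false by lia.
have clC : closed_set graph_Sigma C && (x \notin C).
  rewrite inE /= tC andbT; apply/forallP => i; apply/implyP => /SigmaP[j lt_j ->].
  apply/implyP => /subsetP sub; exfalso.
  have lt_e := imp_lt lt_j; have lt_te := lt_t (ltnW lt_e).
  case Ec : (chain_premise absent j).
    have := sub (Ordinal lt_te); rewrite !inE /prem /graph_prem Ec eqxx => /(_ isT) /=.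
    by rewrite tC.
  have pe : ~~ absent (j %/ 2) by move: Ec; rewrite /chain_premise; case: odd => //= ->.
  have [la lb] := edge_vertices lt_e pe.
  have := sub (Ordinal (lt_base la)); have := sub (Ordinal (lt_base lb)).
  rewrite !inE /prem /graph_prem Ec /= !eqxx orbT => /(_ isT) /andP[_ Ib] /(_ isT) /andP[_ Ia].
  by have := ind _ lt_e pe; rewrite Ia Ib.
have [M maxM sCM] := @maxset_exists _ (fun C => closed_set graph_Sigma C && (x \notin C)) _ clC.
have /andP[clM xM] := maxsetp maxM.
exists M; split=> //=; first by apply/bigcupP; exists x; rewrite ?inE.
  exact: sub0set.
apply/setP => i; rewrite !inE; apply/negP => /andP[iM /orP[/eqP Ei|/andP[iB Fi]]].
  by case/negP: xM; apply: mem_val_eq iM _.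
have [_ [e lt_e [pe Ie]]] := dom i iB Fi; have [la lb] := edge_vertices lt_e pe.
have inM v (lv : v < B) : I v -> Ordinal (lt_base lv) \in M.
  by move=> Iv; apply: (subsetP sCM); rewrite inE /= lv.
case/negP: xM; case: Ie => -[Ei Iv].
  exact: (closed_edge clM lt_e pe (esym Ei) (erefl : Ordinal (lt_base lb) = b e :> nat) iM (inM _ _ Iv)).
exact: (closed_edge clM lt_e pe (erefl : Ordinal (lt_base la) = a e :> nat) (esym Ei) (inM _ _ Iv) iM).
Qed.

(* Since [x = t_E] is in F and in no premise, a meet-irreducible set avoiding
   F is maximal among the closed sets that avoid [x] itself. *)
Lemma graph_set_of_yes : ics_yes graph_instance -> exists I, dominating_independent I.
Proof.
case=> M [/bigcupP[z _]]; rewrite inE => maxM _ MF.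
pose x := tnode (leqnn E).
have F_out (i : 'I_n) : graph_F B E F0 i -> i \notin M.
  move=> Fi; apply/negP => iM; have /setP/(_ i) := MF.
  by rewrite !inE iM Fi.
have xM : x \notin M by apply: F_out; rewrite /graph_F eqxx.
have /andP[clM zM] := maxsetp maxM.
have Sbound j (i : 'I_n) : j < 2 * E -> prem j i -> i < B + E.
  move=> lt_j; have lt_e := imp_lt lt_j; have := edge_vertices lt_e.
  rewrite /prem /graph_prem /chain_premise.
  case: (odd j) => /=; first by lia.
  by case: (absent _) => /= [_|/(_ isT) [? ?]]; lia.
have clx : closed_set graph_Sigma (x |: M).
  apply/forallP => i; apply/implyP => iS; apply/implyP => /subsetP sub.
  have subM : premise i \subset M.
    apply/subsetP => y yi; have := sub y yi; rewrite in_setU1 => /predU1P[Ey|//].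
    case/SigmaP: iS yi => j lt_j ->; rewrite inE => /(Sbound _ _ lt_j).
    by rewrite Ey /= ltnn.
  by have := implyP (implyP (forallP clM i) iS) subM => s; apply: subset_trans s (subsetUr _ _).
have Ezx : z = x.
  apply/eqP; apply: contraT => zx; case/maxsetP: maxM => _ /(_ (x |: M)).
  rewrite clx !inE negb_or zx zM subsetUr => /(_ isT isT) EM.
  by case/negP: xM; rewrite -EM setU11.
subst z.
have tM e (le_e : e <= E) : tnode le_e \notin M.
  by apply: contra xM; apply: closed_chain.
pose I v := if insub v is Some i then (i : 'I_n) \in M else false.
have IE (i : 'I_n) : I i = (i \in M) by rewrite /I valK.
have IB v (lv : v < B) : I v = (Ordinal (lt_base lv) \in M) by rewrite -IE.
exists I; split=> [e lt_e pe|i iB Fi].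
  have [la lb] := edge_vertices lt_e pe; rewrite !IB; apply/negP => /andP[aM bM].
  by case/negP: xM; apply: (closed_edge clM lt_e pe _ _ aM bM).
have iM : Ordinal (lt_base iB) \notin M by apply: F_out; rewrite /graph_F /= iB Fi orbT.
split; first by rewrite IB.
set o := Ordinal _ in iM.
suff /existsP[e /andP[pe Ie]] : [exists e : 'I_E, ~~ absent e &&
    (((a e == i) && I (b e)) || ((b e == i) && I (a e)))].
  by exists e => //; split=> //; case/orP: Ie => /andP[/eqP ? ?]; [left|right].
(* If no neighbour of [o] were in [M], then [o |: M] would contradict maximality. It contains no
   premise: the elements [t_e] are outside [M], an edge at [o] lacks its other end, and loops are
   excluded by [edge_irrefl]. *)
apply: contraT => /existsPn Hn.
have clo : closed_set graph_Sigma (o |: M).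
  apply/forallP => im; apply/implyP => iS; apply/implyP => /subsetP sub.
  have iS' := iS; case/SigmaP: iS => j lt_j Ej.
  have lt_e := imp_lt lt_j; have lt_te := lt_t (ltnW lt_e).
  case Ec : (chain_premise absent j).
    have := sub (Ordinal lt_te); rewrite Ej !inE /prem /graph_prem Ec eqxx => /(_ isT).
    case/orP=> [/eqP/(congr1 val) /= Ei|tiM]; first by lia.
    by have := tM _ (ltnW lt_e); rewrite (_ : tnode _ = Ordinal lt_te) ?tiM //; apply: val_inj.
  have pe : ~~ absent (j %/ 2) by move: Ec; rewrite /chain_premise; case: odd => //= ->.
  have [la lb] := edge_vertices lt_e pe.
  have := sub (Ordinal (lt_base la)); have := sub (Ordinal (lt_base lb)).
  rewrite Ej !inE /prem /graph_prem Ec /= !eqxx orbT => /(_ isT) Hb /(_ isT) Ha.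
  have := Hn (Ordinal lt_e); rewrite pe /= !IB => Hne.
  exfalso; have := edge_irrefl lt_e pe.
  move: Hne Ha Hb; rewrite -!val_eqE /=.
  case: (a _ =P i) => [Ea|_] /=; case: (b _ =P i) => [Eb|_] /=.
  - by move=> _ _ _; rewrite Ea Eb.
  - by rewrite orbF => /negP Hb _ /Hb.
  - by move=> /negP Ha /Ha.
  - by move=> _ aM bM _; apply: (negP xM); apply: (closed_edge clM lt_e pe _ _ aM bM).
case/maxsetP: maxM => _ /(_ (o |: M)).
rewrite clo !inE negb_or xM andbT subsetUr -val_eqE /= => EM.
case/negP: iM; rewrite -EM ?setU11 //; lia.
Qed.

Lemma card_imps_le (P : pred (implication 'I_n)) (L : seq nat) :
  (forall j, j < 2 * E -> P (graph_imp j) -> j \in L) ->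
  #|[set i in graph_Sigma | P i]| <= size L.
Proof.
move=> HL; rewrite -(size_map graph_imp); apply: leq_trans (card_size _).
apply: subset_leq_card; apply/subsetP => i; rewrite inE => /andP[/SigmaP[j lt_j ->] Pj].
exact: map_f (HL _ lt_j Pj).
Qed.

Hypothesis edge_degree : forall i, i < B -> exists2 L : seq nat, size L <= 4 &
  forall e, e < E -> ~~ absent e -> (a e == i) || (b e == i) -> e \in L.

Lemma graph_restriction : restriction graph_instance.
Proof.
have halves j : j = 2 * (j %/ 2) + odd j by rewrite {1}(divn_eq j 2) modn2 mulnC.
(* With [i = B + e], index [2 * e] is the edge implication and [2 * e - 1] the chain implication
   from the previous element; for [e = 0] the truncated subtraction merely repeats 0. *)
have conc_in j i : conc j i -> j \in [:: 2 * (i - B); 2 * (i - B) - 1].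
  rewrite /conc /graph_conc !inE; have := halves j.
  by case: (odd j) => /= Ej; [|case/andP=> _] => /eqP Ei; lia.
have prem_in j i : B <= i -> j < 2 * E -> prem j i ->
    j \in [:: 2 * (i - B); 2 * (i - B) + 1].
  move=> Bi lt_j; have lt_e := imp_lt lt_j; have := edge_vertices lt_e.
  rewrite /prem /graph_prem /chain_premise !inE; have := halves j.
  case: (odd j) => /= Ej; first by lia.
  case: (absent _) => /= [_|/(_ isT) [? ?]]; lia.
have base_in i : i < B -> exists2 L, size L <= 4 &
    forall j, j < 2 * E -> prem j i || conc j i -> j \in L.
  move=> iB; have [L sL HL] := edge_degree iB; exists (map (muln 2) L); first by rewrite size_map.
  move=> j lt_j; have lt_e := imp_lt lt_j.
  rewrite /prem /conc /graph_prem /graph_conc /chain_premise; have := halves j.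
  case: (odd j) => /= Ej; first by lia.
  case Ea : (absent _) => /=; first by lia.
  rewrite [i == B + _](_ : _ = false) ?orbF; last by lia.
  move=> Hi; rewrite Ej addn0; apply: map_f; apply: HL => //; first by rewrite Ea.
  by rewrite ![_ == i]eq_sym.
do !split=> //=.
- apply/acyclic_certificate; exists (fun i i' : 'I_n => i < i'); split.
  + move=> i i' /existsP[im /and3P[/SigmaP[j lt_j ->]]]; rewrite !inE.
    exact: prem_conc_lt.
  + by move=> i j k; apply: ltn_trans.
  + by move=> i; rewrite /= ltnn.
- apply/bigmax_leqP => x _; case: (ltnP x B) => [xB|Bx].
    have [L sL HL] := base_in _ xB; apply: leq_trans sL; apply: card_imps_le => j lt_j.
    by rewrite !inE; apply: HL.
  apply: leq_trans (_ : size ([:: 2 * (x - B); 2 * (x - B) + 1] ++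
                       [:: 2 * (x - B); 2 * (x - B) - 1]) <= 4) => //.
  apply: card_imps_le => j lt_j; rewrite ![x \in _]inE mem_cat => /orP[xp|xc].
    by rewrite prem_in.
  by rewrite (conc_in _ _ xc) orbT.
- apply/bigmax_leqP => x _; case: (ltnP x B) => [xB|Bx].
    have [L sL HL] := base_in _ xB; apply: leq_trans sL; apply: card_imps_le => j lt_j.
    by rewrite !inE => H; apply: HL => //; rewrite H.
  apply: leq_trans (_ : size [:: 2 * (x - B); 2 * (x - B) + 1] <= 4) => //.
  by apply: card_imps_le => j lt_j; rewrite inE; apply: prem_in.
- apply/bigmax_leqP => x _.
  apply: leq_trans (_ : size [:: 2 * (x - B); 2 * (x - B) - 1] <= 2) => //.
  by apply: card_imps_le => j lt_j; rewrite inE; apply: conc_in.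
- apply/bigmax_leqP => i /SigmaP[j lt_j ->]; rewrite /graph_imp /= /premise /=.
  have lt_e := imp_lt lt_j; have lt_te := lt_t (ltnW lt_e).
  case Ec : (chain_premise absent j).
    apply: leq_trans (_ : #|[set Ordinal lt_te]| <= 2); last by rewrite cards1.
    apply: subset_leq_card; apply/subsetP => i'; rewrite !inE /prem /graph_prem Ec.
    by move=> /eqP Ei; apply/eqP; apply: val_inj.
  have pe : ~~ absent (j %/ 2) by move: Ec; rewrite /chain_premise; case: odd => //= ->.
  have [la lb] := edge_vertices lt_e pe.
  apply: leq_trans (_ : #|[set Ordinal (lt_base la); Ordinal (lt_base lb)]| <= 2).
    apply: subset_leq_card; apply/subsetP => i'; rewrite !inE /prem /graph_prem Ec.
    by case/orP=> /eqP Ei; apply/orP; [left|right]; apply/eqP; apply: val_inj.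
  by rewrite cards2; case: (_ != _).
Qed.

End Graph.

Section GraphDefinable.

Variables (B E : ctx 0 -> nat) (a b : ctx 0 -> nat -> nat) (absent F0 : ctx 0 -> nat -> bool).
Hypotheses (DB : D B) (DE : D E) (Da : DF1 a) (Db : DF1 b).
Hypothesis Dabsent : DF1 (fun c x => absent c x).
Hypothesis DF0 : DF1 (fun c x => F0 c x).

Lemma D_graph_word : D (fun p : ctx 1 =>
  graph_bit (B p.1) (E p.1) (a p.1) (b p.1) (absent p.1) (F0 p.1) p.2).
Proof.
have Dn : D (fun c => ground_size (B c) (E c)) by unfold ground_size; definable.
have Dp : DF2 (fun c j i => graph_prem (B c) (a c) (b c) (absent c) j i).
  by apply: DF2I; unfold graph_prem, chain_premise; definable.
have Dc : DF2 (fun c j i => graph_conc (B c) (absent c) j i).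
  by apply: DF2I; unfold graph_conc; definable.
have DFF : DF1 (fun c i => graph_F (B c) (E c) (F0 c) i).
  by apply: DF1I; unfold graph_F; definable.
by unfold graph_bit; definable.
Qed.

Lemma D_graph_size : D (fun c => record_at (ground_size (B c) (E c)) (2 * E c)).
Proof. by unfold record_at, ground_size; definable. Qed.

End GraphDefinable.

(** * From formulas to graphs *)

(* A formula has [m] clauses, and slots [4 j .. 4 j + 3] hold the literals of
   clause [j]: 0 stands for no literal, [2 y + 1] for the variable [y] and
   [2 y + 2] for its negation.  Every variable gets one copy per slot, so that
   no copy is used in two clauses; copy [k] of [y] has index [k * Y + y]. *)

Definition satisfies m (lit : nat -> nat) (v : nat -> bool) :=
  forall j, j < m -> exists2 s, s < 4 & lit (4 * j + s) != 0 /\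
    v ((lit (4 * j + s) - 1) %/ 2) = odd (lit (4 * j + s)).

Section CnfDef.

Variables (Y m : nat) (lit : nat -> nat).

Definition ncopies := 4 * m * Y.
Definition cnf_vertices := 3 * ncopies + m.
Definition cnf_edges := 3 * ncopies + 4 * m.

Definition slot_vertex k :=
  k * Y + (lit k - 1) %/ 2 + (if odd (lit k) then 0 else ncopies).

(** With [P = ncopies], vertex [e < P] is a positive copy, [P + e] the matching negative copy,
    [2 * P + e] an auxiliary vertex and [3 * P + j] clause [j]. The four blocks of edges join
    positive and negative copies, auxiliary vertices and negative copies, auxiliary vertices and the
    next positive copies, clauses and literals. Dominating [2 * P + e] requires the negative copy
    [e] or the next positive copy, so truth is passed along the cycle; adding [Y] modulo [P] reaches
    the next copy of the same variable. *)
Definition cnf_a e :=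
  if e < ncopies then e else
  if e < 2 * ncopies then e + ncopies else
  if e < 3 * ncopies then e else 3 * ncopies + (e - 3 * ncopies) %/ 4.

Definition cnf_b e :=
  if e < ncopies then ncopies + e else
  if e < 2 * ncopies then e else
  if e < 3 * ncopies then (e - 2 * ncopies + Y) %% ncopies
  else slot_vertex (e - 3 * ncopies).

Definition cnf_absent e := (3 * ncopies <= e) && (lit (e - 3 * ncopies) == 0).
Definition cnf_F i := 2 * ncopies <= i.

End CnfDef.

Section Cnf.

Variables (Y m : nat) (lit : nat -> nat).
Hypothesis lit_le : forall k, k < 4 * m -> lit k <= 2 * Y.

Let P := ncopies Y m.
Let B := cnf_vertices Y m.
Let E := cnf_edges Y m.
Let a := cnf_a Y m.
Let b := cnf_b Y m lit.
Let absent := cnf_absent Y m lit.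

Lemma lit_var_lt k : k < 4 * m -> lit k != 0 -> (lit k - 1) %/ 2 < Y.
Proof. by move=> /lit_le le0 nz; rewrite ltn_divLR //; lia. Qed.

Lemma copy_lt k y : k < 4 * m -> y < Y -> k * Y + y < P.
Proof.
move=> lt_k lt_y; have : k.+1 * Y <= P by rewrite leq_mul2r lt_k orbT.
by rewrite mulSn; lia.
Qed.

Lemma next_small e : e < P -> (e + Y) %% P = e + Y \/ (e + Y) %% P + P = e + Y.
Proof.
move=> lt_e; have YP : Y <= P.
  rewrite /P /ncopies in lt_e *; move: lt_e; case: m => [|m']; first by rewrite muln0 mul0n.
  by move=> _; rewrite leq_pmull.
case: (ltnP (e + Y) P) => [lt|le]; first by left; rewrite modn_small.
right; rewrite -{1}(subnK le) modnDr modn_small ?subnK //; lia.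
Qed.

Variant edge_spec e : Prop :=
  | EdgeCopy of e < P & a e = e & b e = P + e & absent e = false
  | EdgeNeg e' of e' < P & e = P + e' & a e = 2 * P + e' & b e = P + e' & absent e = false
  | EdgeNext e' of e' < P & e = 2 * P + e' & a e = 2 * P + e' & b e = (e' + Y) %% P
      & absent e = false
  | EdgeSlot k of k < 4 * m & e = 3 * P + k & a e = 3 * P + k %/ 4
      & b e = slot_vertex Y m lit k & absent e = (lit k == 0).

Lemma edgeP e : e < E -> edge_spec e.
Proof.
rewrite /E /cnf_edges -/P => lt_e.
have [a_ b_ abs] : [/\ a e = cnf_a Y m e, b e = cnf_b Y m lit e & absent e = cnf_absent Y m lit e] by [].
move: a_ b_ abs; rewrite /cnf_a /cnf_b /cnf_absent -/P.
case: (ltnP e P) => [lt1|le1].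
  rewrite (_ : (3 * P <= e) = false); last by lia.
  by move=> *; apply: EdgeCopy.
case: (ltnP e (2 * P)) => [lt2|le2].
  rewrite (_ : (3 * P <= e) = false); last by lia.
  by move=> a_ b_ abs; apply: (@EdgeNeg _ (e - P)) => //; lia.
case: (ltnP e (3 * P)) => [lt3|le3].
  by move=> a_ b_ abs; apply: (@EdgeNext _ (e - 2 * P)) => //; lia.
by move=> a_ b_ abs; apply: (@EdgeSlot _ (e - 3 * P)) => //; lia.
Qed.

Lemma slot_vertex_lt k : k < 4 * m -> lit k != 0 -> slot_vertex Y m lit k < 2 * P.
Proof.
move=> lt_k nz; have := copy_lt lt_k (lit_var_lt lt_k nz).
by rewrite /slot_vertex -/P; case: odd; lia.
Qed.

Lemma cnf_edge_vertices e : e < E -> ~~ absent e -> a e < B /\ b e < B.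
Proof.
rewrite /B /cnf_vertices -/P.
case/edgeP=> [lt_e -> ->|e' lt_e _ -> ->|e' lt_e _ -> ->|k lt_k _ -> ->] -> // nz; try lia.
have : k %/ 4 < m by rewrite ltn_divLR // mulnC.
by have := slot_vertex_lt lt_k nz; lia.
Qed.

Lemma cnf_edge_irrefl e : e < E -> ~~ absent e -> a e <> b e.
Proof.
case/edgeP=> [lt_e -> ->|e' lt_e _ -> ->|e' lt_e _ -> ->|k lt_k _ -> ->] -> // nz; try lia.
by have := slot_vertex_lt lt_k nz; lia.
Qed.

Lemma cnf_edge_degree i : i < B -> exists2 L : seq nat, size L <= 4 &
  forall e, e < E -> ~~ absent e -> (a e == i) || (b e == i) -> e \in L.
Proof.
rewrite /B /cnf_vertices -/P => iB.
have slotv k : k < 4 * m -> lit k != 0 ->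
    slot_vertex Y m lit k = i -> i < P /\ k = i %/ Y \/ P <= i < 2 * P /\ k = (i - P) %/ Y.
  move=> lt_k nz; have lt_y := lit_var_lt lt_k nz; have lt_c := copy_lt lt_k lt_y.
  have divE : (k * Y + (lit k - 1) %/ 2) %/ Y = k.
    by rewrite divnMDl; [rewrite (divn_small lt_y) addn0 | lia].
  rewrite /slot_vertex -/P; case: odd => <-; [left|right].
    by rewrite addn0 divE.
  by rewrite addnK divE; split=> //; lia.
case: (ltnP i (2 * P)) => [lt_i|le_i]; last case: (ltnP i (3 * P)) => [lt_i|le_i3].
- case: (ltnP i P) => iP.
    (* The cyclic predecessor of [i] is [i - Y] or, across the wrap, [i + P - Y]; both are listed,
       and the bound 4 still holds. *)
    exists [:: i; 2 * P + (i - Y); 2 * P + (i + P - Y); 3 * P + i %/ Y] => // e.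
    case/edgeP=> [lt_e -> ->|e' lt_e -> -> ->|e' lt_e -> -> ->|k lt_k -> -> ->] -> // nz;
      rewrite !inE => H; try lia.
      by have := next_small lt_e; lia.
    have {}H : slot_vertex Y m lit k = i by lia.
    have := slotv _ lt_k nz H; lia.
  exists [:: i - P; i; 3 * P + (i - P) %/ Y] => // e.
  case/edgeP=> [lt_e -> ->|e' lt_e -> -> ->|e' lt_e -> -> ->|k lt_k -> -> ->] -> // nz;
      rewrite !inE => H; try lia.
  have {}H : slot_vertex Y m lit k = i by lia.
  have := slotv _ lt_k nz H; lia.
- exists [:: i - P; i] => // e.
  case/edgeP=> [lt_e -> ->|e' lt_e -> -> ->|e' lt_e -> -> ->|k lt_k -> -> ->] -> // nz;
      rewrite !inE => H; try lia.
  by have := slot_vertex_lt lt_k nz; lia.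
- pose j := i - 3 * P.
  exists [:: 3 * P + 4 * j; 3 * P + 4 * j + 1; 3 * P + 4 * j + 2; 3 * P + 4 * j + 3] => // e.
  case/edgeP=> [lt_e -> ->|e' lt_e -> -> ->|e' lt_e -> -> ->|k lt_k -> -> ->] -> // nz;
      rewrite !inE => H; try lia.
  have Hk : k %/ 4 = j by have := slot_vertex_lt lt_k nz; rewrite /j; lia.
  have := divn_eq k 4; have := ltn_pmod k (isT : 0 < 4); rewrite Hk; lia.
Qed.

(** The set takes the positive copies of true variables and the negative copies of false ones. The
    two neighbours of an auxiliary vertex are copies of one variable with opposite signs, so exactly
    one of them is taken. *)
Lemma sat_independent v : satisfies m lit v -> exists I,
  dominating_independent B E a b absent (cnf_F Y m) I.
Proof.
move=> sat; pose I i := if i < P then v (i %% Y) else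
  if i < 2 * P then ~~ v ((i - P) %% Y) else false.
have Ipos i : i < P -> I i = v (i %% Y) by rewrite /I => ->.
have Ineg i : i < P -> I (P + i) = ~~ v (i %% Y).
  by move=> lt_i; rewrite /I ifF; [rewrite ifT ?addKn //; lia | lia].
have Iout i : I (2 * P + i) = false.
  by rewrite /I ifF; [rewrite ifF //; lia | lia].
have Iout' i : I (3 * P + i) = false by rewrite mulSn -addnA addnCA Iout.
exists I; split=> [e lt_e pe|i iB].
  case: (edgeP lt_e) pe => [lt_e' -> ->|e' lt_e' _ -> ->|e' lt_e' _ -> ->|k lt_k _ -> ->] -> _;
    rewrite ?Iout ?Iout' //.
  by rewrite Ipos // Ineg // andbN.
rewrite /cnf_F -/P => Fi; split; first by rewrite -(subnKC Fi) Iout.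
rewrite /B /cnf_vertices -/P in iB; rewrite /E /cnf_edges -/P.
case: (ltnP i (3 * P)) => [lt_i|le_i].
  pose e := i - 2 * P; have lt_e : e < P by lia.
  have ltE : 2 * P + e < E by rewrite /E /cnf_edges -/P; lia.
  have ltE' : P + e < E by rewrite /E /cnf_edges -/P; lia.
  case Ev : (v (e %% Y)).
    exists (2 * P + e); first by lia.
    case: (edgeP ltE) => [|e'|e' lt_e' Ee -> -> ->|k]; try lia.
    split=> //; left; split; first by lia.
    have <- : e = e' by lia.
    rewrite Ipos; last by rewrite ltn_mod; lia.
    by rewrite modn_dvdm ?modnDr // dvdn_mull.
  exists (P + e); first by lia.
  case: (edgeP ltE') => [|e' lt_e' Ee -> -> ->|e'|k]; try lia.
  split=> //; left; split; first by lia.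
  by have <- : e = e' by [lia]; rewrite Ineg // Ev.
pose j := i - 3 * P; have lt_j : j < m by lia.
have [s lt_s [nz vs]] := sat j lt_j; set k := 4 * j + s in nz vs.
have lt_k : k < 4 * m by rewrite /k; lia.
have ltE : 3 * P + k < E by rewrite /E /cnf_edges -/P; lia.
exists (3 * P + k); first by lia.
case: (edgeP ltE) => [|e'|e'|k' lt_k' Ek -> -> ->]; try lia.
have Ekk : k' = k by lia.
subst k'; split=> //; left; split.
  have -> : k %/ 4 = j by rewrite /k mulnC divnMDl // (divn_small lt_s) addn0.
  by lia.
have lt_y := lit_var_lt lt_k nz; have lt_c := copy_lt lt_k lt_y.
have modE : (k * Y + (lit k - 1) %/ 2) %% Y = (lit k - 1) %/ 2 by rewrite modnMDl modn_small.
rewrite /slot_vertex -/P; case Eo : (odd (lit k)); rewrite ?addn0.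
  by rewrite Ipos // modE vs.
by rewrite addnC Ineg // modE vs Eo.
Qed.

(** Copy 0 of variable [y] is vertex [y] itself, so [I] serves as the valuation. A positive copy in
    [I] spreads around the cycle to copy 0. If a clause uses a negative copy [k], copy 0 cannot be
    in [I], as it would spread to the positive copy [k], which excludes the negative one. *)
Lemma independent_sat I : dominating_independent B E a b absent (cnf_F Y m) I ->
  exists v, satisfies m lit v.
Proof.
case=> ind dom; exists I.
have excl e : e < P -> I e -> ~~ I (P + e).
  move=> lt_e Ie; have ltE : e < E by rewrite /E /cnf_edges -/P; lia.
  have := ind e ltE; case: (edgeP ltE) => [_ -> -> ->|e'|e'|k]; lia.
have next e : e < P -> I e -> I ((e + Y) %% P).
  move=> lt_e Ie; have := @dom (2 * P + e); rewrite /B /cnf_vertices /cnf_F -/P.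
  case; [by lia | by lia | move=> _ [e0 lt_e0 []]].
  have lt_m : (e + Y) %% P < P by rewrite ltn_mod; lia.
  case/edgeP: lt_e0 => [lt_e0 -> -> ->|e' lt_e' _ -> -> ->|e' lt_e' _ -> -> ->|k lt_k _ -> -> ->] pe.
  - by case=> -[? _]; lia.
  - case=> -[Ee]; last by lia.
    have -> : e' = e by lia.
    by rewrite (negbTE (excl _ lt_e Ie)).
  - have lt_m' : (e' + Y) %% P < P by rewrite ltn_mod; lia.
    by case=> -[Ee]; [have -> : e' = e by lia | lia].
  - by have sv := slot_vertex_lt lt_k pe; case=> -[? _]; lia.
have shift c e : e < P -> I e -> I ((e + c * Y) %% P).
  elim: c => [|c IH] lt_e Ie; first by rewrite addn0 modn_small.
  have := next _ _ (IH lt_e Ie); rewrite ltn_mod modnDml => H.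
  by rewrite mulSnr addnA; apply: H; lia.
move=> j lt_j.
have := @dom (3 * P + j); rewrite /B /cnf_vertices /cnf_F -/P.
case; [by lia | by lia | move=> _ [e lt_e []]].
case/edgeP: lt_e => [lt_e -> -> ->|e' lt_e' _ -> -> ->|e' lt_e' _ -> -> ->|k lt_k _ -> -> ->] pe;
  try by case=> -[? _]; lia.
case=> -[Ek Ik]; last by have := slot_vertex_lt lt_k pe; lia.
have Ekj : k = 4 * j + k %% 4 by have := divn_eq k 4; lia.
exists (k %% 4); first by rewrite ltn_mod.
rewrite -Ekj; split=> //.
have lt_y := lit_var_lt lt_k pe; have lt_c := copy_lt lt_k lt_y.
move: Ik; rewrite /slot_vertex -/P; set y := _ %/ 2 in lt_y lt_c *.
have lt_yP : y < P by lia.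
case: (odd (lit k)); rewrite ?addn0 => Ik.
  have := shift (4 * m - k) _ lt_c Ik.
  suff -> : (k * Y + y + (4 * m - k) * Y) %% P = y by [].
  rewrite addnAC -mulnDl subnKC; last by lia.
  by rewrite -/(ncopies Y m) -/P modnDl modn_small.
apply/negP => Iy; have := shift k _ lt_yP Iy; rewrite addnC modn_small // => Ik'.
by have := excl _ lt_c Ik'; rewrite addnC Ik.
Qed.

Definition cnf_instance : ics_instance := graph_instance (cnf_F Y m) cnf_edge_vertices.

Definition cnf_word := graph_word B E a b absent (cnf_F Y m).

Lemma cnf_instance_codes : ics_codes cnf_instance cnf_word.
Proof. exact: graph_instance_codes. Qed.

Lemma cnf_instance_restriction : restriction cnf_instance.
Proof. exact: graph_restriction cnf_edge_degree. Qed.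

Lemma cnf_instance_yes : ics_yes cnf_instance <-> exists v, satisfies m lit v.
Proof.
split=> [/(graph_set_of_yes cnf_edge_irrefl)[I]|[v /sat_independent[I HI]]].
  exact: independent_sat.
exact: (graph_yes_of_set _ HI).
Qed.

End Cnf.

Lemma cnf_reduction (Y m : word -> nat) (lit : word -> nat -> nat) :
  D (fun c : ctx 0 => Y c.1) -> D (fun c : ctx 0 => m c.1) ->
  D (fun c : ctx 1 => lit c.1.1 c.2) ->
  (forall w k, k < 4 * m w -> lit w k <= 2 * Y w) ->
  exists2 f, polytime_fun f & forall w, exists I, [/\ restriction I, ics_codes I (f w)
    & ics_yes I <-> exists v, satisfies (m w) (lit w) v].
Proof.
move=> DY Dm Dl lit_le; have DL := DF1I (g := fun c k => lit c.1 k) Dl.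
exists (fun w => cnf_word (Y w) (m w) (lit w)); last first.
  move=> w; exists (cnf_instance (lit_le w)); split.
  - exact: cnf_instance_restriction.
  - exact: cnf_instance_codes.
  - exact: cnf_instance_yes.
have DP : D (fun c : ctx 0 => ncopies (Y c.1) (m c.1)) by unfold ncopies; definable.
have DB : D (fun c : ctx 0 => cnf_vertices (Y c.1) (m c.1)) by unfold cnf_vertices; definable.
have DE : D (fun c : ctx 0 => cnf_edges (Y c.1) (m c.1)) by unfold cnf_edges; definable.
have Da : DF1 (fun c => cnf_a (Y c.1) (m c.1)).
  by apply: DF1I; unfold cnf_a; definable.
have Db : DF1 (fun c => cnf_b (Y c.1) (m c.1) (lit c.1)).
  by apply: DF1I; unfold cnf_b, slot_vertex; definable.
have Dabs : DF1 (fun c e => cnf_absent (Y c.1) (m c.1) (lit c.1) e).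
  by apply: DF1I; unfold cnf_absent; definable.
have DF : DF1 (fun c e => cnf_F (Y c.1) (m c.1) e).
  by apply: DF1I; unfold cnf_F; definable.
have := definable_polytime (args := fun w => [:: w]) (fun=> isT)
  (D_graph_size DB DE) (D_graph_word DB DE Da Db Dabs DF).
by [].
Qed.

(** * Cook's theorem *)

Definition pos_lit x := 2 * x + 1.
Definition neg_lit x := 2 * x + 2.

Definition sel s l0 l1 l2 l3 : nat :=
  if s == 0 then l0 else if s == 1 then l1 else if s == 2 then l2 else l3.

Definition holds (v : nat -> bool) l := (l != 0) && (v ((l - 1) %/ 2) == odd l).

Lemma holds_pos v x : holds v (pos_lit x) = v x.
Proof.
by rewrite /holds /pos_lit addn1 subn1 /= mul2n odd_double -[x.*2]muln2 mulnK // eqb_id.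
Qed.

Lemma holds_neg v x : holds v (neg_lit x) = ~~ v x.
Proof.
rewrite /holds /neg_lit addn2 subn1 /= mul2n odd_double eqbF_neg -addn1 -muln2.
by rewrite divnMDl // addn0.
Qed.

Definition csat (v : nat -> bool) (f : nat -> nat) :=
  exists2 s, s < 4 & f s != 0 /\ v ((f s - 1) %/ 2) = odd (f s).

Lemma csat_sel v l0 l1 l2 l3 : csat v (fun s => sel s l0 l1 l2 l3) <->
  [|| holds v l0, holds v l1, holds v l2 | holds v l3].
Proof.
split=> [[s lt_s [nz /eqP vs]]|].
  have : holds v (sel s l0 l1 l2 l3) by rewrite /holds nz.
  by rewrite /sel; case: s {nz vs} lt_s => [|[|[|[|]]]] //= _ ->; rewrite ?orbT.
by case/or4P=> /andP[nz /eqP vs]; [exists 0 | exists 1 | exists 2 | exists 3].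
Qed.

Section Tableau.

Variables (M : machine) (w : word) (len T : nat).

Let nt := (ntapes M).+1.
Let Z : finType := (state M * {ffun 'I_nt -> cell (aux M)})%type.
Let A : finType := cell (aux M).

Definition nz := #|Z|.
Definition na := #|A|.
Definition zof (z : nat) : Z := nth (start M, [ffun=> None]) (enum Z) z.
Definition zindex (z : Z) := index z (enum Z).
Definition sym (a : nat) : A := nth None (enum A) a.
Definition aindex (a : A) := index a (enum A).

Lemma zindexK z : zof (zindex z) = z.
Proof. by rewrite /zof nth_index // mem_enum. Qed.
Lemma zindex_lt z : zindex z < nz.
Proof. by rewrite /nz cardE index_mem mem_enum. Qed.
Lemma aindexK a : sym (aindex a) = a.
Proof. by rewrite /sym nth_index // mem_enum. Qed.
Lemma aindex_lt a : aindex a < na.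
Proof. by rewrite /na cardE index_mem mem_enum. Qed.
Lemma symK a : a < na -> aindex (sym a) = a.
Proof. by rewrite /na cardE => lt_a; rewrite /aindex index_uniq // enum_uniq. Qed.

(** A halted control rewrites what it scans and stays put, which matches the fixpoint behaviour of
    [step]. *)
Definition ctrl_next (z : Z) : state M * {ffun 'I_nt -> cell (aux M) * move} :=
  if halt z.1 then (z.1, [ffun i => (z.2 i, MoveN)]) else delta z.1 z.2.

(** In a step the cell at index [j.+1] moves to index [j + shift m]; the offset by one avoids
    negative displacements. *)
Definition shift (m : move) := match m with MoveR => 0 | MoveN => 1 | MoveL => 2 end.

Definition mismatch z z' : nat := (zof z').1 != (ctrl_next (zof z)).1.
Definition scanned z i := aindex ((zof z).2 (inord i)).
Definition written z i := aindex ((ctrl_next (zof z)).2 (inord i)).1.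
Definition shifted z i := shift ((ctrl_next (zof z)).2 (inord i)).2.
Definition not_start z (_ : nat) : nat := (zof z).1 != start M.
Definition not_accepting z (_ : nat) : nat := (zof z).2 ord0 != Some (inl true).

(* Cell contents are recorded relative to the head, which is always at index
   [T.+1]. *)
Definition stride := 3 * T + 6.
Definition cell_var t i j a := 3 * (((t * nt + i) * stride + j) * na + a).
(* States that the index of the state and scanned symbols at time [t] is at
   least [z]. *)
Definition ctrl_var t z := 3 * (t * nz.+1 + z) + 1.
Definition len_var k := 3 * (2 * k) + 2.
Definition bit_var k := 3 * (2 * k + 1) + 2.

Definition initial i j :=
  if [&& i == 0, T.+1 <= j & j - T.+1 < size w]
  then if nth false w (j - T.+1) then aindex (Some (inl true)) else aindex (Some (inl false))
  else aindex None.

(** The literals [c0], [c1] together say that the control at time [t] is not [z]. Families 0 and 1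
    make the next state and the scanned symbols correct, 2 and 3 transport the old cells and the
    written one, 4 and 5 fix the ends of the ladder, 6 and 7 express start and acceptance, 8 the
    known initial cells. Families 9 to 12 put a guessed word on the second tape, [len_var k] meaning
    that its length exceeds [k]. Index combinations without a constraint receive a tautology. *)
Definition clause fam t i z y j s :=
  let c0 := neg_lit (ctrl_var t z) in
  let c1 := pos_lit (ctrl_var t z.+1) in
  let trivial := sel s (pos_lit 0) (neg_lit 0) 0 0 in
  if fam == 0 then
    if (t < T) && (finite_table nz nz mismatch z y != 0)
    then sel s c0 c1 (neg_lit (ctrl_var t.+1 y)) (pos_lit (ctrl_var t.+1 y.+1))
    else trivial
  else if fam == 1 then
    if (y < na) && (finite_table nz nt scanned z i != y)
    then sel s c0 c1 (neg_lit (cell_var t i T.+1 y)) 0 else trivial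
  else if fam == 2 then
    if [&& t < T, y < na & j != T]
    then sel s c0 c1 (neg_lit (cell_var t i j.+1 y))
           (pos_lit (cell_var t.+1 i (j + finite_table nz nt shifted z i) y))
    else trivial
  else if fam == 3 then
    if t < T
    then sel s c0 c1 (pos_lit (cell_var t.+1 i (T + finite_table nz nt shifted z i)
                                 (finite_table nz nt written z i))) 0
    else trivial
  else if fam == 4 then sel s (pos_lit (ctrl_var t 0)) 0 0 0
  else if fam == 5 then sel s (neg_lit (ctrl_var t nz)) 0 0 0
  else if fam == 6 then
    if (t == 0) && (finite_table nz 1 not_start z 0 != 0) then sel s c0 c1 0 0 else trivial
  else if fam == 7 then
    if (t == T) && (finite_table nz 1 not_accepting z 0 != 0) then sel s c0 c1 0 0
    else trivial
  else if fam == 8 then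
    if [&& i == 1, T.+1 <= j & j - T.+1 < len] then trivial
    else sel s (pos_lit (cell_var 0 i j (initial i j))) 0 0 0
  else if (i == 1) && (j < len) then
    if fam == 9 then sel s (neg_lit (len_var j)) (neg_lit (bit_var j))
      (pos_lit (cell_var 0 i (T.+1 + j) (aindex (Some (inl true))))) 0
    else if fam == 10 then sel s (neg_lit (len_var j)) (pos_lit (bit_var j))
      (pos_lit (cell_var 0 i (T.+1 + j) (aindex (Some (inl false))))) 0
    else if fam == 11 then sel s (pos_lit (len_var j))
      (pos_lit (cell_var 0 i (T.+1 + j) (aindex None))) 0 0
    else sel s (neg_lit (len_var j.+1)) (pos_lit (len_var j)) 0 0
  else trivial.

(* A clause index is read in mixed radix [13, T.+1, nt, nz, nz + na, 2 * T + 2]. *)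
Definition fam_of k := k %/ 4 %% 13.
Definition t_of k := k %/ 4 %/ 13 %% T.+1.
Definition i_of k := k %/ 4 %/ 13 %/ T.+1 %% nt.
Definition z_of k := k %/ 4 %/ 13 %/ T.+1 %/ nt %% nz.
Definition y_of k := k %/ 4 %/ 13 %/ T.+1 %/ nt %/ nz %% (nz + na).
Definition j_of k := k %/ 4 %/ 13 %/ T.+1 %/ nt %/ nz %/ (nz + na).
Definition nclauses := 13 * (T.+1 * (nt * (nz * ((nz + na) * (2 * T + 2))))).

Definition tableau_lit k :=
  clause (fam_of k) (t_of k) (i_of k) (z_of k) (y_of k) (j_of k) (k %% 4).

End Tableau.

Lemma D_tableau (M : machine) (len time : word -> nat) :
  D (fun c : ctx 0 => len c.1) -> D (fun c : ctx 0 => time c.1) ->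
  D (fun c : ctx 1 => tableau_lit M c.1.1 (len c.1.1) (time c.1.1) c.2) /\
  D (fun c : ctx 0 => nclauses M (time c.1)).
Proof.
move=> Dl DT; split; last by unfold nclauses; definable.
have DS : D (fun c : ctx 0 => stride (time c.1)) by unfold stride; definable.
have Df : DF1 (fun c k => fam_of k) by apply: DF1I; unfold fam_of; definable.
have Dt : DF1 (fun c k => t_of (time c.1) k) by apply: DF1I; unfold t_of; definable.
have Di : DF1 (fun c k => i_of M (time c.1) k) by apply: DF1I; unfold i_of; definable.
have Dz : DF1 (fun c k => z_of M (time c.1) k) by apply: DF1I; unfold z_of; definable.
have Dy : DF1 (fun c k => y_of M (time c.1) k) by apply: DF1I; unfold y_of; definable.
have Dj : DF1 (fun c k => j_of M (time c.1) k) by apply: DF1I; unfold j_of; definable.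
unfold tableau_lit, clause, initial, cell_var, ctrl_var, len_var, bit_var, pos_lit,
  neg_lit, sel.
definable.
Qed.

(** A ladder that starts true and ends false drops somewhere; this provides a value of the control
    without a clause that lists all values. *)
Lemma bool_drop n (P : nat -> bool) : P 0 -> ~~ P n -> exists2 z, z < n & P z && ~~ P z.+1.
Proof.
elim: n => [P0|n IH P0 Pn]; first by rewrite P0.
case: (boolP (P n)) => Pn'; first by exists n; rewrite ?Pn'.
by have [z lt_z Hz] := IH P0 Pn'; exists z; rewrite // leqW.
Qed.

Lemma radix_lt x X y n : x < X -> y < n -> x * n + y < X * n.
Proof.
move=> lx ly; have : x.+1 * n <= X * n by rewrite leq_mul2r lx orbT.
by rewrite mulSn; move: (x * n) (X * n) => p q; lia.
Qed.

Lemma radix_mod q a x : x < a -> (q * a + x) %% a = x.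
Proof. by move=> lt_x; rewrite modnMDl modn_small. Qed.

Lemma radix_div q a x : x < a -> (q * a + x) %/ a = q.
Proof.
by move=> lt_x; rewrite divnMDl ?divn_small ?addn0 //; apply: leq_ltn_trans lt_x.
Qed.

(** * Correctness of the tableau *)

Section TableauCorrect.

Variables (M : machine) (w : word) (len T : nat).

Let nt := (ntapes M).+1.

Notation nz := (nz M).
Notation na := (na M).
Notation zof := (zof M).
Notation clause := (clause M w len T).
Notation cell_var := (cell_var M T).
Notation ctrl_var := (ctrl_var M).

Definition all_clauses v := forall fam t i z y j,
  fam < 13 -> t <= T -> i < nt -> z < nz -> y < nz + na -> j < 2 * T + 2 ->
  csat v (clause fam t i z y j).

Lemma satisfies_tableau v :
  satisfies (nclauses M T) (tableau_lit M w len T) v <-> all_clauses v.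
Proof.
have nz0 : 0 < nz by apply: leq_ltn_trans (zindex_lt (start M, [ffun=> None])).
split=> [sat fam t i z y j lf lt li lz ly lj|all c lt_c].
  pose c := ((((j * (nz + na) + y) * nz + z) * nt + i) * T.+1 + t) * 13 + fam.
  have lt_c : c < nclauses M T.
    rewrite /nclauses -/nt [ltnRHS]mulnC; apply: radix_lt => //.
    rewrite [ltnRHS]mulnC; apply: radix_lt => //.
    rewrite [ltnRHS]mulnC; apply: radix_lt => //.
    rewrite [ltnRHS]mulnC; apply: radix_lt => //.
    by rewrite [ltnRHS]mulnC; apply: radix_lt.
  have [s lt_s H] := sat c lt_c; exists s => //; move: H.
  rewrite /tableau_lit /fam_of /t_of /i_of /z_of /y_of /j_of -/nt mulnC.
  rewrite (radix_div _ lt_s) (radix_mod _ lt_s) /c (radix_div _ lf) (radix_mod _ lf).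
  rewrite (radix_div _ (lt : t < T.+1)) (radix_mod _ (lt : t < T.+1)).
  rewrite (radix_div _ li) (radix_mod _ li) (radix_div _ lz) (radix_mod _ lz).
  by rewrite (radix_div _ ly) (radix_mod _ ly).
have E4 s : s < 4 -> (4 * c + s) %/ 4 = c /\ (4 * c + s) %% 4 = s.
  by move=> lt_s; rewrite mulnC radix_div // radix_mod.
have fields s : s < 4 -> tableau_lit M w len T (4 * c + s) =
   clause (fam_of (4 * c)) (t_of T (4 * c)) (i_of M T (4 * c)) (z_of M T (4 * c))
          (y_of M T (4 * c)) (j_of M T (4 * c)) s.
  move=> lt_s; have [Es Em] := E4 s lt_s; have [E0 _] := E4 0 isT; rewrite addn0 in E0.
  by rewrite /tableau_lit /fam_of /t_of /i_of /z_of /y_of /j_of Es Em E0.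
have [E0 _] := E4 0 isT; rewrite addn0 in E0.
have [s lt_s H] : csat v (clause (fam_of (4 * c)) (t_of T (4 * c)) (i_of M T (4 * c))
    (z_of M T (4 * c)) (y_of M T (4 * c)) (j_of M T (4 * c))).
  apply: all; rewrite /fam_of /t_of /i_of /z_of /y_of /j_of E0 ?ltn_mod //.
  - by rewrite -ltnS ltn_mod.
  - by rewrite addn_gt0 nz0.
  - rewrite !ltn_divLR ?addn_gt0 ?nz0 //; apply: leq_trans lt_c _.
    rewrite /nclauses -/nt [13 * _]mulnC [T.+1 * _]mulnC [nt * _]mulnC [nz * _]mulnC.
    by rewrite [(nz + na) * _]mulnC.
by exists s => //; rewrite fields.
Qed.

Definition cont (tp : tape (aux M)) j :=
  if T.+1 <= j then nth None (rhs tp) (j - T.+1) else nth None (lhs tp) (T - j).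

Lemma cont_head tp : cont tp T.+1 = scan tp.
Proof. by rewrite /cont leqnn subnn nth0. Qed.

Lemma cont_act tp x m j :
  cont (act tp (x, m)) (j + shift m) = if j == T then x else cont tp j.+1.
Proof.
have below a b : a < b -> (b <= a) = false by lia.
rewrite /cont; case: m => /=.
- rewrite addn2; case: (ltngtP j T) => [lt_j|lt_j|->].
  + rewrite (below j.+1 T.+1) //; case: (leqP T.+1 j.+2) => [le|gt].
      have -> : j.+2 - T.+1 = 0 by lia.
      have -> : T - j.+1 = 0 by lia.
      by rewrite /= nth0.
    by rewrite nth_behead; congr nth; lia.
  + rewrite ifT; last by lia.
    rewrite ifT; last by lia.
    have -> : j.+2 - T.+1 = (j - T.+1).+2 by lia.
    by rewrite /= nth_behead; congr nth; lia.
  + by rewrite leqnSn; have -> : T.+2 - T.+1 = 1 by lia.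
- rewrite addn1; case: (ltngtP j T) => [lt_j|lt_j|->].
  + by rewrite (below j.+1 T.+1).
  + rewrite ifT; last by lia.
    rewrite ifT; last by lia.
    have -> : j.+1 - T.+1 = (j - T.+1).+1 by lia.
    by rewrite /= nth_behead.
  + by rewrite leqnn subnn.
- rewrite addn0; case: (ltngtP j T) => [lt_j|lt_j|->].
  + rewrite /= (below j.+1 T.+1) //.
    by have -> : T - j = (T - j.+1).+1 by lia.
  + rewrite /= ifT; last by lia.
    by rewrite nth_behead; congr nth; lia.
  + by rewrite /= subnn.
Qed.

Section Run.

Variable u : word.

Definition run t := iter t (@step M) (init M [:: w; u]).

Definition ctrl t : state M * {ffun 'I_nt -> cell (aux M)} :=
  ((run t).1, [ffun i => scan ((run t).2 i)]).

Lemma run_state t : (run t.+1).1 = (ctrl_next (ctrl t)).1.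
Proof.
rewrite /run iterS -/(run t) /step /ctrl_next /ctrl /= /halted; case: ifP => // _.
by case: (delta _ _).
Qed.

Lemma run_cont t i j : let d := (ctrl_next (ctrl t)).2 i in
  cont ((run t.+1).2 i) (j + shift d.2) = if j == T then d.1 else cont ((run t).2 i) j.+1.
Proof.
rewrite /run iterS -/(run t) /step /ctrl_next /ctrl /= /halted; case: ifP => _ /=.
  rewrite !ffunE /= addn1; case: eqP => // ->; exact: cont_head.
by case: (delta _ _) => q d /=; rewrite ffunE; case: (d i) => x m; apply: cont_act.
Qed.

Lemma run_initial (i : 'I_nt) j : cont ((run 0).2 i) j =
  if T.+1 <= j then nth None [seq Some (inl b) | b <- nth [::] [:: w; u] i] (j - T.+1)
  else None.
Proof. by rewrite /run /= /cont ffunE /=; case: ifP => // _; rewrite nth_nil. Qed.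

End Run.

Definition selected (v : nat -> bool) t z := v (ctrl_var t z) && ~~ v (ctrl_var t z.+1).

Section Soundness.

Variable v : nat -> bool.
Hypothesis all : all_clauses v.

Let nz0 : 0 < nz.
Proof. exact: leq_ltn_trans (zindex_lt (start M, [ffun=> None])). Qed.

Let y0 : 0 < nz + na.
Proof. by rewrite addn_gt0 nz0. Qed.

Let j0 : 0 < 2 * T + 2.
Proof. by rewrite addn2. Qed.

Lemma exists_selected t : t <= T -> exists2 z, z < nz & selected v t z.
Proof.
move=> le_t; apply: bool_drop.
  have := @all 4 t 0 0 0 0 isT le_t isT nz0 y0 j0; rewrite /clause /= => /csat_sel.
  by rewrite holds_pos /holds /= !orbF.
have := @all 5 t 0 0 0 0 isT le_t isT nz0 y0 j0; rewrite /clause /= => /csat_sel.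
by rewrite holds_neg /holds /= !orbF.
Qed.

Lemma selected_clause t z l2 l3 : selected v t z ->
  csat v (fun s => sel s (neg_lit (ctrl_var t z)) (pos_lit (ctrl_var t z.+1)) l2 l3) ->
  holds v l2 || holds v l3.
Proof. by case/andP=> h1 h2 /csat_sel; rewrite holds_neg holds_pos h1 (negbTE h2). Qed.

Let holds0 : holds v 0 = false.
Proof. by []. Qed.

(** Families 9 to 12 exist only for [j < 2 * T + 2], so the length of the guess is read off up to
    there; cells further away are out of reach within [T] steps. *)
Let bound := minn len (2 * T + 2).
Let L := find (fun k => ~~ v (len_var k)) (iota 0 bound).

Definition guess := mkseq (fun k => v (bit_var k)) L.

Lemma guess_size : size guess <= len.
Proof.
rewrite size_mkseq; apply: leq_trans (find_size _ _) _.
by rewrite size_iota geq_minl.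
Qed.

Lemma len_var_in k : k < L -> v (len_var k).
Proof.
move=> lt_k; have := before_find 0 lt_k; rewrite nth_iota; first by move/negbFE.
by apply: leq_trans lt_k _; have := find_size (fun k => ~~ v (len_var k)) (iota 0 bound); rewrite size_iota.
Qed.

(** Family 12 makes the length variables decreasing in [k]. It is attached to tape 1, hence the
    assumption that a second tape exists. *)
Lemma len_var_out k : 1 < nt -> L <= k -> k < bound -> ~~ v (len_var k).
Proof.
move=> nt1; elim: k => [|k IH] le_k lt_k.
  have lt_L : L < bound by lia.
  have : has (fun k => ~~ v (len_var k)) (iota 0 bound) by rewrite has_find size_iota.
  move/(nth_find 0); rewrite -/L nth_iota // add0n.
  by have -> : L = 0 by lia.
move: le_k; rewrite leq_eqVlt => /predU1P[EL|lt_L].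
  have : has (fun k => ~~ v (len_var k)) (iota 0 bound) by rewrite has_find size_iota -/L EL.
  by move/(nth_find 0); rewrite -/L nth_iota EL.
have lt_k' : k < bound by lia.
have := IH lt_L lt_k'; apply: contra => Hk.
have lk : k < 2 * T + 2 by rewrite /bound in lt_k'; lia.
have := @all 12 0 1 0 0 k isT isT nt1 nz0 y0 lk; rewrite /clause /=.
have -> : k < len by rewrite /bound in lt_k'; lia.
by move/csat_sel; rewrite holds_neg holds_pos Hk !holds0 /= orbF.
Qed.

Lemma initial_cells (i : 'I_nt) j : 0 < j -> j < 2 * T.+1 ->
  v (cell_var 0 i j (aindex (cont ((run guess 0).2 i) j))).
Proof.
move=> lt0j lt_j; rewrite run_initial; have lj : j < 2 * T + 2 by lia.
case Eg : [&& nat_of_ord i == 1, T.+1 <= j & j - T.+1 < len]; last first.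
  have := @all 8 0 i 0 0 j isT isT (ltn_ord i) nz0 y0 lj; rewrite /clause /= Eg.
  move/csat_sel; rewrite holds_pos !holds0 !orbF; congr (v (cell_var _ _ _ _)).
  rewrite /initial; case: (leqP T.+1 j) => [le_j|]; last by rewrite andbF.
  case: i Eg => [[|[|i]] lti] /=.
  - move=> _; case: (ltnP (j - T.+1) (size w)) => [lt_w|le_w].
      by rewrite (nth_map false) //; case: nth.
    by rewrite nth_default ?size_map.
  - rewrite le_j /= => /negbT; rewrite -leqNgt => le_l.
    by rewrite nth_default // size_map; apply: leq_trans guess_size _.
  - by rewrite !nth_nil.
case/and3P: Eg => /eqP Ei le_j lt_l; rewrite le_j Ei /=.
have nt1 : 1 < nt by rewrite -Ei.
set k := j - T.+1 in lt_l *; have Ej : j = T.+1 + k by rewrite /k; lia.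
have lk : k < 2 * T + 2 by rewrite /k; lia.
have lkb : k < bound by rewrite /bound; lia.
have H f (lf : f < 13) := @all f 0 1 0 0 k lf isT nt1 nz0 y0 lk.
case: (ltnP k L) => [lt_kL|le_kL].
  have vl := len_var_in lt_kL.
  rewrite (nth_map false) ?size_mkseq // nth_mkseq // Ej.
  case Eb : (v (bit_var k)).
    have := H 9 isT; rewrite /clause /= lt_l => /csat_sel.
    by rewrite !holds_neg holds_pos vl Eb !holds0 /= orbF.
  have := H 10 isT; rewrite /clause /= lt_l => /csat_sel.
  by rewrite holds_neg !holds_pos vl Eb !holds0 /= orbF.
rewrite nth_default; last by rewrite size_map /guess size_mkseq.
rewrite Ej.
have := H 11 isT; rewrite /clause /= lt_l => /csat_sel.
by rewrite !holds_pos (negbTE (len_var_out nt1 le_kL lkb)) !holds0 /= !orbF.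
Qed.

(** The range of known cells loses one cell at each end per step and shrinks to the head index
    [T.+1] at time [T]. The valuation may declare several symbols for a cell or select several [z];
    it suffices that the true symbols are declared and that every selected [z] is the true
    control. *)
Lemma tableau_invariant t : t <= T ->
  (forall (i : 'I_nt) j, t < j -> j < 2 * T.+1 - t ->
     v (cell_var t i j (aindex (cont ((run guess t).2 i) j)))) /\
  (forall z, z < nz -> selected v t z -> zof z = ctrl guess t).
Proof.
have scan_ok t' : t' <= T -> (forall (i : 'I_nt) j, t' < j -> j < 2 * T.+1 - t' ->
     v (cell_var t' i j (aindex (cont ((run guess t').2 i) j)))) ->
   forall z, z < nz -> selected v t' z -> (zof z).1 = (run guess t').1 -> zof z = ctrl guess t'.
  move=> le_t Hc z lt_z sz Es; rewrite [LHS]surjective_pairing Es; congr (_, _).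
  apply/ffunP => i; rewrite ffunE -cont_head.
  have Hh := Hc i T.+1 (ltac:(lia)) (ltac:(lia)).
  set x := cont _ _ in Hh *; have lx : aindex x < nz + na by rewrite ltn_addl ?aindex_lt.
  have := @all 1 t' i z (aindex x) 0 isT le_t (ltn_ord i) lt_z lx j0.
  rewrite /clause /= aindex_lt tableE //; case: eqP => [E _|_].
    by rewrite -(aindexK x) -E aindexK inord_val.
  by move/(selected_clause sz); rewrite holds_neg Hh.
elim: t => [|t IH] le_t.
  split; first by move=> i j lt0 lt_j; apply: initial_cells => //; rewrite subn0 in lt_j.
  move=> z lt_z sz; apply: scan_ok => //.
    by move=> i j lt0 lt_j; apply: initial_cells => //; rewrite subn0 in lt_j.
  have := @all 6 0 0 z 0 0 isT isT isT lt_z y0 j0.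
  rewrite /clause /= tableE // /not_start; case: (_ =P start M) => //= _.
  by move/(selected_clause sz).
have [Hc Hz] := IH (ltnW le_t); have [z lt_z sz] := exists_selected (ltnW le_t).
have Ez := Hz z lt_z sz.
have cells (i : 'I_nt) j : t.+1 < j -> j < 2 * T.+1 - t.+1 ->
   v (cell_var t.+1 i j (aindex (cont ((run guess t.+1).2 i) j))).
  move=> lt1 lt2; have Rc := run_cont guess t i; rewrite -Ez in Rc.
  have Esh : shifted M z i = shift ((ctrl_next (zof z)).2 i).2.
    by rewrite /shifted inord_val.
  have Ewr : written M z i = aindex ((ctrl_next (zof z)).2 i).1.
    by rewrite /written inord_val.
  have sh2 : shifted M z i <= 2 by rewrite Esh; case: (_.2).
  (* The cell now at [j] was at [j'.+1] before the step; [j' = T] means that it was the scanned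
     cell. *)
  pose j' := j - shifted M z i.
  have Ej : j = j' + shifted M z i by rewrite /j'; lia.
  have := Rc j'; rewrite /= -Esh -Ej => ->.
  have lj' : j' < 2 * T + 2 by lia.
  case: (j' =P T) => [ET|nT].
    have := @all 3 t i z 0 0 isT (ltnW le_t) (ltn_ord i) lt_z y0 j0.
    rewrite /clause /= le_t !tableE // => /(selected_clause sz).
    by rewrite holds0 orbF holds_pos Ewr Ej ET.
  have Hs := Hc i j'.+1 (ltac:(lia)) (ltac:(lia)).
  set x := cont _ _ in Hs *; have lx : aindex x < nz + na by rewrite ltn_addl ?aindex_lt.
  have := @all 2 t i z (aindex x) j' isT (ltnW le_t) (ltn_ord i) lt_z lx lj'.
  rewrite /clause /= le_t aindex_lt /= (introF eqP nT) /= tableE //.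
  by move=> /(selected_clause sz); rewrite holds_neg holds_pos Hs -Ej.
split=> // z' lt_z' sz'; apply: scan_ok => //.
have ly : z' < nz + na by rewrite ltn_addr.
have := @all 0 t 0 z z' 0 isT (ltnW le_t) isT lt_z ly j0.
rewrite /clause /= le_t tableE // /mismatch Ez -run_state; case: (_ =P (run guess t.+1).1) => //= _.
move/(selected_clause sz); rewrite holds_neg holds_pos.
by case/andP: sz' => -> /negbTE ->.
Qed.

Lemma tableau_sound : scan ((run guess T).2 ord0) = Some (inl true).
Proof.
have [_ Hz] := tableau_invariant (leqnn T).
have [z lt_z sz] := exists_selected (leqnn T); have Ez := Hz z lt_z sz.
have := @all 7 T 0 z 0 0 isT (leqnn T) isT lt_z y0 j0.
rewrite /clause /= eqxx /= tableE // /not_accepting Ez ffunE; case: (_ =P Some (inl true)) => // _.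
by move/(selected_clause sz).
Qed.

End Soundness.

Section Completeness.

Variable u : word.
Hypothesis size_u : size u <= len.
Hypothesis accept : scan ((run u T).2 ord0) = Some (inl true).

(** The residue modulo 3 tells the kinds of variables apart: cells, ladder, and length or bit of the
    guess, the latter two separated by parity. *)
Definition run_valuation x :=
  let k := x %/ 3 in
  if x %% 3 == 0 then
    cont ((run u (k %/ na %/ stride T %/ nt)).2 (inord (k %/ na %/ stride T %% nt)))
         (k %/ na %% stride T) == sym M (k %% na)
  else if x %% 3 == 1 then k %% nz.+1 <= zindex (ctrl u (k %/ nz.+1))
  else if odd k then nth false u (k %/ 2) else k %/ 2 < size u.

Lemma valuation_cell t (i : 'I_nt) j a : j < stride T -> a < na ->
  run_valuation (cell_var t i j a) = (cont ((run u t).2 i) j == sym M a).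
Proof.
move=> lj la; rewrite /run_valuation /cell_var -/nt.
set k := (_ * na + a); have -> : (3 * k) %% 3 = 0 by rewrite modnMr.
rewrite /= mulKn // /k (radix_div _ la) (radix_mod _ la) (radix_div _ lj) (radix_mod _ lj).
by rewrite radix_div // radix_mod // inord_val.
Qed.

Lemma valuation_ctrl t z : z <= nz ->
  run_valuation (ctrl_var t z) = (z <= zindex (ctrl u t)).
Proof.
move=> lz; rewrite /run_valuation /ctrl_var mulnC (radix_mod _ (isT : 1 < 3)) /=.
by rewrite (radix_div _ (isT : 1 < 3)) radix_mod // radix_div.
Qed.

Lemma valuation_len k : run_valuation (len_var k) = (k < size u).
Proof.
rewrite /run_valuation /len_var mulnC (radix_mod _ (isT : 2 < 3)) /=.
by rewrite (radix_div _ (isT : 2 < 3)) mul2n odd_double -muln2 mulnK.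
Qed.

Lemma valuation_bit k : run_valuation (bit_var k) = nth false u k.
Proof.
rewrite /run_valuation /bit_var mulnC (radix_mod _ (isT : 2 < 3)) /=.
rewrite (radix_div _ (isT : 2 < 3)) mulnC (radix_div _ (isT : 1 < 2)).
by rewrite oddD muln2 odd_double.
Qed.

Lemma csat_ctrl t z l2 l3 : z < nz ->
  (zof z = ctrl u t -> holds run_valuation l2 || holds run_valuation l3) ->
  csat run_valuation (fun s =>
    sel s (neg_lit (ctrl_var t z)) (pos_lit (ctrl_var t z.+1)) l2 l3).
Proof.
move=> lz H; apply/csat_sel; rewrite holds_neg holds_pos.
rewrite (valuation_ctrl t (ltnW lz)) (valuation_ctrl t lz) -ltnNge; case: (ltngtP z (zindex (ctrl u t))) => // E.
by apply: H; rewrite E zindexK.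
Qed.

Lemma csat_trivial v : csat v (fun s => sel s (pos_lit 0) (neg_lit 0) 0 0).
Proof. by apply/csat_sel; rewrite holds_pos holds_neg; case: (v 0). Qed.

Lemma tableau_complete : all_clauses run_valuation.
Proof.
have triv := csat_trivial run_valuation.
move=> fam t i0 z y j lf lt li lz ly lj.
suff {i0 li} : forall i : 'I_nt, csat run_valuation (clause fam t i z y j) by move/(_ (Ordinal li)).
move=> i.
have Ezi : zof z = ctrl u t -> forall d, d = (ctrl_next (ctrl u t)).2 i ->
    shifted M z i = shift d.2 /\ written M z i = aindex d.1.
  by move=> Ez d ->; rewrite /shifted /written Ez inord_val.
have lh : T.+1 < stride T by rewrite /stride; lia.
have init_cell j' : j' < stride T ->
   run_valuation (cell_var 0 i j' (aindex (cont ((run u 0).2 i) j'))).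
  by move=> lj'; rewrite valuation_cell ?aindex_lt // aindexK.
have guess_cell : nat_of_ord i = 1 -> cont ((run u 0).2 i) (T.+1 + j) =
    nth None [seq Some (inl b) | b <- u] j.
  by move=> Ei; rewrite run_initial leq_addr addKn Ei.
(* Cell indices reach [3 * T + 2] here and [2 * T + 3] in family 2; both are below the stride, so
   they decode correctly. *)
have lgj : T.+1 + j < stride T by rewrite /stride; lia.
case: fam lf => [|[|[|[|[|[|[|[|[|fam]]]]]]]]] lf; rewrite /clause /=.
- case E : (_ && _); last exact: triv.
  case/andP: E => lt_t; case: (ltnP y nz) => [lz'|ge]; last by rewrite table_out.
  rewrite tableE // => mis; apply: csat_ctrl => // Ez.
  rewrite holds_neg holds_pos (valuation_ctrl t.+1 (ltnW lz')) (valuation_ctrl t.+1 lz') -ltnNge.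
  case: (ltngtP y (zindex (ctrl u t.+1))) => // Ey.
  by move: mis; rewrite /mismatch Ey zindexK Ez /= run_state eqxx.
- case E : (_ && _); last exact: triv.
  case/andP: E => la; rewrite tableE // => neq; apply: csat_ctrl => // Ez.
  rewrite holds_neg valuation_cell // cont_head; apply/orP; left.
  apply: contra neq => /eqP Es; rewrite /scanned inord_val Ez ffunE Es.
  by rewrite symK.
- case E : (_ && _); last exact: triv.
  case/and3P: E => lt_t la nT; apply: csat_ctrl => // Ez.
  have [Esh _] := Ezi Ez _ erefl; rewrite tableE // holds_neg holds_pos.
  have sh2 : shifted M z i <= 2 by rewrite Esh; case: (_.2).
  rewrite !valuation_cell //; try by rewrite /stride; lia.
  by rewrite Esh run_cont (negbTE nT) orNb.
- case lt_t : (t < T); last exact: triv.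
  apply: csat_ctrl => // Ez.
  have [Esh Ewr] := Ezi Ez _ erefl; rewrite !tableE // holds_pos.
  have sh2 : shifted M z i <= 2 by rewrite Esh; case: (_.2).
  rewrite valuation_cell ?Ewr ?aindex_lt //; last by rewrite /stride; lia.
  by rewrite Esh run_cont eqxx aindexK eqxx.
- by apply/csat_sel; rewrite holds_pos valuation_ctrl.
- by apply/csat_sel; rewrite holds_neg valuation_ctrl // -ltnNge zindex_lt.
- case E : (_ && _); last exact: triv.
  case/andP: E => /eqP t0; rewrite tableE // => ns; apply: csat_ctrl => // Ez.
  by move: ns; rewrite /not_start Ez t0 /= eqxx.
- case E : (_ && _); last exact: triv.
  case/andP: E => /eqP tT; rewrite tableE // => ns; apply: csat_ctrl => // Ez.
  by move: ns; rewrite /not_accepting Ez tT ffunE accept eqxx.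
- case Eg : (_ && _); first exact: triv.
  apply/csat_sel; rewrite holds_pos; apply/orP; left.
  have -> : initial M w T i j = aindex (cont ((run u 0).2 i) j).
    rewrite run_initial /initial; case: (leqP T.+1 j) => [le_j|]; last by rewrite andbF.
    move: Eg; rewrite le_j /=; case: (nat_of_ord i) => [|[|i']] /=.
    - move=> _; case: (ltnP (j - T.+1) (size w)) => [lt_w|le_w].
        by rewrite (nth_map false) //; case: nth.
      by rewrite nth_default ?size_map.
    - move=> /negbT; rewrite -leqNgt => le_l.
      by rewrite nth_default // size_map; apply: leq_trans size_u _.
    - by rewrite !nth_nil.
  by apply: init_cell; rewrite /stride; lia.
case E : (_ && _); last exact: triv.
case/andP: E => /eqP Ei lt_l.
have := init_cell _ lgj; rewrite guess_cell //.
case: (ltnP j (size u)) => [lu|ge].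
  rewrite (nth_map false) // => Hc.
  case: fam lf => [|[|[|fam]]] lf /=.
  - apply/csat_sel; rewrite !holds_neg holds_pos valuation_bit.
    by move: Hc; case: (nth false u j) => [->|_]; rewrite ?orbT.
  - apply/csat_sel; rewrite holds_neg !holds_pos valuation_bit.
    by move: Hc; case: (nth false u j) => [_|->]; rewrite ?orbT.
  - by apply/csat_sel; rewrite !holds_pos valuation_len lu.
  - by apply/csat_sel; rewrite !holds_pos valuation_len lu orbT.
rewrite nth_default ?size_map // => Hc.
case: fam lf => [|[|[|fam]]] lf /=.
- by apply/csat_sel; rewrite holds_neg valuation_len -leqNgt ge.
- by apply/csat_sel; rewrite holds_neg valuation_len -leqNgt ge.
- by apply/csat_sel; rewrite !holds_pos Hc orbT.
- by apply/csat_sel; rewrite holds_neg valuation_len -leqNgt leqW.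
Qed.

End Completeness.

Lemma tableau_correct : (exists v, satisfies (nclauses M T) (tableau_lit M w len T) v) <->
  exists2 u, size u <= len & scan ((run u T).2 ord0) = Some (inl true).
Proof.
split=> [[v /satisfies_tableau all]|[u su acc]].
  by exists (guess v); [apply: guess_size | apply: tableau_sound].
by exists (run_valuation u); apply/satisfies_tableau; apply: tableau_complete.
Qed.

End TableauCorrect.

(** * NP-hardness *)

Lemma leq_expr m n d : m <= n -> m ^ d <= n ^ d.
Proof. by case: d => // d; rewrite leq_exp2r. Qed.

Lemma run_accepts M w u (b : bool) t T :
  computes_within M [:: w; u] [:: b] t -> t <= T ->
  scan ((run M w u T).2 ord0) = Some (inl b).
Proof.
move=> [hc out] le_t; rewrite /run -(subnK le_t) iterD iter_step_halted //.
move: out; rewrite /output /scan; case: (rhs _) => [|[[b'|]|] r] //=.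
by case=> ->.
Qed.

Lemma restricted_ICS_Ext_hard : NP_hard (@restrict ICS_Ext restriction).
Proof.
move=> L [V [[M [c [d HM]]] [c' [d' HL]]]].
pose len (w : word) := c' * size w ^ d' + c'.
(* A single time bound serves all certificates of length at most [len w]: it is monotone in their
   length, and a halted run does not change. *)
pose time (w : word) := c * (size w + len w) ^ d + c.
have Dlen : D (fun p : ctx 0 => len p.1) by unfold len; definable.
have Dtime : D (fun p : ctx 0 => time p.1) by unfold time; definable.
have [Dlit Dm] := D_tableau M Dlen Dtime.
pose lit w := tableau_lit M w (len w) (time w).
(* The number of variables only has to dominate the literals, and the sum of all literals is a
   definable bound. *)
pose Y w := nsum (4 * nclauses M (time w)) (lit w).
have DL : DF1 (fun p k => lit p.1 k) by apply: DF1I.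
have DY : D (fun p : ctx 0 => Y p.1) by unfold Y; definable.
have lit_le w k : k < 4 * nclauses M (time w) -> lit w k <= 2 * Y w.
  move=> lt_k; suff : lit w k <= Y w by lia.
  by rewrite /Y /nsum (bigD1 (Ordinal lt_k)) //= leq_addr.
have [f Pf Hf] := cnf_reduction DY Dm Dlit lit_le.
exists f; split=> // w; have [I [rI cI yI]] := Hf w; exists I; split=> //.
rewrite HL /= yI tableau_correct.
have acc u : size u <= len w -> scan ((run M w u (time w)).2 ord0) = Some (inl (V w u)).
  move=> le_u; apply: run_accepts (HM (w, u)) _.
  by rewrite leq_add2r leq_mul2l leq_expr ?orbT //= addn0 leq_add2l.
split=> [[u [le_u Vu]]|[u le_u]]; first by exists u; rewrite ?acc ?Vu.
by rewrite acc // => -[Vu]; exists u.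
Qed.

Lemma NP_hard_restrict P (dom : instance P -> Prop) : NP_hard (restrict dom) -> NP_hard P.
Proof.
move=> hard L /hard[f [Pf Hf]]; exists f; split=> // w.
by have [i [[_ ci] Hi]] := Hf w; exists i.
Qed.

Theorem theorem42 :
  NP_complete ICS_Ext /\
  NP_complete
    (@restrict ICS_Ext (fun I : ics_instance =>
       acyclic (Sigma I) /\
       degree (Sigma I) <= 4 /\
       premise_degree (Sigma I) <= 4 /\
       conclusion_degree (Sigma I) <= 2 /\
       dimension (Sigma I) <= 2 /\
       K I = set0)).
Proof.
split; split.
- exact: ICS_Ext_in_NP.
- exact: NP_hard_restrict restricted_ICS_Ext_hard.
- exact: restricted_ICS_Ext_in_NP.
- exact: restricted_ICS_Ext_hard.
Qed.
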